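(* Let $(M,\lambda,J)$ be a contact triad with $M$ compact. Let $(\dot\Sigma,j)$ be a punctured Riemann surface with a possibly empty set of punctures, equipped with a metric $h$ (compatible with $j$) that is cylindrical near each puncture. For any relatively compact domains $D_1$ and $D_2$ in $\dot\Sigma$ such that $\overline{D_1}\subset D_2$, there are constants $C_1,C_2$, depending only on $D_1$, $D_2$ and $(M,\lambda,J)$, such that for every contact instanton $w:\dot\Sigma\to M$, $$ \|dw\|^2_{W^{1,2}(D_1)}\leq C_1 \|dw\|^2_{L^2(D_2)} + C_2 \|dw\|^4_{L^4(D_2)}. $$
   Context: Contact triad: $M$ is a smooth $(2n+1)$-dimensional manifold with a co-oriented contact structure $\xi=\ker\lambda$, where $\lambda$ is a contact form. The Reeb vector field $X_\lambda$ is defined by $\lambda(X_\lambda)=1$, $X_\lambda\rfloor d\lambda=0$. $J:\xi\to\xi$ is an endomorphism with $J^2=-\mathrm{id}$, compatible with $d\lambda$ in the sense that $g_\xi=d\lambda(\cdot,J\cdot)$ makes $(\xi,J,g_\xi)$ a Hermitian vector bundle; $J$ is extended to $TM$ by $JX_\lambda=0$. The triple $(M,\lambda,J)$ is called a contact triad and $M$ carries the triad metric $g=g_\xi+\lambda\otimes\lambda$. $\pi:TM\to\xi$ is the projection along $X_\lambda$. Contact triad connection: $\nabla$ denotes the unique affine connection on $M$ (its existence and uniqueness are known) with torsion $T(X,Y)=\nabla_XY-\nabla_YX-[X,Y]$ such that: (1) $\nabla g=0$; (2) $T(X_\lambda,\cdot)=0$; (3) $\nabla_{X_\lambda}X_\lambda=0$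 and $\nabla_YX_\lambda\in\xi$ for $Y\in\xi$; (4) $\nabla^\pi:=\pi\nabla|_\xi$ is a Hermitian connection on $(\xi,d\lambda|_\xi,J)$; (5) $T^\pi:=\pi T$ satisfies $T^\pi(JY,Y)=0$ for all $Y\in\xi$; (6) $\nabla_YX_\lambda-J\nabla_{JY}X_\lambda=0$ for $Y\in\xi$. A contact instanton is a smooth map $w:\dot\Sigma\to M$ satisfying $\overline{\partial}^\pi w:=\frac12(\pi dw+J\pi dw\circ j)=0$ and $d(w^*\lambda\circ j)=0$. The covariant derivative $\nabla(dw)$ of the $w^*TM$-valued $1$-form $dw$ is taken with respect to the connection on $T^*\dot\Sigma\otimes w^*TM$ induced by the Levi-Civita connection of $h$ and the pull-back of the contact triad connection; norms are those induced by $h$ and $g$, and $\|dw\|^2_{W^{1,2}(D_1)}=\int_{D_1}(|dw|^2+|\nabla(dw)|^2)$. The metric $h$ is fixed. ''Cylindrical near each puncture'' means that a punctured disc neighbourhood of the puncture is isometric to $[0,\infty)\times S^1$ or $(-\infty,0]\times S^1$ with the metric $d\tau^2+dt^2$. *)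

(* Defs.v *)
(* Manifolds are given by atlases.  A tensor field or an affine connection is
   given by its components in every chart, subject to the usual transformation
   law under changes of charts.  Tangent vectors at a point of a chart are row
   vectors of components; a linear endomorphism A acts on them by v |-> v *m A.
   Objects living on an open subset W of a manifold (such as a punctured
   surface), maps out of it included, are total functions of which only the
   values on W matter. *)
From HB Require Import structures.
From mathcomp Require Import all_boot all_order all_algebra all_fingroup.
From mathcomp Require Import all_classical all_reals all_analysis.

Set Implicit Arguments.
Unset Strict Implicit.
Unset Printing Implicit Defensive.

Import Order.TTheory GRing.Theory Num.Theory.
Import numFieldNormedType.Exports.

Local Open Scope classical_set_scope.
Local Open Scope ring_scope.

Section smooth_functions.
Variables (R : realType) (m : nat) (V : normedModType R).

Definition basis_vec (i : 'I_m.+1) : 'rV[R]_m.+1 := delta_mx 0 i.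

Fixpoint Ck_on (k : nat) (U : set 'rV[R]_m.+1) (f : 'rV[R]_m.+1 -> V) : Prop :=
  (forall x, U x -> {for x, continuous f}) /\
  (if k is k'.+1 then
     forall i, (forall x, U x -> derivable f x (basis_vec i)) /\
               Ck_on k' U (fun x => 'D_(basis_vec i) f x)
   else True).

Definition smooth_on (U : set 'rV[R]_m.+1) (f : 'rV[R]_m.+1 -> V) : Prop :=
  forall k, Ck_on k U f.

End smooth_functions.

(* Charts are total functions; only their values on cdom (resp. on the open
   image of cdom, for cinv) are meaningful. *)
Record chart (R : realType) (m : nat) (T : topologicalType) := Chart {
  cdom : set T;
  cmap : T -> 'rV[R]_m.+1;
  cinv : 'rV[R]_m.+1 -> T;
  cdom_open : open cdom;
  cimg_open : open (cmap @` cdom);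
  cmapK : forall p, cdom p -> cinv (cmap p) = p;
  cmap_cont : forall p, cdom p -> {for p, continuous cmap};
  cinv_cont : forall x, (cmap @` cdom) x -> {for x, continuous cinv} }.

(* (Nonempty, Hausdorff, second countable) smooth manifolds of dimension m.+1
   without boundary; chart_at selects a chart around every point. *)
Record manifold (R : realType) (m : nat) := Manifold {
  carrier :> ptopologicalType;
  idx : Type;
  atlas : idx -> chart R m carrier;
  chart_at : carrier -> idx;
  chart_atP : forall p, cdom (atlas (chart_at p)) p;
  trans_smooth : forall c d,
    smooth_on (cmap (atlas c) @` (cdom (atlas c) `&` cdom (atlas d)))
              (cmap (atlas d) \o cinv (atlas c));
  manifold_hausdorff : hausdorff_space carrier;
  manifold_second_countable : @second_countable carrier }.

Section pointwise.
Variables (R : realType) (m : nat).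
Local Notation E := 'rV[R]_m.+1.

Definition covec (a : 'cV[R]_m.+1) (v : E) : R := (v *m a) 0 0.

Definition bil (A : 'M[R]_m.+1) (u v : E) : R := (u *m A *m v^T) 0 0.

(* Christoffel symbols: G x k i j is the k-th component of nabla_(e_i) e_j. *)
Definition chris (G : E -> 'I_m.+1 -> 'M[R]_m.+1) (x u v : E) : E :=
  \row_k bil (G x k) u v.

Definition nabla (G : E -> 'I_m.+1 -> 'M[R]_m.+1) (v : E) (B : E -> E) (x : E)
  : E := 'D_v B x + chris G x v (B x).

Definition lie_bracket (A B : E -> E) (x : E) : E :=
  'D_(A x) B x - 'D_(B x) A x.

Definition torsion (G : E -> 'I_m.+1 -> 'M[R]_m.+1) (A B : E -> E) (x : E) : E :=
  nabla G (A x) B x - nabla G (B x) A x - lie_bracket A B x.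

(* Exterior derivative of a 1-form b, evaluated on constant vector fields u, v
   of the chart (whose Lie bracket vanishes). *)
Definition ext_deriv (b : E -> E -> R) (x u v : E) : R :=
  'D_u (fun y => b y v) x - 'D_v (fun y => b y u) x.

End pointwise.

Section fields.
Variables (R : realType) (m : nat) (M : manifold R m).
Local Notation E := 'rV[R]_m.+1.

Definition vector_field := idx M -> E -> E.
Definition one_form := idx M -> E -> 'cV[R]_m.+1.
Definition tensor2 := idx M -> E -> 'M[R]_m.+1.
Definition connection := idx M -> E -> 'I_m.+1 -> 'M[R]_m.+1.

Definition cimg (W : set M) (c : idx M) : set E :=
  cmap (atlas c) @` (cdom (atlas c) `&` W).

Definition overlap (W : set M) (c d : idx M) : set E :=
  cmap (atlas c) @` (cdom (atlas c) `&` cdom (atlas d) `&` W).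

Definition trans (c d : idx M) : E -> E := cmap (atlas d) \o cinv (atlas c).

Definition is_vector_field (W : set M) (X : vector_field) : Prop :=
  (forall c, smooth_on (cimg W c) (X c)) /\
  (forall c d x, overlap W c d x ->
     'D_(X c x) (trans c d) x = X d (trans c d x)).

Definition is_one_form (W : set M) (a : one_form) : Prop :=
  (forall c, smooth_on (cimg W c) (a c)) /\
  (forall c d x v, overlap W c d x ->
     covec (a c x) v = covec (a d (trans c d x)) ('D_v (trans c d) x)).

Definition is_endomorphism (W : set M) (A : tensor2) : Prop :=
  (forall c, smooth_on (cimg W c) (A c)) /\
  (forall c d x v, overlap W c d x ->
     'D_(v *m A c x) (trans c d) x = 'D_v (trans c d) x *m A d (trans c d x)).

Definition is_metric (W : set M) (h : tensor2) : Prop :=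
  [/\ forall c, smooth_on (cimg W c) (h c),
      forall c d x u v, overlap W c d x ->
        bil (h c x) u v =
        bil (h d (trans c d x)) ('D_u (trans c d) x) ('D_v (trans c d) x),
      forall c x u v, cimg W c x -> bil (h c x) u v = bil (h c x) v u
    & forall c x u, cimg W c x -> u != 0 -> 0 < bil (h c x) u u].

Definition is_connection (W : set M) (G : connection) : Prop :=
  (forall c k, smooth_on (cimg W c) (fun x => G c x k)) /\
  (forall c d x u v, overlap W c d x ->
     'D_(chris (G c) x u v) (trans c d) x =
     'D_u (fun y => 'D_v (trans c d) y) x +
     chris (G d) (trans c d x) ('D_u (trans c d) x) ('D_v (trans c d) x)).

Definition preserves (W : set M) (G : connection)
    (g : idx M -> E -> E -> E -> R) : Prop :=
  forall c (A B : E -> E),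
    smooth_on (cimg W c) A -> smooth_on (cimg W c) B ->
  forall x v, cimg W c x ->
    'D_v (fun y => g c y (A y) (B y)) x =
    g c x (nabla (G c) v A x) (B x) + g c x (A x) (nabla (G c) v B x).

Definition is_levi_civita (W : set M) (h : tensor2) (G : connection) : Prop :=
  [/\ is_connection W G,
      preserves W G (fun c x => bil (h c x))
    & forall c (A B : E -> E),
        smooth_on (cimg W c) A -> smooth_on (cimg W c) B ->
        forall x, cimg W c x -> torsion (G c) A B x = 0].

End fields.

Section contact.
Variables (R : realType) (n : nat) (M : manifold R n.*2).
Local Notation E := 'rV[R]_n.*2.+1.
Variables (lam : one_form M) (X : vector_field M) (J : tensor2 M).

Definition dlam (c : idx M) (x u v : E) : R :=
  ext_deriv (fun y => covec (lam c y)) x u v.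

(* lam /\ (d lam)^n on the coordinate frame, up to the factor 2^n: the wedge
   product is the alternating sum over all permutations of the frame. *)
Definition contact_volume (c : idx M) (x : E) : R :=
  \sum_(s : 'S_(n.*2.+1))
    (-1) ^+ s * covec (lam c x) (basis_vec R (s ord0)) *
    \prod_(i < n) dlam c x (basis_vec R (s (inord i.*2.+1)))
                           (basis_vec R (s (inord i.*2.+2))).

Definition is_contact_form : Prop :=
  is_one_form setT lam /\
  forall c x, cimg setT c x -> contact_volume c x != 0.

Definition is_reeb : Prop :=
  [/\ is_vector_field setT X,
      forall c x, cimg setT c x -> covec (lam c x) (X c x) = 1
    & forall c x v, cimg setT c x -> dlam c x (X c x) v = 0].

Definition xi (c : idx M) (x : E) : set E := [set v | covec (lam c x) v = 0].

Definition proj_xi (c : idx M) (x v : E) : E := v - covec (lam c x) v *: X c x.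

Definition g_xi (c : idx M) (x u v : E) : R := dlam c x u (v *m J c x).

(* J is the extension to TM of the endomorphism of xi, and (xi, J, g_xi) is a
   Hermitian vector bundle. *)
Definition is_contact_triad : Prop :=
  [/\ is_contact_form, is_reeb, is_endomorphism setT J
    & forall c x, cimg setT c x ->
      [/\ X c x *m J c x = 0,
          forall v, xi c x v ->
            xi c x (v *m J c x) /\ v *m J c x *m J c x = - v,
          forall u v, xi c x u -> xi c x v ->
            g_xi c x u v = g_xi c x v u /\
            g_xi c x (u *m J c x) (v *m J c x) = g_xi c x u v
        & forall v, xi c x v -> v != 0 -> 0 < g_xi c x v v]].

Definition triad_metric (c : idx M) (x u v : E) : R :=
  g_xi c x (proj_xi c x u) (proj_xi c x v) +
  covec (lam c x) u * covec (lam c x) v.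

Definition xi_section (c : idx M) (A : E -> E) : Prop :=
  smooth_on (cimg setT c) A /\ forall x, cimg setT c x -> xi c x (A x).

Definition nabla_pi (G : connection M) (c : idx M) (v : E) (B : E -> E) (x : E)
  : E := proj_xi c x (nabla (G c) v B x).

(* nabla^pi preserves the Hermitian structure (d lam, J) of xi. *)
Definition hermitian_pi (G : connection M) : Prop :=
  forall c (A B : E -> E), xi_section c A -> xi_section c B ->
  forall x v, cimg setT c x ->
    'D_v (fun y => dlam c y (A y) (B y)) x =
      dlam c x (nabla_pi G c v A x) (B x) + dlam c x (A x) (nabla_pi G c v B x)
    /\
    nabla_pi G c v (fun y => A y *m J c y) x = nabla_pi G c v A x *m J c x.

Definition is_triad_connection (G : connection M) : Prop :=
  is_connection setT G /\
  [/\ preserves setT G triad_metric,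
      forall c (A : E -> E), smooth_on (cimg setT c) A ->
        forall x, cimg setT c x -> torsion (G c) (X c) A x = 0,
      forall c x, cimg setT c x ->
        nabla (G c) (X c x) (X c) x = 0 /\
        (forall v, xi c x v -> xi c x (nabla (G c) v (X c) x)),
      hermitian_pi G
    & (forall c (A : E -> E), xi_section c A ->
         forall x, cimg setT c x ->
           proj_xi c x (torsion (G c) (fun y => A y *m J c y) A x) = 0) /\
      (forall c x v, cimg setT c x -> xi c x v ->
         nabla (G c) v (X c) x - nabla (G c) (v *m J c x) (X c) x *m J c x = 0)].

End contact.

Notation borel S := (g_sigma_algebraType (@open (carrier S))).

Section surfaces.
Variables (R : realType) (S : manifold R 1).
Local Notation E := 'rV[R]_2.

(* Complex structure of a Riemann surface, as an almost complex structure
   (always integrable in real dimension 2). *)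
Definition is_complex_structure (j : tensor2 S) : Prop :=
  is_endomorphism setT j /\
  forall c x, cimg setT c x -> j c x *m j c x = - 1%:M.

Definition compatible_metric (W : set S) (j h : tensor2 S) : Prop :=
  forall c x u v, cimg W c x ->
    bil (h c x) (u *m j c x) (v *m j c x) = bil (h c x) u v.

(* Half cylinders [0,+oo[ x S^1 and ]-oo,0] x S^1, with S^1 = R / Z, in the
   coordinates (tau, t) of their universal cover. *)
Definition half_cylinder (b : bool) : set E :=
  [set z | if b then 0 <= z ord0 ord0 else z ord0 ord0 <= 0].

(* psi is the isometry from the half cylinder, lifted to the universal cover
   and smooth up to the boundary.  The last clause says that the tails of the
   cylinder, with p added, form a basis of neighbourhoods of p, i.e. that the
   image of psi is a punctured disc neighbourhood of p. *)
Definition cylindrical_near (P : set S) (h : tensor2 S) (p : S) : Prop :=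
  exists (b : bool) (U : set E) (psi : E -> S),
  [/\ open U, half_cylinder b `<=` U,
      (forall z, U z -> {for z, continuous psi}) /\
      (forall a, smooth_on (U `&` psi @^-1` cdom (atlas a))
                           (cmap (atlas a) \o psi))
    & [/\ forall z, half_cylinder b z -> ~ P (psi z),
          forall z z', half_cylinder b z -> half_cylinder b z' ->
            psi z = psi z' <->
            z ord0 ord0 = z' ord0 ord0 /\
            exists k : int, z' ord0 ord_max = z ord0 ord_max + k%:~R,
          forall a z u v, half_cylinder b z -> cdom (atlas a) (psi z) ->
            bil (h a (cmap (atlas a) (psi z)))
                ('D_u (cmap (atlas a) \o psi) z)
                ('D_v (cmap (atlas a) \o psi) z) = (u *m v^T) 0 0
        & forall N : set S, nbhs p N <->
            N p /\ exists T : R, forall z,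
              half_cylinder b z -> T <= `|z ord0 ord0| -> N (psi z)]].

(* ~` P, with complex structure j and metric h, is a Riemann surface punctured
   at the points of P, with cylindrical ends. *)
Definition is_punctured_surface (P : set S) (j h : tensor2 S) : Prop :=
  [/\ closed P, is_complex_structure j, is_metric (~` P) h,
      compatible_metric (~` P) j h
    & forall p, P p -> cylindrical_near P h p].

Definition row2 (z : R * R) : E := \row_(i < 2) if i == 0 then z.1 else z.2.

(* This determines mu on the Borel subsets of W. *)
Definition is_area_measure (W : set S) (h : tensor2 S)
    (mu : {measure set (borel S) -> \bar R}) : Prop :=
  forall (a : idx S) (A : set (borel S)), measurable A ->
    A `<=` cdom (atlas a) `&` W ->
    mu A = (\int[lebesgue_measure \x lebesgue_measure]_(z in
              row2 @^-1` (cmap (atlas a) @` A))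
              (Num.sqrt (\det (h a (row2 z))))%:E)%E.

Definition domain_in (W D : set S) : Prop :=
  [/\ D `<=` W, open D & connected D].

(* closure D `&` W is the closure of D in the subspace W. *)
Definition relatively_compact_in (W D : set S) : Prop :=
  compact (closure D `&` W).

End surfaces.

Section instantons.
Variables (R : realType) (n : nat) (S : manifold R 1) (M : manifold R n.*2).
Variables (W : set S) (w : S -> M).

Definition local_rep (a : idx S) (c : idx M) : 'rV[R]_2 -> 'rV[R]_n.*2.+1 :=
  cmap (atlas c) \o w \o cinv (atlas a).

Definition local_dom (a : idx S) (c : idx M) : set 'rV[R]_2 :=
  cmap (atlas a) @` (cdom (atlas a) `&` w @^-1` cdom (atlas c) `&` W).

Definition smooth_map : Prop :=
  (forall p, W p -> {for p, continuous w}) /\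
  (forall a c, smooth_on (local_dom a c) (local_rep a c)).

Variables (lam : one_form M) (X : vector_field M) (J : tensor2 M).
Variables (j h : tensor2 S).

Definition delbar_pi (a : idx S) (c : idx M) (x v : 'rV[R]_2)
  : 'rV[R]_n.*2.+1 :=
  let f := local_rep a c in
  2^-1 *: (proj_xi lam X c (f x) ('D_v f x) +
           proj_xi lam X c (f x) ('D_(v *m j a x) f x) *m J c (f x)).

Definition pullback_lam_j (a : idx S) (c : idx M) (x v : 'rV[R]_2) : R :=
  let f := local_rep a c in covec (lam c (f x)) ('D_(v *m j a x) f x).

Definition contact_instanton : Prop :=
  smooth_map /\
  forall a c x, local_dom a c x ->
    (forall v, delbar_pi a c x v = 0) /\
    (forall u v, ext_deriv (pullback_lam_j a c) x u v = 0).

Variables (Gh : connection S) (G : connection M).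

Definition nabla_dw (a : idx S) (c : idx M) (x u v : 'rV[R]_2)
  : 'rV[R]_n.*2.+1 :=
  let f := local_rep a c in
  'D_u (fun y => 'D_v f y) x + chris (G c) (f x) ('D_u f x) ('D_v f x)
  - 'D_(chris (Gh a) x u v) f x.

Definition norm_dw (p : S) : R :=
  let a := chart_at p in let c := chart_at (w p) in
  let x := cmap (atlas a) p in let f := local_rep a c in
  let k := invmx (h a x) in
  Num.sqrt (\sum_(i1 < 2) \sum_(i2 < 2)
    k i1 i2 * triad_metric lam X J c (f x)
                ('D_(basis_vec R i1) f x) ('D_(basis_vec R i2) f x)).

Definition norm_nabla_dw (p : S) : R :=
  let a := chart_at p in let c := chart_at (w p) in
  let x := cmap (atlas a) p in let f := local_rep a c in
  let k := invmx (h a x) in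
  Num.sqrt (\sum_(i1 < 2) \sum_(i2 < 2) \sum_(l1 < 2) \sum_(l2 < 2)
    k i1 i2 * k l1 l2 *
    triad_metric lam X J c (f x)
      (nabla_dw a c x (basis_vec R i1) (basis_vec R l1))
      (nabla_dw a c x (basis_vec R i2) (basis_vec R l2))).

Variable mu : {measure set (borel S) -> \bar R}.

Definition Lp_norm_dw (p : R) (D : set S) : \bar R :=
  Lnorm mu p%:E ((EFin \o norm_dw) \_ D).

Definition W12_norm2_dw (D : set S) : \bar R :=
  (\int[mu]_(p in D) (norm_dw p ^+ 2 + norm_nabla_dw p ^+ 2)%:E)%E.

End instantons.

(* Main.v *)
(* In charts of source and target let f represent the instanton and write the
   complex structure as the matrix ((a, b), (c, -a)).  Taking the curl of the two
   instanton equations (of d^pi w o j = J d^pi w, and of d(w^*lambda o j) = 0)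
   shows that c f_00 - 2 a f_01 - b f_11 contains no second derivatives of f: it
   is O(|df| + |df|^2).  Since a^2 + b c = -1, completing the square bounds
   u_00^2 + u_01^2 + u_11^2, for every component u of f, by a multiple of
   (u_01^2 - u_00 u_11) + |df|^2 + |df|^4, and u_00 u_11 - u_01^2 is a divergence.
   Multiply by the square of a bump function in the source times a bump function
   of the target chart evaluated along f; its gradient costs only a factor
   1 + |df|, so after integration over a coordinate square the boundary terms
   vanish and the cross terms are absorbed.  Finitely many target charts cover
   the compact M, with constants independent of w, and finitely many coordinate
   squares cover the closure of D1. *)

Require Import Defs.
From HB Require Import structures.
From mathcomp Require Import all_boot all_order all_algebra.
From mathcomp Require Import all_classical all_reals all_analysis.
From mathcomp Require Import measurable_realfun.
From mathcomp Require Import ring lra.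

Set Implicit Arguments.
Unset Strict Implicit.
Unset Printing Implicit Defensive.

Import Order.TTheory GRing.Theory Num.Theory.
Import numFieldNormedType.Exports.

Local Open Scope classical_set_scope.
Local Open Scope ring_scope.

(** * Differential calculus in coordinates *)

(** Nothing is known about the modulus of continuity of w, so a source square cannot be shrunk until
    its image lies in one target chart: its size, and with it the constants, would depend on w. The
    localisation in the target is therefore done by a cutoff evaluated along w. Its gradient costs a
    factor |df|, which after Young's inequality produces |df|^4, the same order as the quadratic
    terms of the equation already give.

    Such a cutoff only sees the part of the square that w sends into a small target set V. There it
    yields a pointwise bound |nabla dw|^2 <= L (|dw|^2 + |dw|^4) - D, where D is a multiple of a
    divergence and has integral zero. What allows the sets V to be combined is a second inequality,
    D <= L (|dw|^2 + |dw|^4), on the whole square: it makes the right-hand side nonnegative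
    everywhere, so the bounds for finitely many sets V can simply be added, whatever w does. *)

Section calculus.
Variable R : realType.

Lemma derivable_line (V W : normedModType R) (f : V -> W) (y v : V) (t : R) :
  derivable f (t *: v + y) v -> is_derive t 1 (fun t : R => f (t *: v + y)) ('D_v f (t *: v + y)).
Proof.
move=> df.
have E : (fun h : R => h^-1 *: (((fun t : R => f (t *: v + y)) \o shift t) (h *: 1) - f (t *: v + y)))
  = (fun h : R => h^-1 *: ((f \o shift (t *: v + y)) (h *: v) - f (t *: v + y))).
  by apply/funext => h /=; rewrite [_ *: 1]mulr1 scalerDl addrA.
by split; rewrite /derivable /derive /= E.
Qed.

Lemma open_near (T : topologicalType) (U : set T) (x : T) (Q : T -> Prop) :
  open U -> U x -> (forall y, U y -> Q y) -> \near x, Q x.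
Proof.
by move=> oU Ux UQ; apply: filterS (open_nbhs_nbhs (conj oU Ux)) => y /UQ.
Qed.

Lemma continuous_near_eq (T T' : topologicalType) (f g : T -> T') (x : T) :
  (\near x, f x = g x) -> {for x, continuous f} -> {for x, continuous g}.
Proof.
move=> fg cf; rewrite /prop_for /continuous_at -(nbhs_singleton fg).
exact: (cvg_trans (near_eq_cvg fg) cf).
Qed.

(** The step s may be negative, in which case the segment is traversed backwards; locating c by
    [|c| <= |s|] alone covers both signs. *)
Lemma mvt_dir (V : normedModType R) (f : V -> R) (y v : V) (s : R) :
  (forall c, `|c| <= `|s| -> derivable f (c *: v + y) v) ->
  exists2 c, `|c| <= `|s| & f (s *: v + y) - f y = s * 'D_v f (c *: v + y).
Proof.
move=> df.
have dg (c : R) : `|c| <= `|s| -> is_derive c 1 (fun t : R => f (t *: v + y)) ('D_v f (c *: v + y)).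
  by move=> /df; exact: derivable_line.
have cg (c : R) : `|c| <= `|s| -> {for c, continuous (fun t : R => f (t *: v + y))}.
  move=> /dg h; apply: differentiable_continuous; apply/derivable1_diffP.
  exact: ex_derive.
have [s0|s0] := leP 0 s.
- have [||c] := @MVT_segment R (fun t : R => f (t *: v + y)) (fun c : R => 'D_v f (c *: v + y)) 0 s s0.
  + move=> c /[!in_itv]/= /andP[c0 cs]; apply: dg.
    by rewrite !ger0_norm// ltW.
  + apply: continuous_in_subspaceT => c /[!inE]/=; rewrite in_itv/= => /andP[c0 cs].
    by apply: cg; rewrite !ger0_norm.
  rewrite in_itv/= => /andP[c0 cs]; rewrite scale0r add0r subr0 => ->.
  by exists c; rewrite ?ger0_norm// mulrC.
- have [||c] := @MVT_segment R (fun t : R => f (t *: v + y)) (fun c : R => 'D_v f (c *: v + y)) s 0 (ltW s0).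
  + move=> c /[!in_itv]/= /andP[c0 cs]; apply: dg.
    by rewrite !ler0_norm ?lerN2 ?ltW// ltW.
  + apply: continuous_in_subspaceT => c /[!inE]/=; rewrite in_itv/= => /andP[c0 cs].
    by apply: cg; rewrite !ler0_norm ?lerN2// ltW.
  rewrite in_itv/= => /andP[c0 cs]; rewrite scale0r add0r sub0r mulrN => /(congr1 -%R).
  rewrite opprK opprB => ->.
  by exists c; rewrite ?ler0_norm ?lerN2// ?ltW// mulrC.
Qed.

Lemma differentiable_littleo (V W : normedModType R) (f : V -> W)
    (L : {linear V -> W}) x : continuous L ->
  (forall eps : R, 0 < eps ->
    \forall h \near 0, `|f (h + x) - f x - L h| <= eps * `|h|) ->
  differentiable f x.
Proof.
move=> cL fL; suff E : f \o shift x = cst (f x) + L +o_ 0 id.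
  by apply/diff_locallyP; rewrite (diff_unique cL E).
by apply/eqaddoP => eps /fL; apply: filterS => h /=; rewrite opprD addrA.
Qed.

Lemma normr_basis m (i : 'I_m.+1) : `|basis_vec R i| <= 1.
Proof.
rewrite /basis_vec [leLHS]/Num.Def.normr/= mx_normrE bigmax_le// => -[k l] _ /=.
by rewrite !mxE; case: (_ && _); rewrite ?normr1 ?normr0.
Qed.

Lemma entry_le_norm m n (A : 'M[R]_(m, n)) i j : `|A i j| <= `|A|.
Proof.
rewrite [leRHS]/Num.Def.normr/= mx_normrE.
exact: (le_bigmax _ (fun ij => `|A ij.1 ij.2|) (i, j)).
Qed.

Lemma norm_le_entry m n (A : 'M[R]_(m, n)) (c : R) :
  0 <= c -> (forall i j, `|A i j| <= c) -> `|A| <= c.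
Proof.
move=> c0 Ac; rewrite [leLHS]/Num.Def.normr/= mx_normrE bigmax_le// => -[i j] _; exact: Ac.
Qed.

Lemma row_basis m (v : 'rV[R]_m.+1) : v = \sum_i v 0 i *: basis_vec R i.
Proof. by rewrite {1}[v]row_sum_delta. Qed.

Section scalar.
Variable m : nat.
Local Notation E := 'rV[R]_m.+1.
Local Notation e := (@basis_vec R m).
Implicit Types (f : E -> R) (U : set E).

Lemma open_normP U (x : E) : open U -> U x ->
  exists2 r : R, 0 < r & forall y, `|y - x| <= r -> U y.
Proof.
move=> oU Ux; have /nbhs_ballP[r /= r0 rU] := open_nbhs_nbhs (conj oU Ux).
exists (r / 2); first exact: divr_gt0.
move=> y yx; apply: rU; rewrite -ball_normE /ball_/= distrC.
by rewrite (le_lt_trans yx)// ltr_pdivrMr// ltr_pMr// ltr1n.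
Qed.

(** The corners of a path from 0 to h that moves along one coordinate axis at a time. *)
Let trunc (h : E) (k : nat) : E := \row_i (if (i < k)%N then h 0 i else 0).

(** Continuous partial derivatives give differentiability: the increment of f telescopes along the
    corners [trunc h k], the mean value theorem turns each term into a partial derivative at a point
    within [|h|] of x, and continuity bounds each of the m+1 errors by [eps / m.+1]. *)
Lemma Ck_differentiable f U x : open U -> U x -> 
  (forall i y, U y -> derivable f y (e i)) ->
  (forall i, {for x, continuous (fun y => 'D_(e i) f y)}) ->
  differentiable f x.
Proof.
move=> oU Ux df cf.
have [r r0 rU] := open_normP oU Ux.
pose c : 'cV[R]_m.+1 := \col_i 'D_(e i) f x.
pose g (h : E) : R := (h *m c) 0 0.
have glin : linear g by move=> a u v; rewrite /g mulmxDl -scalemxAl !mxE.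
pose gL : {linear E -> R} := HB.pack g (GRing.isLinear.Build _ _ _ _ g glin).
have gE h : g h = \sum_i h 0 i * 'D_(e i) f x.
  by rewrite /g mxE; apply: eq_bigr => i _; rewrite mxE.
have gc : continuous gL.
  apply/linear_bounded_continuous/bounded_funP => k.
  exists (\sum_i k * `|'D_(e i) f x|) => h hk.
  rewrite /gL/= gE (le_trans (ler_norm_sum _ _ _))// ler_sum// => i _.
  by rewrite normrM ler_wpM2r// (le_trans _ hk)// entry_le_norm.
apply: (differentiable_littleo gc) => eps eps0.
  have eps1 : 0 < eps / m.+1%:R by rewrite divr_gt0.
  have : \forall d \near (0 : R)^'+, forall i y, `|y - x| <= d -> `|'D_(e i) f y - 'D_(e i) f x| <= eps / m.+1%:R.
    apply: filter_forall => i.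
    have /cvgrPdist_le /(_ _ eps1)/nbhs_ballP[d /= d0 dP] := cf i.
    near=> t => y yx; rewrite distrC; apply: dP; rewrite -ball_normE /ball_/= distrC.
    by rewrite (le_lt_trans yx).
  move=> near1.
  have [d [d0 dr dP]] : exists d : R, [/\ 0 < d, d <= r & forall i y, `|y - x| <= d -> `|'D_(e i) f y - 'D_(e i) f x| <= eps / m.+1%:R].
    near (0 : R)^'+ => d; exists d; split => //.
    + by near: d; exact: nbhs_right_le.
    + by near: d.
  near=> h.
  have hd : `|h| <= d by near: h; exact: (@nbhs0_le _ E).
  rewrite -[gL h]/(g h) gE.
  have tr0 : trunc h 0 = 0 by apply/rowP => i; rewrite !mxE.
  have trm : trunc h m.+1 = h by apply/rowP => i; rewrite !mxE ltn_ord.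
  have trS (i : 'I_m.+1) : trunc h i.+1 = h 0 i *: e i + trunc h i.
    apply/rowP => l; rewrite !mxE /= eqE/= ltnS leq_eqVlt.
    have [/val_inj ->|li] := eqVneq (l : nat) i; first by rewrite ltnn mulr1 addr0.
    by rewrite mulr0 add0r.
  have -> : f (h + x) = f x + \sum_(i < m.+1) (f (trunc h i.+1 + x) - f (trunc h i + x)).
    rewrite -(big_mkord xpredT (fun i => f (trunc h i.+1 + x) - f (trunc h i + x))).
    by rewrite telescope_sumr// trm tr0 add0r addrCA subrr addr0.
  rewrite [f x + _]addrC addrK -sumrB.
  apply: (@le_trans _ _ (\sum_(i < m.+1) `|h| * (eps / m.+1%:R))); last first.
    rewrite sumr_const card_ord -[leLHS]mulr_natr mulrCA -mulrA divfK ?pnatr_eq0// mulrC.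
  rewrite (le_trans (ler_norm_sum _ _ _))// ler_sum// => i _.
  have sub c1 : `|c1| <= `|h 0 i| -> `|c1 *: e i + (trunc h i + x) - x| <= `|h|.
    move=> c1h; rewrite addrA addrK; apply: norm_le_entry => // a b.
    rewrite (ord1 a) !mxE eqxx eqE/=.
    have [/val_inj ->|bi] := eqVneq (b : nat) i.
      by rewrite ltnn mulr1 addr0 (le_trans c1h)// entry_le_norm.
    rewrite mulr0 add0r.
    by case: ifP; rewrite ?normr0// entry_le_norm.
  have [c1 c1h] := @mvt_dir _ f (trunc h i + x) (e i) (h 0 i) (fun c1 c1h =>
     df i _ (rU _ (le_trans (sub _ c1h) (le_trans hd dr)))).
  move=> E3; have {E3} -> : f (trunc h i.+1 + x) - f (trunc h i + x) =
      h 0 i * 'D_(e i) f (c1 *: e i + (trunc h i + x)).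
    by rewrite trS -addrA; exact: E3.
  rewrite -mulrBr normrM ler_pM// ?entry_le_norm//.
  by apply: dP; rewrite (le_trans (sub _ c1h)).
Unshelve. all: by end_near. Qed.

Lemma derive_basis (W : normedModType R) (f : E -> W) x v : differentiable f x ->
  'D_v f x = \sum_i v 0 i *: 'D_(e i) f x.
Proof.
move=> df; rewrite deriveE// {1}[v]row_basis linear_sum.
by apply: eq_bigr => i _; rewrite linearZ/= deriveE.
Qed.

Lemma Ck_eq (W : normedModType R) k U (f g : E -> W) : open U -> (forall x, U x -> f x = g x) ->
  Ck_on k U f -> Ck_on k U g.
Proof.
move=> oU; elim: k f g => [|k IH] f g fg /= [cf df].
  by split=> // x Ux; apply: (continuous_near_eq _ (cf _ Ux)); exact: (open_near oU Ux fg).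
have nfg x : U x -> \near x, f x = g x.
  by move=> Ux; exact: (open_near oU Ux).
split.
  by move=> x Ux; exact: (continuous_near_eq (nfg x Ux) (cf _ Ux)).
move=> i; have [dfi Cfi] := df i; split.
  by move=> x Ux; apply: near_eq_derivable (dfi _ Ux); exact: nfg.
apply: IH Cfi => x Ux; apply: near_eq_derive; exact: nfg.
Qed.

Lemma Ck_continuous (W : normedModType R) k U (f : E -> W) x : Ck_on k U f -> U x -> {for x, continuous f}.
Proof. by case: k => [|k] [cf _] /cf. Qed.

Lemma Ck_derive (W : normedModType R) k U (f : E -> W) i : Ck_on k.+1 U f -> Ck_on k U (fun x => 'D_(e i) f x).
Proof. by case=> _ /(_ i)[]. Qed.

Lemma Ck_diff k U f x : open U -> Ck_on k.+1 U f -> U x -> differentiable f x.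
Proof.
move=> oU Cf Ux; apply: (Ck_differentiable oU Ux).
  by move=> i y Uy; case: Cf => _ /(_ i)[/(_ _ Uy)].
by move=> i; exact: Ck_continuous (Ck_derive _ Cf) Ux.
Qed.

Lemma derivable_shift f (w x v : E) : derivable f (w + x) v ->
  is_derive x v (fun y => f (w + y)) ('D_v f (w + x)).
Proof.
move=> df.
have E0 : (fun h : R => h^-1 *: (((fun y => f (w + y)) \o shift x) (h *: v) - f (w + x)))
  = (fun h : R => h^-1 *: ((f \o shift (w + x)) (h *: v) - f (w + x))).
  by apply/funext => h /=; rewrite addrCA.
by split; rewrite /derivable /derive /= E0.
Qed.

(** The mean value theorem is used twice, in direction u for y |-> f (s v + y) - f y, then in
    direction v for the derivative of f along u. *)
Lemma second_difference f x (u v : E) (r s : R) : 0 < r -> `|u| <= 1 -> `|v| <= 1 ->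
  (forall y, `|y - x| <= r -> derivable f y u /\
     derivable (fun y => 'D_u f y) y v) ->
  `|s| *+ 2 <= r ->
  exists2 y, `|y - x| <= `|s| *+ 2 &
    f (s *: v + (s *: u + x)) - f (s *: u + x) - (f (s *: v + x) - f x) =
    s * (s * 'D_v (fun y => 'D_u f y) y).
Proof.
move=> r0 u1 v1 df sr.
have s2 (a b : R) : `|a| <= `|s| -> `|b| <= `|s| ->
    `|a *: v + (b *: u + x) - x| <= `|s| *+ 2.
  move=> a1 b1; rewrite addrA addrK (le_trans (ler_normD _ _))// !normrZ mulr2n.
  by rewrite lerD// -[leRHS]mulr1 ler_pM.
have sx (b : R) : `|b| <= `|s| -> `|b *: u + x - x| <= r.
  move=> b1; rewrite (le_trans _ sr)// (le_trans _ (s2 0 b _ b1)) ?normr0//.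
  by rewrite scale0r add0r.
have [|c cs E1] := @mvt_dir _ (fun y => f (s *: v + y) - f y) x u s.
  move=> c cs; have [+ _] := df _ (le_trans (s2 _ _ (lexx _) cs) sr).
  move=> /derivable_shift H; have [H' _] := df _ (sx _ cs).
  exact: derivableB (@ex_derive _ _ _ _ _ _ _ H) H'.
have [D1 _] := df _ (le_trans (s2 _ _ (lexx _) cs) sr).
have [D2 _] := df _ (sx _ cs).
have D1' := derivable_shift D1.
have E3 : 'D_u (fun y => f (s *: v + y) - f y) (c *: u + x) =
    'D_u f (s *: v + (c *: u + x)) - 'D_u f (c *: u + x).
  refine (etrans (deriveB (@ex_derive _ _ _ _ _ _ _ D1') D2) _); congr (_ - _).
  exact: (@derive_val _ _ _ _ _ _ _ D1').
rewrite E3 in E1.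
have [|d ds E2] := @mvt_dir _ (fun y => 'D_u f y) (c *: u + x) v s.
  by move=> d ds; have [] := df _ (le_trans (s2 _ _ ds cs) sr).
exists (d *: v + (c *: u + x)); first exact: s2.
by rewrite -E2; exact: E1.
Qed.

Let dist_aux (a b a' b' c : R) :
  `|a - a'| <= c / 2 -> `|b - b'| <= c / 2 -> a' = b' -> `|a - b| <= c.
Proof.
move=> H1 H2 E; rewrite (le_trans (ler_distD a' _ _))// (splitr c) lerD//.
by rewrite E distrC.
Qed.

Let sub_swap (a b c d : R) : a - b - (c - d) = a - c - (b - d).
Proof. ring. Qed.

(** The second difference is symmetric in its two directions, so the two mixed derivatives take
    equal values at two points at distance at most 2|s| from x; continuity at x does the rest. *)
Lemma schwarz f U x i j : open U -> U x -> Ck_on 2 U f ->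
  'D_(e i) (fun y => 'D_(e j) f y) x = 'D_(e j) (fun y => 'D_(e i) f y) x.
Proof.
move=> oU Ux Cf; have [r r0 rU] := open_normP oU Ux.
have df a b y : `|y - x| <= r -> derivable f y (e a) /\
     derivable (fun y => 'D_(e a) f y) y (e b).
  move=> /rU Uy; split; apply: diff_derivable.
    exact: (Ck_diff oU Cf Uy).
  exact: (Ck_diff oU (Ck_derive a Cf) Uy).
have cont a b : {for x, continuous (fun y => 'D_(e a) (fun y => 'D_(e b) f y) y)}.
  by apply: (Ck_continuous (Ck_derive a (Ck_derive b Cf)) Ux).
apply/eqP; rewrite -subr_eq0 -normr_le0; apply/ler_addgt0Pl => eps eps0; rewrite addr0.
have e2 : 0 < eps / 2 by rewrite divr_gt0.
have /cvgrPdist_le /(_ _ e2)/nbhs_ballP[d1 /= d10 d1P] := cont i j.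
have /cvgrPdist_le /(_ _ e2)/nbhs_ballP[d2 /= d20 d2P] := cont j i.
near (0 : R)^'+ => s.
have s0 : 0 < s by [].
have sr : `|s| *+ 2 <= r.
  by rewrite gtr0_norm// -[s *+ 2]mulr_natr -ler_pdivlMr//; near: s; apply: nbhs_right_le; rewrite divr_gt0.
have sd1 : `|s| *+ 2 < d1.
  by rewrite gtr0_norm// -[s *+ 2]mulr_natr -ltr_pdivlMr//; near: s; apply: nbhs_right_lt; rewrite divr_gt0.
have sd2 : `|s| *+ 2 < d2.
  by rewrite gtr0_norm// -[s *+ 2]mulr_natr -ltr_pdivlMr//; near: s; apply: nbhs_right_lt; rewrite divr_gt0.
have [y yx E1] := second_difference r0 (normr_basis j) (normr_basis i) (df j i) sr.
have [z zx E2] := second_difference r0 (normr_basis i) (normr_basis j) (df i j) sr.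
have E : 'D_(e i) (fun y => 'D_(e j) f y) y = 'D_(e j) (fun y => 'D_(e i) f y) z.
  apply: (mulfI (lt0r_neq0 s0)); apply: (mulfI (lt0r_neq0 s0)).
  by rewrite addrCA sub_swap in E1; exact: etrans (esym E1) E2.
have H1 : `|'D_(e i) (fun y => 'D_(e j) f y) x - 'D_(e i) (fun y => 'D_(e j) f y) y| <= eps / 2.
  by apply: d1P; rewrite -ball_normE /ball_/= distrC (le_lt_trans yx).
have H2 : `|'D_(e j) (fun y => 'D_(e i) f y) x - 'D_(e j) (fun y => 'D_(e i) f y) z| <= eps / 2.
  by apply: d2P; rewrite -ball_normE /ball_/= distrC (le_lt_trans zx).
exact: dist_aux H1 H2 E.
Unshelve. all: by end_near. Qed.

End scalar.
End calculus.

(** * Matrix-valued functions, arbitrary directions and the second-order chain rule *)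

Section calculus2.
Variable R : realType.

Lemma differentiable_mx (V : normedModType R) p q (F : V -> 'M[R]_(p, q)) x :
  (forall i j, differentiable (fun y => F y i j) x) -> differentiable F x.
Proof.
move=> dF.
have -> : F = (fun y => \sum_i (\sum_j (fun y => F y i j *: delta_mx i j)) y).
  apply/funext => y; rewrite {1}[F y]matrix_sum_delta; apply: eq_bigr => i _.
  by rewrite fct_sumE.
have -> : (fun y => \sum_i (\sum_j (fun y => F y i j *: delta_mx i j)) y) =
   \sum_i (\sum_j (fun y => F y i j *: delta_mx i j : 'M[R]_(p, q))).
  by apply/funext => y; rewrite fct_sumE.
by apply: differentiable_sum => i; apply: differentiable_sum => j; exact: differentiableZl.
Qed.

Lemma near_eq_differentiable (V W : normedModType R) (f g : V -> W) x :
  (\near x, f x = g x) -> differentiable f x -> differentiable g x.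
Proof.
move=> nfg df; have [cf lf] := (diff_locallyP _ _).1 df.
apply: (@differentiable_littleo R _ _ _ ('d f x)) => // eps eps0.
have /eqaddoP/(_ _ eps0) := lf.
have [r /= r0 rfg] := (@nbhs_normP _ _ _ _).1 nfg.
have nh : \forall h \near (0 : V), `|h| < r by exact: nbhs0_lt.
apply: filterS2 nh => h hr.
rewrite /= !fctE /= (nbhs_singleton nfg) opprD addrA rfg//.
by rewrite /ball_/= opprD addrCA subrr addr0 normrN.
Qed.

Lemma derive_entry (V : normedModType R) p q (F : V -> 'M[R]_(p, q)) x v i j :
  derivable F x v -> ('D_v F x) i j = 'D_v (fun y => F y i j) x.
Proof. by move=> dF; rewrite derive_mx// mxE. Qed.

Lemma diff_entry (V : normedModType R) p q (F : V -> 'M[R]_(p, q)) x v i j :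
  differentiable F x -> ('D_v F x) i j = 'D_v (fun y => F y i j) x.
Proof. by move=> dF; apply/derive_entry/diff_derivable. Qed.

Lemma derivable_entry (V : normedModType R) p q (F : V -> 'M[R]_(p, q)) x v i j :
  derivable F x v -> derivable (fun y => F y i j) x v.
Proof. by move/derivable_mxP. Qed.

Lemma derive_chain (U V W : normedModType R) (f : V -> W) (g : U -> V) x v :
  differentiable g x -> differentiable f (g x) ->
  'D_v (f \o g) x = 'D_('D_v g x) f (g x).
Proof.
move=> dg df; rewrite !deriveE//; last exact: differentiable_comp.
by rewrite diff_comp.
Qed.

Section smooth.
Variable m : nat.
Local Notation E := 'rV[R]_m.+1.
Local Notation e := (@basis_vec R m).
Implicit Types (U : set E).

Lemma Ck_entry p q k U (F : E -> 'M[R]_(p, q)) i j : open U ->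
  Ck_on k U F -> Ck_on k U (fun x => F x i j).
Proof.
move=> oU; elim: k F => [|k IH] F [cF dF].
  split=> // x Ux.
  exact: (continuous_comp (cF x Ux) (@coord_continuous _ _ _ i j _)).
split=> [x Ux|l].
  exact: (continuous_comp (cF x Ux) (@coord_continuous _ _ _ i j _)).
have [dFl CFl] := dF l; split=> [x Ux|].
  exact: derivable_entry (dFl x Ux).
apply: (@Ck_eq _ _ _ k U (fun x => ('D_(e l) F x) i j)) => //; last exact: IH.
by move=> x Ux; rewrite derive_entry//; exact: dFl.
Qed.

Lemma smooth_entry p q U (F : E -> 'M[R]_(p, q)) i j : open U ->
  smooth_on U F -> smooth_on U (fun x => F x i j).
Proof. by move=> oU sF k; exact: Ck_entry. Qed.

Lemma smooth_derive (W : normedModType R) U (f : E -> W) i :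
  smooth_on U f -> smooth_on U (fun x => 'D_(e i) f x).
Proof. by move=> sf k; exact: Ck_derive (sf k.+1). Qed.

Lemma smooth_continuous (W : normedModType R) U (f : E -> W) x :
  smooth_on U f -> U x -> {for x, continuous f}.
Proof. by move=> /(_ 0%N); exact: Ck_continuous. Qed.

Lemma smooth_diffR U (f : E -> R) x : open U ->
  smooth_on U f -> U x -> differentiable f x.
Proof. by move=> oU /(_ 1%N); exact: Ck_diff. Qed.

Lemma smooth_diff p q U (F : E -> 'M[R]_(p, q)) x : open U ->
  smooth_on U F -> U x -> differentiable F x.
Proof.
move=> oU sF Ux; apply: differentiable_mx => i j.
exact: (smooth_diffR oU (smooth_entry i j oU sF)).
Qed.

(** [Ck_on] speaks of basis directions only. A constant direction v is reached by expanding the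
    derivative in partial derivatives, an identity valid on all of U and therefore near x. *)
Lemma smooth_derive_dir_diffR U (f : E -> R) v x : open U ->
  smooth_on U f -> U x -> differentiable (fun y => 'D_v f y) x /\
    forall u, 'D_u (fun y => 'D_v f y) x = \sum_i v 0 i * 'D_u (fun y => 'D_(e i) f y) x.
Proof.
move=> oU sf Ux.
have E0 y : U y -> \sum_i v 0 i *: 'D_(e i) f y = 'D_v f y.
  by move=> Uy; rewrite -derive_basis//; exact: smooth_diffR Uy.
have nE : \near x, (\sum_i (v 0 i \*: (fun y => 'D_(e i) f y))) x = 'D_v f x.
  by apply: (open_near oU Ux) => y Uy; rewrite fct_sumE; exact: E0.
have dE : differentiable (\sum_i (v 0 i \*: (fun y => 'D_(e i) f y))) x.
  apply: differentiable_sum => i; apply: differentiableZ.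
  exact: (smooth_diffR oU (smooth_derive i sf)).
have D2 u : is_derive x u (fun y => 'D_v f y) (\sum_i v 0 i * 'D_u (fun y => 'D_(e i) f y) x).
  apply: near_eq_is_derive nE _.
  apply: is_derive_sum => i; apply: is_deriveZ; apply: DeriveDef => //.
  by apply/diff_derivable/(smooth_diffR oU (smooth_derive i sf)).
split=> [|u]; last exact: (@derive_val _ _ _ _ _ _ _ (D2 u)).
exact: near_eq_differentiable nE dE.
Qed.

Lemma smooth_derive_dir_diff p q U (F : E -> 'M[R]_(p, q)) v x : open U ->
  smooth_on U F -> U x -> differentiable (fun y => 'D_v F y) x.
Proof.
move=> oU sF Ux; apply: differentiable_mx => i j.
have [D _] := smooth_derive_dir_diffR v oU (smooth_entry i j oU sF) Ux.
apply: near_eq_differentiable D; apply: (open_near oU Ux) => y Uy.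
by rewrite derive_entry//; apply: diff_derivable; exact: smooth_diff Uy.
Qed.

Lemma derive2_entry p q U (F : E -> 'M[R]_(p, q)) u v x i j : open U ->
  smooth_on U F -> U x ->
  ('D_u (fun y => 'D_v F y) x) i j =
  'D_u (fun y => 'D_v (fun z => F z i j) y) x.
Proof.
move=> oU sF Ux; rewrite derive_entry; last first.
  by apply: diff_derivable; exact: smooth_derive_dir_diff Ux.
apply: near_eq_derive; apply: (open_near oU Ux) => y Uy.
by rewrite derive_entry//; apply: diff_derivable; exact: smooth_diff Uy.
Qed.

Lemma derive2_basisR U (f : E -> R) u v x : open U ->
  smooth_on U f -> U x ->
  'D_u (fun y => 'D_v f y) x = \sum_i \sum_j v 0 i * u 0 j * 'D_(e j) (fun y => 'D_(e i) f y) x.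
Proof.
move=> oU sf Ux; have [_ ->] := smooth_derive_dir_diffR v oU sf Ux.
apply: eq_bigr => i _; rewrite derive_basis; last first.
  exact: (smooth_diffR oU (smooth_derive i sf)).
by rewrite mulr_sumr; apply: eq_bigr => j _; rewrite mulrA.
Qed.

Lemma derive2_symR U (f : E -> R) u v x : open U ->
  smooth_on U f -> U x ->
  'D_u (fun y => 'D_v f y) x = 'D_v (fun y => 'D_u f y) x.
Proof.
move=> oU sf Ux; rewrite !(derive2_basisR _ _ oU sf Ux) exchange_big/=.
apply: eq_bigr => i _; apply: eq_bigr => j _.
by rewrite (schwarz _ _ oU Ux (sf 2%N)) [v 0 j * _]mulrC.
Qed.

Lemma derive2_sym p q U (F : E -> 'M[R]_(p, q)) u v x : open U ->
  smooth_on U F -> U x ->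
  'D_u (fun y => 'D_v F y) x = 'D_v (fun y => 'D_u F y) x.
Proof.
move=> oU sF Ux; apply/matrixP => i j.
apply: etrans (derive2_entry u v i j oU sF Ux) _.
apply: etrans _ (esym (derive2_entry v u i j oU sF Ux)).
exact: derive2_symR oU (smooth_entry i j oU sF) Ux.
Qed.

End smooth.

Section second_chain.
Variables (m k : nat).
Local Notation E := 'rV[R]_m.+1.
Local Notation E' := 'rV[R]_k.+1.
Variables (U : set E) (U' : set E') (g : E -> E').
Hypotheses (oU : open U) (oU' : open U') (sg : smooth_on U g).

(** Iterated derivatives are not tensors. When f is a target transition map the first term carries
    its Hessian, and when g is a source transition map the last term does; in [nabla_dw_target] and
    [nabla_dw_source] this Hessian is cancelled by the inhomogeneous term in the transformation law
    of the Christoffel symbols. *)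
Lemma derive2_chainR (f : E' -> R) x u v : smooth_on U' f ->
  U x -> U' (g x) -> (forall y, U y -> U' (g y)) ->
  'D_u (fun y => 'D_v (f \o g) y) x =
  'D_('D_u g x) (fun z => 'D_('D_v g x) f z) (g x) +
  'D_('D_u (fun y => 'D_v g y) x) f (g x).
Proof.
move=> sf Ux Ugx UU'.
have dg y : U y -> differentiable g y by move=> Uy; exact: smooth_diff Uy.
have df y : U' y -> differentiable f y by move=> Uy; exact: smooth_diffR Uy.
pose a i y := ('D_v g y) 0 i.
pose b i := (fun z => 'D_(basis_vec R i) f z) \o g.
have nE : \near x, (\sum_i (a i * b i)) x = 'D_v (f \o g) x.
  apply: (open_near oU Ux) => y Uy; rewrite fct_sumE derive_chain; [|exact: dg|exact/df/UU'].
  by rewrite derive_basis//; exact/df/UU'.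
have ddg := smooth_derive_dir_diff v oU sg Ux.
have da i : is_derive x u (a i) (('D_u (fun y => 'D_v g y) x) 0 i).
  apply: DeriveDef; last by rewrite derive_entry//; exact: diff_derivable.
  by apply: derivable_entry; exact: diff_derivable.
have dif i : differentiable (fun z => 'D_(basis_vec R i) f z) (g x).
  exact: (smooth_diffR oU' (smooth_derive i sf)).
have db i : is_derive x u (b i) ('D_('D_u g x) (fun z => 'D_(basis_vec R i) f z) (g x)).
  apply: DeriveDef.
    exact/diff_derivable/(differentiable_comp (dg _ Ux) (dif i)).
  exact: (derive_chain _ (dg _ Ux) (dif i)).
have D : is_derive x u (\sum_i (a i * b i)) (\sum_i (a i x *: 'D_('D_u g x) (fun z => 'D_(basis_vec R i) f z) (g x) + b i x *: ('D_u (fun y => 'D_v g y) x) 0 i)).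
  by apply: is_derive_sum => i; exact: is_deriveM.
rewrite -(near_eq_derive u nE) (@derive_val _ _ _ _ _ _ _ D) big_split/=; congr (_ + _).
  by have [_ ->] := smooth_derive_dir_diffR ('D_v g x) oU' sf Ugx.
rewrite (derive_basis _ (df _ Ugx)).
by apply: eq_bigr => i _; rewrite /b [LHS]mulrC.
Qed.

Lemma derive2_chain p q (f : E' -> 'M[R]_(p, q)) x u v : smooth_on U' f ->
  U x -> (forall y, U y -> U' (g y)) ->
  'D_u (fun y => 'D_v (f \o g) y) x =
  'D_('D_u g x) (fun z => 'D_('D_v g x) f z) (g x) +
  'D_('D_u (fun y => 'D_v g y) x) f (g x).
Proof.
move=> sf Ux UU'; have Ugx := UU' _ Ux.
have dg y : U y -> differentiable g y by move=> Uy; exact: smooth_diff Uy.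
have df y : U' y -> differentiable f y by move=> Uy; exact: smooth_diff Uy.
have dfg y : U y -> differentiable (f \o g) y.
  by move=> Uy; apply: differentiable_comp; [exact: dg|exact/df/UU'].
have ddg := smooth_derive_dir_diff v oU sg Ux.
have dd : differentiable (fun y => 'D_v (f \o g) y) x.
  apply: differentiable_mx => i j.
  pose h y := \sum_l ('D_v g y) 0 l * 'D_(basis_vec R l) (fun z => f z i j) (g y).
  have nh : \near x, h x = ('D_v (f \o g) x) i j.
    apply: (open_near oU Ux) => y Uy; rewrite derive_entry; last exact/diff_derivable/dfg.
    rewrite (@derive_chain _ _ _ (fun z => f z i j)); [|exact: dg|].
      by rewrite derive_basis//; exact: (smooth_diffR oU' (smooth_entry i j oU' sf) (UU' _ Uy)).
    exact: (smooth_diffR oU' (smooth_entry i j oU' sf) (UU' _ Uy)).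
  apply: near_eq_differentiable nh _.
  have -> : h = \sum_l ((fun y => ('D_v g y) 0 l) * ((fun z => 'D_(basis_vec R l) (fun z => f z i j) z) \o g)).
    by apply/funext => y; rewrite fct_sumE.
  apply: differentiable_sum => l; apply: differentiableM.
    exact: (differentiable_comp ddg (differentiable_coord _ _ _)).
  apply: differentiable_comp; first exact: dg.
  exact: (smooth_diffR oU' (smooth_derive l (smooth_entry i j oU' sf)) Ugx).
apply/matrixP => i j; have E1 := diff_entry u i j dd.
rewrite [RHS]mxE; refine (etrans E1 _).
have -> := derive2_entry ('D_u g x) ('D_v g x) i j oU' sf Ugx.
have -> := diff_entry ('D_u (fun y => 'D_v g y) x) i j (df _ Ugx).
apply: etrans _ (derive2_chainR u v (smooth_entry i j oU' sf) Ux Ugx UU').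
apply: near_eq_derive; apply: (open_near oU Ux) => y Uy.
exact: (diff_entry v i j (dfg _ Uy)).
Qed.

End second_chain.
End calculus2.

(** * Tensors in charts *)

Section matrix_calculus.
Variable R : realType.

Lemma differentiable_mulmx (V : normedModType R) p q r (F : V -> 'M[R]_(p, q))
    (G : V -> 'M[R]_(q, r)) x :
  differentiable F x -> differentiable G x ->
  differentiable (fun y => F y *m G y) x.
Proof.
move=> dF dG; apply: differentiable_mx => i j.
have -> : (fun y => (F y *m G y) i j) =
    \sum_k ((fun y => F y i k) * (fun y => G y k j)).
  by apply/funext => y; rewrite fct_sumE mxE.
apply: differentiable_sum => k; apply: differentiableM.
  exact: (differentiable_comp dF (differentiable_coord _ _ _)).
exact: (differentiable_comp dG (differentiable_coord _ _ _)).
Qed.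

Lemma derive_mulmx (V : normedModType R) p q r (F : V -> 'M[R]_(p, q))
    (G : V -> 'M[R]_(q, r)) x v :
  differentiable F x -> differentiable G x ->
  'D_v (fun y => F y *m G y) x = 'D_v F x *m G x + F x *m 'D_v G x.
Proof.
move=> dF dG; apply/matrixP => i j.
have E1 := diff_entry v i j (differentiable_mulmx dF dG).
refine (etrans E1 _).
have -> : (fun y => (F y *m G y) i j) =
    \sum_k ((fun y => F y i k) * (fun y => G y k j)).
  by apply/funext => y; rewrite fct_sumE mxE.
have D : is_derive x v (\sum_k ((fun y => F y i k) * (fun y => G y k j)))
   (\sum_k (F x i k *: ('D_v G x) k j + G x k j *: ('D_v F x) i k)).
  apply: is_derive_sum => k; apply: is_deriveM; apply: DeriveDef.
  - by apply: derivable_entry; exact: diff_derivable.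
  - exact: (esym (diff_entry v i k dF)).
  - by apply: derivable_entry; exact: diff_derivable.
  - exact: (esym (diff_entry v k j dG)).
rewrite (@derive_val _ _ _ _ _ _ _ D) !mxE -big_split/=; apply: eq_bigr => k _.
by rewrite addrC; congr (_ + _); exact: mulrC.
Qed.

Lemma derive_sub (V : normedModType R) p q (F G : V -> 'M[R]_(p, q)) x v :
  differentiable F x -> differentiable G x ->
  'D_v (fun y => F y - G y) x = 'D_v F x - 'D_v G x.
Proof. by move=> dF dG; apply: (@deriveB _ _ _ F G); exact: diff_derivable. Qed.

Lemma derive_linear_dir (V W : normedModType R) (f : V -> W) x (a : R) u v :
  differentiable f x ->
  'D_(a *: u + v) f x = a *: 'D_u f x + 'D_v f x.
Proof. by move=> df; rewrite !deriveE// linearP. Qed.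

(** The transpose of the usual Jacobian matrix, since tangent vectors are rows and are multiplied
    from the left. *)
Definition jac (m k : nat) (t : 'rV[R]_m.+1 -> 'rV[R]_k.+1) x : 'M[R]_(m.+1, k.+1) :=
  \matrix_(i, j) ('D_(basis_vec R i) t x) 0 j.

Lemma row_jac m k (t : 'rV[R]_m.+1 -> 'rV[R]_k.+1) x i :
  row i (jac t x) = 'D_(basis_vec R i) t x.
Proof. by apply/rowP => j; rewrite !mxE. Qed.

Lemma derive_jac m k (t : 'rV[R]_m.+1 -> 'rV[R]_k.+1) x v :
  differentiable t x -> 'D_v t x = v *m jac t x.
Proof.
move=> dt; rewrite derive_basis// mulmx_sum_row; apply: eq_bigr => i _.
by rewrite row_jac.
Qed.

Lemma bilE m (A : 'M[R]_m.+1) u v : bil A u v = \sum_i \sum_j u 0 i * v 0 j * A i j.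
Proof.
rewrite /bil mxE exchange_big/=; apply: eq_bigr => j _; rewrite !mxE mulr_suml.
by apply: eq_bigr => i _; rewrite mulrAC.
Qed.

Lemma bil_basis m (A : 'M[R]_m.+1) i j : bil A (basis_vec R i) (basis_vec R j) = A i j.
Proof. by rewrite /bil -rowE /basis_vec trmx_delta -colE !mxE. Qed.

Lemma bil_sum (m : nat) (I : finType) (A : 'M[R]_m.+1) (a b : I -> R) (u v : I -> 'rV[R]_m.+1) :
  bil A (\sum_i a i *: u i) (\sum_j b j *: v j) =
  \sum_i \sum_j a i * b j * bil A (u i) (v j).
Proof.
rewrite /bil !mulmx_suml summxE; apply: eq_bigr => i _.
rewrite linear_sum/= mulmx_sumr summxE; apply: eq_bigr => j _.
by rewrite linearZ/= -!scalemxAl -scalemxAr scalerA mxE.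
Qed.

Lemma bil_inj m (A B : 'M[R]_m.+1) : (forall u v, bil A u v = bil B u v) -> A = B.
Proof. by move=> AB; apply/matrixP => i j; rewrite -!bil_basis AB. Qed.

Lemma covecE m (a : 'cV[R]_m.+1) v : covec a v = \sum_i v 0 i * a i 0.
Proof. by rewrite /covec mxE. Qed.

Lemma covec_scale m (a : 'cV[R]_m.+1) (v : 'rV[R]_m.+1) k (X : 'rV[R]_k.+1) :
  covec a v *: X = v *m (a *m X).
Proof. by rewrite /covec mulmxA [v *m a]mx11_scalar mul_scalar_mx mxE eqxx. Qed.

Lemma bil_antisym m (L : 'I_m.+1 -> 'cV[R]_m.+1) (u v : 'rV[R]_m.+1) :
  covec (\sum_i u 0 i *: L i) v - covec (\sum_i v 0 i *: L i) u =
  bil (\matrix_(i, j) (L i j 0 - L j i 0)) u v.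
Proof.
have E (a b : 'rV[R]_m.+1) : covec (\sum_i a 0 i *: L i) b =
    \sum_i \sum_j a 0 i * b 0 j * L i j 0.
  rewrite covecE exchange_big/=; apply: eq_bigr => j _.
  by rewrite summxE mulr_sumr; apply: eq_bigr => i _; rewrite mxE mulrCA mulrA.
rewrite !E bilE [X in _ - X]exchange_big/= -sumrB; apply: eq_bigr => i _.
rewrite -sumrB; apply: eq_bigr => j _; rewrite mxE mulrBr.
by rewrite [v 0 j * _]mulrC.
Qed.

Lemma add_entry m k (A B : 'M[R]_(m, k)) i j : (A + B) i j = A i j + B i j.
Proof. by rewrite mxE. Qed.

Lemma derive_covec (V : normedModType R) m (l : V -> 'cV[R]_m.+1)
    (B : V -> 'rV[R]_m.+1) x u :
  differentiable l x -> differentiable B x ->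
  'D_u (fun z => covec (l z) (B z)) x =
    covec ('D_u l x) (B x) + covec (l x) ('D_u B x).
Proof.
move=> dl dB; have E1 := diff_entry u 0 0 (differentiable_mulmx dB dl).
refine (etrans (esym E1) _); rewrite (derive_mulmx _ dB dl) addrC.
exact: add_entry.
Qed.

(** A contraction with the inverse metric is a trace of a product of two matrices. Under a change of
    frame A one factor acquires inverses of A and its transpose, the other acquires A and its
    transpose, and they cancel by cyclicity of the trace. Invertibility of A and [h2] is read off
    that of [h1]. *)
Lemma contract_invariant (m : nat) (h1 h2 A : 'M[R]_m.+1) (Q1 Q2 : 'I_m.+1 -> 'I_m.+1 -> R) :
  h1 \in unitmx -> h1 = A *m h2 *m A^T ->
  (forall i j, Q1 i j = \sum_i' \sum_j' A i i' * A j j' * Q2 i' j') ->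
  \sum_i \sum_j invmx h1 i j * Q1 i j = \sum_i \sum_j invmx h2 i j * Q2 i j.
Proof.
move=> uh hE QE.
have : h1 \in unitmx by [].
rewrite {1}hE !unitmx_mul unitmx_tr => /andP[/andP[uA u2] _].
pose M1 : 'M[R]_m.+1 := \matrix_(i, j) Q1 i j.
pose M2 : 'M[R]_m.+1 := \matrix_(i, j) Q2 i j.
have ME : M1 = A *m M2 *m A^T.
  apply/matrixP => i j; rewrite !mxE QE exchange_big/=; apply: eq_bigr => j' _.
  rewrite !mxE mulr_suml; apply: eq_bigr => i' _; rewrite !mxE.
  by rewrite -!mulrA; congr (_ * _); rewrite mulrC.
have cE (k M : 'M[R]_m.+1) : \sum_i \sum_j k i j * M i j = \tr (k *m M^T).
  by apply: eq_bigr => i _; rewrite !mxE; apply: eq_bigr => j _; rewrite !mxE.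
have -> : \sum_i \sum_j invmx h1 i j * Q1 i j = \tr (invmx h1 *m M1^T).
  by rewrite -cE; apply: eq_bigr => i _; apply: eq_bigr => j _; rewrite mxE.
have -> : \sum_i \sum_j invmx h2 i j * Q2 i j = \tr (invmx h2 *m M2^T).
  by rewrite -cE; apply: eq_bigr => i _; apply: eq_bigr => j _; rewrite mxE.
have -> : invmx h1 = invmx A^T *m invmx h2 *m invmx A.
  apply: (can_inj (mulKmx uh)); rewrite mulmxV// hE.
  rewrite !mulmxA mulmxK ?unitmx_tr// mulmxK//.
  by rewrite mulmxV.
rewrite ME !trmx_mul trmxK mxtrace_mulC -!mulmxA.
rewrite (mulKVmx (_ : A^T \in unitmx)) ?unitmx_tr//.
by rewrite mxtrace_mulC -!mulmxA mulVmx// mulmx1 mxtrace_mulC.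
Qed.

(** A chart is only given with an open total image; images of smaller open sets are open because the
    inverse is continuous at every point of that image. *)
Lemma open_image_inv (T T' : topologicalType) (f : T -> T') (g : T' -> T)
    (D V : set T) :
  open (f @` D) -> (forall p, D p -> g (f p) = p) ->
  (forall x, (f @` D) x -> {for x, continuous g}) -> open V ->
  open (f @` (D `&` V)).
Proof.
move=> ofD gf cg oV; rewrite openE => _ [p [Dp Vp] <-]; rewrite /interior.
have ip : (f @` D) (f p) by exists p.
have n1 : nbhs (f p) (f @` D) by exact: open_nbhs_nbhs.
have n2 : nbhs (f p) (g @^-1` V).
  by apply: (cg _ ip); rewrite gf//; exact: open_nbhs_nbhs.
apply: filterS2 n1 n2 => _ [q Dq <-] /=; rewrite gf// => Vq.
by exists q.
Qed.

Lemma chart_img_open m (T : topologicalType) (c : chart R m T) (V : set T) :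
  open V -> open (cmap c @` (cdom c `&` V)).
Proof.
exact: (open_image_inv (@cimg_open _ _ _ c) (@cmapK _ _ _ c) (@cinv_cont _ _ _ c)).
Qed.

Lemma chart_imgE m (T : topologicalType) (c : chart R m T) (V : set T) x :
  (cmap c @` (cdom c `&` V)) x ->
  [/\ cdom c (cinv c x), V (cinv c x) & cmap c (cinv c x) = x].
Proof. by move=> [p [cp Vp] <-]; rewrite cmapK. Qed.

End matrix_calculus.

(** * Transformation laws of the metrics and of the contact tensors *)

Section manifold_tensors.
Variables (R : realType) (m : nat) (M : manifold R m).
Local Notation E := 'rV[R]_m.+1.
Implicit Types (W : set M) (c d : idx M).

Lemma cimg_openW W c : open W -> open (cimg W c).
Proof. exact: chart_img_open. Qed.

Lemma overlap_open W c d : open W -> open (overlap W c d).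
Proof.
move=> oW; rewrite /overlap -setIA; apply: chart_img_open.
by apply: openI => //; exact: cdom_open.
Qed.

Lemma overlapE W c d x : overlap W c d x ->
  [/\ cdom (atlas c) (cinv (atlas c) x), cdom (atlas d) (cinv (atlas c) x),
   W (cinv (atlas c) x) & cmap (atlas c) (cinv (atlas c) x) = x].
Proof. by rewrite /overlap -setIA => /chart_imgE[? []]. Qed.

Lemma overlap_intro W c d p : cdom (atlas c) p -> cdom (atlas d) p -> W p ->
  overlap W c d (cmap (atlas c) p).
Proof. by move=> *; exists p. Qed.

Lemma cimg_intro W c p : cdom (atlas c) p -> W p -> cimg W c (cmap (atlas c) p).
Proof. by move=> *; exists p. Qed.

Lemma overlap_cimg W c d x : overlap W c d x -> cimg W c x.
Proof. by move=> /overlapE[? ? ? <-]; exact: cimg_intro. Qed.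

Lemma trans_cimg W c d x : overlap W c d x -> cimg W d (trans c d x).
Proof. by move=> /overlapE[? ? ? xE]; exact: cimg_intro. Qed.

Lemma trans_smoothW W c d : smooth_on (overlap W c d) (trans c d).
Proof.
have sub : overlap W c d `<=` cmap (atlas c) @` (cdom (atlas c) `&` cdom (atlas d)).
  by move=> x /overlapE[? ? ? <-]; exists (cinv (atlas c) x).
have := @trans_smooth _ _ M c d.
suff H (k : nat) (f : E -> E) U U' : U `<=` U' -> Ck_on k U' f -> Ck_on k U f.
  by move=> s k; exact: H sub (s k).
move=> UU'; elim: k f => [|k IH] f [cf df]; split=> //; try by move=> x /UU'/cf.
by move=> i; have [d1 d2] := df i; split=> [x /UU'/d1//|]; exact: IH.
Qed.

Lemma trans_diff W c d x : open W -> overlap W c d x -> differentiable (trans c d) x.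
Proof.
move=> oW Wx.
exact: (smooth_diff (@overlap_open W c d oW) (@trans_smoothW W c d) Wx).
Qed.

Lemma metric_jac W (h : tensor2 M) c d x : open W -> is_metric W h ->
  overlap W c d x ->
  h c x = jac (trans c d) x *m h d (trans c d x) *m (jac (trans c d) x)^T.
Proof.
move=> oW [_ hE _ _] Wx; apply: bil_inj => u v.
rewrite (hE _ _ _ _ _ Wx) !(derive_jac _ (trans_diff oW Wx)).
by rewrite /bil trmx_mul !mulmxA.
Qed.

(** A nonzero vector in the kernel would have length zero. *)
Lemma metric_unit W (h : tensor2 M) c x : is_metric W h -> cimg W c x ->
  h c x \in unitmx.
Proof.
move=> [_ _ _ pos] Wx; rewrite -row_free_unit -kermx_eq0; apply/eqP/row_matrixP => i.
rewrite row0; apply/eqP; apply: contraT => u0.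
have := pos _ _ _ Wx u0; rewrite /bil.
by rewrite -row_mul mulmx_ker row0 mul0mx mxE ltxx.
Qed.

End manifold_tensors.

Section contact_tensors.
Variables (R : realType) (n : nat) (M : manifold R n.*2).
Local Notation E := 'rV[R]_n.*2.+1.
Local Notation e := (basis_vec R).
Variables (lam : one_form M) (X : vector_field M) (J : tensor2 M).
Hypothesis htriad : is_contact_triad lam X J.

Let slam c : smooth_on (cimg setT c) (lam c). Proof. by case: htriad => -[[]]. Qed.
Let sX c : smooth_on (cimg setT c) (X c). Proof. by case: htriad => _ [[]]. Qed.
Let sJ c : smooth_on (cimg setT c) (J c). Proof. by case: htriad => _ _ []. Qed.
Let oT c : open (cimg [set: M] c). Proof. by apply: cimg_openW; exact: openT. Qed.

Lemma lam_diff c x : cimg setT c x -> differentiable (lam c) x.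
Proof. exact: smooth_diff. Qed.

Lemma covec_cst_derive c x u v : cimg setT c x ->
  'D_u (fun y => covec (lam c y) v) x = covec ('D_u (lam c) x) v.
Proof.
move=> cx; rewrite (derive_covec _ (lam_diff cx) (differentiable_cst v x)).
by rewrite derive_cst [X in _ + X]/covec mul0mx mxE addr0.
Qed.

Lemma dlamE c x u v : cimg setT c x ->
  dlam lam c x u v = covec ('D_u (lam c) x) v - covec ('D_v (lam c) x) u.
Proof. by move=> cx; rewrite /dlam /ext_deriv !covec_cst_derive. Qed.

Definition dlam_mx c x : 'M[R]_n.*2.+1 :=
  \matrix_(i, j) (('D_(e i) (lam c) x) j 0 - ('D_(e j) (lam c) x) i 0).

Lemma dlam_bil c x u v : cimg setT c x -> dlam lam c x u v = bil (dlam_mx c x) u v.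
Proof.
by move=> cx; rewrite dlamE// !(derive_basis _ (lam_diff cx)) bil_antisym.
Qed.

Definition proj_mx c x : 'M[R]_n.*2.+1 := 1%:M - lam c x *m X c x.

Lemma proj_xiE c x v : proj_xi lam X c x v = v *m proj_mx c x.
Proof. by rewrite /proj_xi covec_scale mulmxBr mulmx1. Qed.

Definition triad_mx c x : 'M[R]_n.*2.+1 :=
  proj_mx c x *m dlam_mx c x *m (proj_mx c x *m J c x)^T + lam c x *m (lam c x)^T.

Lemma triad_bil c x u v : cimg setT c x ->
  triad_metric lam X J c x u v = bil (triad_mx c x) u v.
Proof.
move=> cx; rewrite /triad_metric /g_xi dlam_bil// !proj_xiE /bil /covec.
rewrite /triad_mx mulmxDr mulmxDl [RHS]mxE !trmx_mul !mulmxA; congr (_ + _).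
rewrite -(mulmxA (u *m _)) -trmx_mul [RHS]mxE big_ord1; congr (_ * _).
by rewrite !mxE.
Qed.

Section transform.
Variables (c d : idx M) (x : E).
Hypothesis ox : overlap setT c d x.
Let t := trans c d.
Let y := t x.
Let T v := 'D_v t x.
Let cx : cimg setT c x := overlap_cimg ox.
Let dy : cimg setT d y := trans_cimg ox.
Let dt : differentiable t x. Proof. exact: trans_diff openT ox. Qed.

Let sub_cancel (a b s : R) : a + s - (b + s) = a - b.
Proof. by rewrite opprD addrACA subrr addr0. Qed.

(** Naturality of the exterior derivative: differentiating the transformation law of lambda brings
    in second derivatives of the transition map, which are symmetric and drop out after
    antisymmetrisation. *)
Lemma dlam_trans u v : dlam lam c x u v = dlam lam d y (T u) (T v).
Proof.
have oO : open (overlap [set: M] c d) by apply: overlap_open; exact: openT.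
have st := @trans_smoothW _ _ M setT c d.
have lamE : forall z w, overlap setT c d z ->
    covec (lam c z) w = covec (lam d (t z)) ('D_w t z) by case: htriad => -[[_ H] _] _ _ _ z w; exact: H.
have D u' v' : 'D_u' (fun z => covec (lam c z) v') x =
    covec ('D_(T u') (lam d) y) (T v') + covec (lam d y) ('D_u' (fun z => 'D_v' t z) x).
  have nE : \near x, covec (lam d (t x)) ('D_v' t x) = covec (lam c x) v'.
    by apply: (open_near oO ox) => z oz; rewrite lamE.
  rewrite -(near_eq_derive u' nE).
  have dl : differentiable (lam d \o t) x := differentiable_comp dt (lam_diff dy).
  have dT := smooth_derive_dir_diff v' oO st ox.
  by rewrite (derive_covec _ dl dT) (derive_chain _ dt (lam_diff dy)).
rewrite [RHS]dlamE// [LHS]/dlam /ext_deriv !D (derive2_sym _ _ oO st ox).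
exact: sub_cancel.
Qed.

Lemma proj_trans v : T (proj_xi lam X c x v) = proj_xi lam X d y (T v).
Proof.
have lamE : covec (lam c x) v = covec (lam d y) (T v).
  by case: htriad => -[[_ H] _] _ _ _; exact: H.
have XE : T (X c x) = X d y by case: htriad => _ [[_ H] _ _] _ _; exact: H.
rewrite /proj_xi -lamE -XE /T addrC -scaleNr (derive_linear_dir _ _ _ dt).
by rewrite scaleNr addrC.
Qed.

Lemma triad_trans u v :
  triad_metric lam X J c x u v = triad_metric lam X J d y (T u) (T v).
Proof.
have lamE w : covec (lam c x) w = covec (lam d y) (T w).
  by case: htriad => -[[_ H] _] _ _ _; exact: H.
have JE w : T (w *m J c x) = T w *m J d y by case: htriad => _ _ [_ H] _; exact: H.
by rewrite /triad_metric /g_xi !lamE dlam_trans JE !proj_trans.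
Qed.

End transform.
End contact_tensors.

(** * Chart independence of the norms *)

Lemma scale2_eq (K : pzRingType) (V : lmodType K) (a b : K) (v w : V) :
  v = w -> a *: (b *: v) = (a * b) *: w.
Proof. by move=> ->; rewrite scalerA. Qed.

Lemma add3_eq (V : zmodType) (a a' b b' c c' : V) :
  a = a' -> b = b' -> c = c' -> a + b - c = a' + b' - c'.
Proof. by move=> -> -> ->. Qed.

Lemma smooth_sub (R : realType) m (V : normedModType R) (U1 U2 : set 'rV[R]_m.+1)
    (F : 'rV[R]_m.+1 -> V) :
  U1 `<=` U2 -> smooth_on U2 F -> smooth_on U1 F.
Proof.
move=> U12 sF k; move: (sF k) => {sF}; elim: k F => [|k IH] F [cF dF].
  by split=> // y /U12/cF.
split=> [y /U12/cF//|i]; have [d1 d2] := dF i.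
by split=> [y /U12/d1//|]; exact: IH.
Qed.

Section contraction.
Variables (R : realType) (m : nat).

Definition contr (k : 'M[R]_m) (Q : 'I_m -> 'I_m -> R) : R :=
  \sum_i \sum_j k i j * Q i j.

Lemma eq_contr k Q Q' : (forall i j, Q i j = Q' i j) -> contr k Q = contr k Q'.
Proof. by move=> QE; apply: eq_bigr => i _; apply: eq_bigr => j _; rewrite QE. Qed.

End contraction.

Section local_representation.
Variables (R : realType) (n : nat) (S : manifold R 1) (M : manifold R n.*2).
Local Notation E := 'rV[R]_n.*2.+1.
Local Notation E2 := 'rV[R]_2.
Local Notation e := (basis_vec R).
Variables (W : set S) (w : S -> M).
Variables (lam : one_form M) (X : vector_field M) (J : tensor2 M).
Variables (j h : tensor2 S) (Gh : connection S) (G : connection M).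
Hypotheses (oW : open W) (sw : smooth_map W w).

Lemma preimage_open (V : set M) : open V -> open (W `&` w @^-1` V).
Proof.
move=> oV; rewrite openE => p [Wp Vp]; rewrite /interior.
have n1 : nbhs p W by exact: open_nbhs_nbhs.
have n2 : nbhs p (w @^-1` V) by apply: (sw.1 p Wp); exact: open_nbhs_nbhs.
exact: filterI.
Qed.

Lemma local_domE a c :
  local_dom W w a c = cmap (atlas a) @` (cdom (atlas a) `&` (W `&` w @^-1` cdom (atlas c))).
Proof. by rewrite /local_dom -setIA [X in _ `&` X]setIC. Qed.

Lemma local_dom_open a c : open (local_dom W w a c).
Proof.
by rewrite local_domE; apply/chart_img_open/preimage_open; exact: cdom_open.
Qed.

Lemma local_domP a c x : local_dom W w a c x ->
  [/\ cdom (atlas a) (cinv (atlas a) x), W (cinv (atlas a) x),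
      cdom (atlas c) (w (cinv (atlas a) x)) & cmap (atlas a) (cinv (atlas a) x) = x].
Proof. by rewrite local_domE => /chart_imgE[? []]. Qed.

Lemma local_dom_intro a c p : cdom (atlas a) p -> W p -> cdom (atlas c) (w p) ->
  local_dom W w a c (cmap (atlas a) p).
Proof. by move=> *; exists p. Qed.

Lemma local_repE a c p : cdom (atlas a) p ->
  local_rep w a c (cmap (atlas a) p) = cmap (atlas c) (w p).
Proof. by move=> ap; rewrite /local_rep /= cmapK. Qed.

Lemma local_rep_smooth a c : smooth_on (local_dom W w a c) (local_rep w a c).
Proof. exact: sw.2. Qed.

Lemma local_rep_diff a c x : local_dom W w a c x -> differentiable (local_rep w a c) x.
Proof.
exact: (smooth_diff (@local_dom_open a c) (@local_rep_smooth a c)).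
Qed.

Lemma local_dom_cimg a c x : local_dom W w a c x -> cimg W a x.
Proof. by move=> /local_domP[? ? ? <-]; exact: cimg_intro. Qed.

Lemma local_rep_cimg a c x : local_dom W w a c x -> cimg setT c (local_rep w a c x).
Proof. by move=> /local_domP[? ? ? <-]; rewrite local_repE//; exact: cimg_intro. Qed.

(* Squares of the norms of dw and of nabla(dw), computed in arbitrary charts a, c
   instead of those selected by chart_at. *)
Definition norm2 a c x : R :=
  contr (invmx (h a x)) (fun i1 i2 => triad_metric lam X J c (local_rep w a c x)
      ('D_(e i1) (local_rep w a c) x) ('D_(e i2) (local_rep w a c) x)).

Definition nnorm2 a c x : R :=
  contr (invmx (h a x)) (fun i1 i2 => contr (invmx (h a x)) (fun l1 l2 =>
    triad_metric lam X J c (local_rep w a c x)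
      (nabla_dw w Gh G a c x (e i1) (e l1)) (nabla_dw w Gh G a c x (e i2) (e l2)))).

Section change_target.
Variables (a : idx S) (c d : idx M) (p : S).
Hypotheses (ap : cdom (atlas a) p) (Wp : W p).
Hypotheses (cp : cdom (atlas c) (w p)) (dp : cdom (atlas d) (w p)).
Let x := cmap (atlas a) p.
Let f := local_rep w a c.
Let t := trans c d.

Let U := cmap (atlas a) @` (cdom (atlas a) `&` (W `&` w @^-1` (cdom (atlas c) `&` cdom (atlas d)))).
Let oU : open U.
Proof. by apply/chart_img_open/preimage_open; apply: openI; exact: cdom_open. Qed.
Let Ux : U x. Proof. by exists p. Qed.
Let U_dom y : U y -> local_dom W w a c y.
Proof. by move=> /chart_imgE[ay [Wy [cy dy]] <-]; exact: local_dom_intro. Qed.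
Let U_domd y : U y -> local_dom W w a d y.
Proof. by move=> /chart_imgE[ay [Wy [cy dy]] <-]; exact: local_dom_intro. Qed.
Let U_overlap y : U y -> overlap setT c d (f y).
Proof.
move=> /chart_imgE[ay [Wy [cy dy]] <-]; rewrite /f local_repE//.
exact: overlap_intro.
Qed.
Let fE y : U y -> (t \o f) y = local_rep w a d y.
Proof.
move=> /chart_imgE[ay [Wy [cy dy]] <-]; rewrite /f /t /trans /=.
by rewrite !local_repE// cmapK.
Qed.
Let sf : smooth_on U f.
Proof.
exact: smooth_sub U_dom (local_rep_smooth a c).
Qed.
Let oO : open (overlap [set: M] c d). Proof. by apply: overlap_open; exact: openT. Qed.
Let st : smooth_on (overlap [set: M] c d) t. Proof. exact: trans_smoothW. Qed.
Let dt y : U y -> differentiable t (f y).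
Proof. by move=> Uy; exact: (smooth_diff oO st (U_overlap Uy)). Qed.
Let df y : U y -> differentiable f y. Proof. by move=> Uy; exact: (local_rep_diff (U_dom Uy)). Qed.

Lemma derive_target y v : U y ->
  'D_v (local_rep w a d) y = 'D_('D_v f y) t (f y).
Proof.
move=> Uy; rewrite -(derive_chain _ (df Uy) (dt Uy)).
by apply: near_eq_derive; apply: (open_near oU Uy) => z Uz; rewrite fE.
Qed.

Let add_shuffle (A B C D : E) : A + B + C - D = B + (A + C) - D.
Proof. by rewrite addrA [B + A]addrC. Qed.

Lemma nabla_dw_target u v : is_connection setT G ->
  nabla_dw w Gh G a d x u v = 'D_(nabla_dw w Gh G a c x u v) t (f x).
Proof.
move=> [_ GE].
have E1 : 'D_u (fun y => 'D_v (local_rep w a d) y) x =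
    'D_('D_u f x) (fun z => 'D_('D_v f x) t z) (f x) +
    'D_('D_u (fun y => 'D_v f y) x) t (f x).
  rewrite -(derive2_chain oU oO sf u v st Ux U_overlap).
  apply: near_eq_derive; apply: (open_near oU Ux) => y Uy.
  by apply: near_eq_derive; apply: (open_near oU Uy) => z Uz; rewrite fE.
have E2 := GE c d (f x) ('D_u f x) ('D_v f x) (U_overlap Ux).
have E3 (u' v' w' : E) : 'D_(u' + v' - w') t (f x) = 'D_u' t (f x) + 'D_v' t (f x) - 'D_w' t (f x).
  by rewrite !(derive_jac _ (dt Ux)) mulmxBl mulmxDl.
rewrite /nabla_dw E3 E1 !derive_target// E2 -(fE Ux).
exact: add_shuffle.
Qed.

Hypothesis htriad : is_contact_triad lam X J.

Let triadE u v v' u' : u' = 'D_u t (f x) -> v' = 'D_v t (f x) ->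
  triad_metric lam X J c (f x) u v = triad_metric lam X J d (local_rep w a d x) u' v'.
Proof. by move=> -> ->; rewrite -(fE Ux) (triad_trans htriad (U_overlap Ux)). Qed.

Lemma norm2_target : norm2 a c x = norm2 a d x.
Proof. by apply: eq_contr => i1 i2; apply: triadE; exact: derive_target. Qed.

Lemma nnorm2_target : is_connection setT G -> nnorm2 a c x = nnorm2 a d x.
Proof.
move=> cG; apply: eq_contr => i1 i2; apply: eq_contr => l1 l2.
by apply: triadE; exact: nabla_dw_target.
Qed.

End change_target.

Lemma chris_bilin m (Ga : 'rV[R]_m.+1 -> 'I_m.+1 -> 'M[R]_m.+1) y (u v : 'rV[R]_m.+1) :
  chris Ga y u v = \sum_i \sum_k (u 0 i * v 0 k) *: chris Ga y (e i) (e k).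
Proof.
apply/rowP => l; rewrite summxE mxE {1}[u]row_basis {1}[v]row_basis bil_sum.
apply: eq_bigr => i _; rewrite summxE; apply: eq_bigr => k _.
by rewrite [RHS]mxE mxE.
Qed.

Lemma derive2_bilin m p q U (F : 'rV[R]_m.+1 -> 'M[R]_(p, q)) u v x : open U ->
  smooth_on U F -> U x ->
  'D_u (fun y => 'D_v F y) x =
  \sum_i \sum_k (u 0 i * v 0 k) *: 'D_(e i) (fun y => 'D_(e k) F y) x.
Proof.
move=> oU sF Ux.
rewrite (derive_basis _ (smooth_derive_dir_diff v oU sF Ux)); apply: eq_bigr => i _.
have E1 := derive2_sym (e i) v oU sF Ux.
have E2 := derive_basis v (smooth_derive_dir_diff (e i) oU sF Ux).
refine (etrans (congr1 _ (etrans E1 E2)) _); rewrite scaler_sumr.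
apply: eq_bigr => k _; apply: scale2_eq.
exact: (derive2_sym _ _ oU sF Ux).
Qed.

(** Each of the three terms of nabla(dw) is bilinear in (u, v). This lets [nnorm2_source] pass from
    the images of the basis of one source chart to the basis of the other. *)
Lemma nabla_dw_bilin a c u v y : local_dom W w a c y ->
  nabla_dw w Gh G a c y u v =
  \sum_i \sum_k (u 0 i * v 0 k) *: nabla_dw w Gh G a c y (e i) (e k).
Proof.
move=> dy.
pose F := local_rep w a c.
have dF : differentiable F y := local_rep_diff dy.
have E1 := derive2_bilin u v (@local_dom_open a c) (@local_rep_smooth a c) dy.
have E4 : chris (G c) (F y) ('D_u F y) ('D_v F y) =
    \sum_i \sum_k (u 0 i * v 0 k) *: chris (G c) (F y) ('D_(e i) F y) ('D_(e k) F y).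
  rewrite !(derive_basis _ dF).
  apply/rowP => l; rewrite summxE mxE bil_sum.
  apply: eq_bigr => i _; rewrite summxE; apply: eq_bigr => k _.
  by rewrite [RHS]mxE mxE.
have E5 : 'D_(chris (Gh a) y u v) F y =
    \sum_i \sum_k (u 0 i * v 0 k) *: 'D_(chris (Gh a) y (e i) (e k)) F y.
  rewrite (derive_jac _ dF) chris_bilin mulmx_suml; apply: eq_bigr => i _.
  rewrite mulmx_suml; apply: eq_bigr => k _.
  by rewrite -scalemxAl (derive_jac _ dF).
refine (etrans (add3_eq E1 E4 E5) _).
rewrite -big_split -sumrB/=; apply: eq_bigr => i _.
rewrite -big_split -sumrB/=; apply: eq_bigr => k _.
by rewrite -scalerDr -scalerBr.
Qed.

Section change_source.
Variables (a b : idx S) (c : idx M) (p : S).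
Hypotheses (ap : cdom (atlas a) p) (bp : cdom (atlas b) p) (Wp : W p).
Hypotheses (cp : cdom (atlas c) (w p)).
Let x := cmap (atlas a) p.
Let t := trans a b.
Let f := local_rep w b c.

Let U := cmap (atlas a) @` (cdom (atlas a) `&` (cdom (atlas b) `&` (W `&` w @^-1` cdom (atlas c)))).
Let oU : open U.
Proof.
by apply: chart_img_open; apply: openI; [exact: cdom_open|apply: preimage_open; exact: cdom_open].
Qed.
Let Ux : U x. Proof. by exists p. Qed.
Let U_doma y : U y -> local_dom W w a c y.
Proof. by move=> /chart_imgE[ay [yb [Wy cy]] <-]; exact: local_dom_intro. Qed.
Let U_domb y : U y -> local_dom W w b c (t y).
Proof.
move=> /chart_imgE[ay [yb [Wy cy]] <-].
by rewrite /t /trans /= cmapK//; exact: local_dom_intro.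
Qed.
Let U_overlap y : U y -> overlap W a b y.
Proof. by move=> /chart_imgE[ay [yb [Wy cy]] <-]; exact: overlap_intro. Qed.
Let fE y : U y -> (f \o t) y = local_rep w a c y.
Proof.
move=> /chart_imgE[ay [yb [Wy cy]] <-]; rewrite /f /t /trans /=.
by rewrite cmapK// !local_repE.
Qed.
Let st : smooth_on U t.
Proof. exact: (smooth_sub U_overlap (@trans_smoothW _ _ S W a b)). Qed.
Let dt y : U y -> differentiable t y.
Proof. by move=> Uy; exact: (smooth_diff oU st Uy). Qed.
Let df y : U y -> differentiable f (t y).
Proof. by move=> Uy; exact: (local_rep_diff (U_domb Uy)). Qed.

Lemma derive_source y v : U y ->
  'D_v (local_rep w a c) y = 'D_('D_v t y) f (t y).
Proof.
move=> Uy; rewrite -(derive_chain _ (dt Uy) (df Uy)).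
by apply: near_eq_derive; apply: (open_near oU Uy) => z Uz; rewrite fE.
Qed.

Let add_shuffle (A B C D : E) : A + B + C - (B + D) = A + C - D.
Proof. by rewrite [A + B + C]addrAC opprD addrA addrK. Qed.

Lemma nabla_dw_source u v : is_connection W Gh ->
  nabla_dw w Gh G a c x u v = nabla_dw w Gh G b c (t x) ('D_u t x) ('D_v t x).
Proof.
move=> [_ GE].
have E1 : 'D_u (fun y => 'D_v (local_rep w a c) y) x =
    'D_('D_u t x) (fun z => 'D_('D_v t x) f z) (t x) +
    'D_('D_u (fun y => 'D_v t y) x) f (t x).
  have lo := @local_dom_open b c; have ls := @local_rep_smooth b c.
  rewrite -(derive2_chain oU lo st u v ls Ux U_domb).
  apply: near_eq_derive; apply: (open_near oU Ux) => y Uy.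
  by apply: near_eq_derive; apply: (open_near oU Uy) => z Uz; rewrite fE.
have H2 := GE a b x u v (U_overlap Ux).
have E3 (u' v' : E2) : 'D_(u' + v') f (t x) = 'D_u' f (t x) + 'D_v' f (t x).
  by rewrite !(derive_jac _ (df Ux)) mulmxDl.
have E4 : chris (G c) (local_rep w a c x) ('D_u (local_rep w a c) x) ('D_v (local_rep w a c) x) =
   chris (G c) (f (t x)) ('D_('D_u t x) f (t x)) ('D_('D_v t x) f (t x)).
  by rewrite (derive_source u Ux) (derive_source v Ux) -(fE Ux).
have E5 : 'D_(chris (Gh a) x u v) (local_rep w a c) x =
    'D_('D_u (fun y => 'D_v t y) x) f (t x) + 'D_(chris (Gh b) (t x) ('D_u t x) ('D_v t x)) f (t x).
  exact: (etrans (derive_source _ Ux) (etrans (congr1 (fun v => 'D_v f (t x)) H2) (E3 _ _))).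
refine (etrans (add3_eq E1 E4 E5) _); exact: add_shuffle.
Qed.

Let A := jac t x.

Lemma norm2_source : is_contact_triad lam X J -> is_metric W h ->
  norm2 a c x = norm2 b c (t x).
Proof.
move=> htriad mh; have ox := U_overlap Ux.
apply: (@contract_invariant _ _ _ _ A _ _ _ (metric_jac oW mh ox)).
  exact: metric_unit mh (overlap_cimg ox).
move=> i k; have cx := local_rep_cimg (U_doma Ux).
have cx' := local_rep_cimg (U_domb Ux).
have D l : 'D_(e l) (local_rep w a c) x = \sum_i A l i *: 'D_(e i) f (t x).
  rewrite (derive_source _ Ux) (derive_basis _ (df Ux)); apply: eq_bigr => i' _.
  by rewrite mxE.
by rewrite !D !triad_bil// -(fE Ux) bil_sum; apply: eq_bigr => i' _; apply: eq_bigr => j' _; rewrite triad_bil.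
Qed.

(** The four-index contraction is transformed one pair of indices at a time. [P] is the mixed tensor
    with its first slot in the frame of a and its second in the frame of b: [contract_invariant]
    first moves the l indices, then, once the sums have been interchanged, the i indices. *)
Lemma nnorm2_source : is_contact_triad lam X J -> is_metric W h -> is_connection W Gh ->
  nnorm2 a c x = nnorm2 b c (t x).
Proof.
move=> htriad mh cGh; have ox := U_overlap Ux.
have cx := local_rep_cimg (U_doma Ux); have cx' := local_rep_cimg (U_domb Ux).
have hE := metric_jac oW mh ox.
have hu := metric_unit mh (overlap_cimg ox).
pose N i l := nabla_dw w Gh G b c (t x) (e i) (e l).
pose P i l := \sum_i' A i i' *: N i' l.
have DN i l : nabla_dw w Gh G a c x (e i) (e l) = \sum_l' A l l' *: P i l'.
  refine (etrans (nabla_dw_source _ _ cGh) _).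
  refine (etrans (nabla_dw_bilin _ _ (U_domb Ux)) _); rewrite exchange_big/=.
  apply: eq_bigr => l' _; rewrite scaler_sumr; apply: eq_bigr => i' _.
  by rewrite scalerA !mxE mulrC.
pose T u v := triad_metric lam X J c (f (t x)) u v.
pose Q i1 i2 := contr (invmx (h b (t x))) (fun l1 l2 => T (P i1 l1) (P i2 l2)).
have E1 : nnorm2 a c x = contr (invmx (h a x)) Q.
  apply: eq_contr => i1 i2.
  apply: (contract_invariant hu hE) => l1 l2.
  rewrite !DN triad_bil// -(fE Ux) bil_sum.
  by apply: eq_bigr => i' _; apply: eq_bigr => j' _; rewrite /T triad_bil.
rewrite E1; apply: (contract_invariant hu hE) => i1 i2.
rewrite /Q /contr.
under eq_bigr => l1 _ do under eq_bigr => l2 _ do rewrite /T (triad_bil htriad _ _ cx') bil_sum mulr_sumr.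
transitivity (\sum_l1 \sum_l2 \sum_i' \sum_j' A i1 i' * A i2 j' *
   (invmx (h b (t x)) l1 l2 * triad_metric lam X J c (f (t x)) (N i' l1) (N j' l2))).
  apply: eq_bigr => l1 _; apply: eq_bigr => l2 _; apply: eq_bigr => i' _.
  rewrite mulr_sumr; apply: eq_bigr => j' _.
  by rewrite (triad_bil htriad _ _ cx') mulrCA.
under eq_bigr do rewrite exchange_big/=.
rewrite exchange_big/=; apply: eq_bigr => i' _.
under eq_bigr do rewrite exchange_big/=.
rewrite exchange_big/=; apply: eq_bigr => j' _.
by rewrite mulr_sumr; apply: eq_bigr => l1 _; rewrite mulr_sumr.
Qed.

End change_source.

End local_representation.

(** * Regularity of the norms of dw and nabla(dw) *)

Section differentiable_tools.
Variables (R : realType) (V : normedModType R).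

Lemma differentiable_entry p q (F : V -> 'M[R]_(p, q)) x i k :
  differentiable F x -> differentiable (fun y => F y i k) x.
Proof. by move=> dF; exact: (differentiable_comp dF (differentiable_coord _ _ _)). Qed.

Lemma differentiable_tr p q (F : V -> 'M[R]_(p, q)) x :
  differentiable F x -> differentiable (fun y => (F y)^T) x.
Proof.
move=> dF; apply: differentiable_mx => i k.
have -> : (fun y => (F y)^T i k) = (fun y => F y k i) by apply/funext => y; rewrite mxE.
exact: differentiable_entry.
Qed.

Lemma differentiable_add_mx p q (F G : V -> 'M[R]_(p, q)) x :
  differentiable F x -> differentiable G x -> differentiable (fun y => F y + G y) x.
Proof. exact: differentiableD. Qed.

Lemma differentiable_sub_mx p q (F G : V -> 'M[R]_(p, q)) x :
  differentiable F x -> differentiable G x -> differentiable (fun y => F y - G y) x.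
Proof. exact: differentiableB. Qed.

Lemma differentiable_fsum (W : normedModType R) (I : finType) (F : I -> V -> W) x :
  (forall i, differentiable (F i) x) -> differentiable (fun y => \sum_i F i y) x.
Proof.
move=> dF; have -> : (fun y => \sum_i F i y) = \sum_i F i.
  by apply/funext => y; rewrite fct_sumE.
by elim/big_ind : _ => // f g; exact: differentiableD.
Qed.

Lemma differentiable_bil m (A : V -> 'M[R]_m.+1) (u v : V -> 'rV[R]_m.+1) x :
  differentiable A x -> differentiable u x -> differentiable v x ->
  differentiable (fun y => bil (A y) (u y) (v y)) x.
Proof.
move=> dA du dv; apply: differentiable_entry; apply: differentiable_mulmx.
  exact: differentiable_mulmx.
exact: differentiable_tr.
Qed.

Lemma contr_contr m (k : 'M[R]_m) (T : 'I_m -> 'I_m -> 'I_m -> 'I_m -> R) :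
  \sum_i1 \sum_i2 \sum_l1 \sum_l2 k i1 i2 * k l1 l2 * T i1 i2 l1 l2 =
  contr k (fun i1 i2 => contr k (T i1 i2)).
Proof.
apply: eq_bigr => i1 _; apply: eq_bigr => i2 _.
rewrite mulr_sumr; apply: eq_bigr => l1 _.
by rewrite mulr_sumr; apply: eq_bigr => l2 _; rewrite mulrA.
Qed.

Lemma differentiable_contr m (k : V -> 'M[R]_m) (Q : V -> 'I_m -> 'I_m -> R) x :
  differentiable k x -> (forall a b, differentiable (fun y => Q y a b) x) ->
  differentiable (fun y => contr (k y) (Q y)) x.
Proof.
move=> dk dQ; apply: differentiable_fsum => a; apply: differentiable_fsum => b.
exact: (differentiableM (differentiable_entry a b dk) (dQ a b)).
Qed.

Lemma invmx22E (h : 'M[R]_2) : h \in unitmx ->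
  [/\ invmx h 0 0 = (\det h)^-1 * h 1 1, invmx h 1 1 = (\det h)^-1 * h 0 0,
      invmx h 0 1 = - ((\det h)^-1 * h 0 1) & invmx h 1 0 = - ((\det h)^-1 * h 1 0)].
Proof.
move=> uh; rewrite /invmx uh.
have cof i k : (\adj h) i k = (-1) ^+ (k + i) * \det (row' k (col' i h)) by rewrite mxE.
have l (i : 'I_2) (k : 'I_1) : lift i k = (1 - i).
  by case: i k => -[|[|//]] ? [[|//] ?]; apply/val_inj.
have d1 i k : \det (row' k (col' i h)) = h (1 - k) (1 - i).
  by rewrite det_mx11 !mxE !l.
split; rewrite mxE cof d1 /= ?subrr ?subr0.
- by rewrite expr0 mul1r.
- by rewrite sqrrN expr1n mul1r.
- by rewrite mulN1r mulrN.
- by rewrite mulN1r mulrN.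
Qed.

Lemma det22E (h : 'M[R]_2) : \det h = h 0 0 * h 1 1 - h 0 1 * h 1 0.
Proof.
rewrite (expand_det_row _ ord0) !big_ord_recl big_ord0 /cofactor !det_mx11 !mxE /=.
rewrite addr0 expr0 mul1r expr1 mulN1r mulrN.
by congr (_ * _ - _ * _); congr (h _ _); apply/val_inj.
Qed.

Lemma differentiable_invmx22 (h : V -> 'M[R]_2) x :
  (\near x, h x \in unitmx) -> differentiable h x ->
  differentiable (fun y => invmx (h y)) x.
Proof.
move=> uh dh; have dij i k := differentiable_entry i k dh.
have ddet : differentiable (fun y => (\det (h y))^-1) x.
  apply: differentiableV.
    have -> : (fun y => \det (h y)) = (fun y => h y 0 0 * h y 1 1) - (fun y => h y 0 1 * h y 1 0).
      by apply/funext => y; rewrite det22E.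
    by apply: differentiableB; apply: differentiableM.
  by have := nbhs_singleton uh; rewrite unitmxE unitfE.
have two (i : 'I_2) : i = 0 \/ i = 1.
  by case: i => -[|[|//]] ?; [left|right]; exact/val_inj.
apply: differentiable_mx => i k.
have [->|->] := two i; have [->|->] := two k.
- apply: (@near_eq_differentiable _ _ _ (fun y => (\det (h y))^-1 * h y 1 1)).
    by apply: filterS uh => y /invmx22E[-> _ _ _].
  exact: differentiableM.
- apply: (@near_eq_differentiable _ _ _ (fun y => - ((\det (h y))^-1 * h y 0 1))).
    by apply: filterS uh => y /invmx22E[_ _ -> _].
  by apply: differentiableN; apply: differentiableM.
- apply: (@near_eq_differentiable _ _ _ (fun y => - ((\det (h y))^-1 * h y 1 0))).
    by apply: filterS uh => y /invmx22E[_ _ _ ->].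
  by apply: differentiableN; apply: differentiableM.
- apply: (@near_eq_differentiable _ _ _ (fun y => (\det (h y))^-1 * h y 0 0)).
    by apply: filterS uh => y /invmx22E[_ -> _ _].
  exact: differentiableM.
Qed.

End differentiable_tools.

Section norms.
Variables (R : realType) (n : nat) (S : manifold R 1) (M : manifold R n.*2).
Local Notation E := 'rV[R]_n.*2.+1.
Local Notation E2 := 'rV[R]_2.
Local Notation e := (basis_vec R).
Variables (W : set S) (w : S -> M).
Variables (lam : one_form M) (X : vector_field M) (J : tensor2 M).
Variables (h : tensor2 S) (Gh : connection S) (G : connection M).
Hypotheses (oW : open W) (sw : smooth_map W w).
Hypotheses (htriad : is_contact_triad lam X J) (mh : is_metric W h).
Hypotheses (cGh : is_connection W Gh) (cG : is_connection setT G).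

Local Notation n2 := (norm2 w lam X J h).
Local Notation nn2 := (nnorm2 w lam X J h Gh G).

Lemma transE (a b : idx S) p : cdom (atlas a) p ->
  trans a b (cmap (atlas a) p) = cmap (atlas b) p.
Proof. by move=> ap; rewrite /trans /= cmapK. Qed.

(** The source chart is exchanged first and the target chart second, so that at each stage a single
    transition map is involved. *)
Lemma norm_dwE p a c : W p -> cdom (atlas a) p -> cdom (atlas c) (w p) ->
  norm_dw w lam X J h p = Num.sqrt (n2 a c (cmap (atlas a) p)).
Proof.
move=> Wp ap cp; have a'p := chart_atP p; have c'p := chart_atP (w p).
have E1 := norm2_source oW sw ap a'p Wp cp htriad mh.
have E2 := norm2_target h oW sw a'p Wp c'p cp htriad.
exact: (congr1 Num.sqrt (esym (etrans E1 (etrans (congr1 (n2 _ c) (transE _ ap)) (esym E2))))).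
Qed.

Lemma norm_nabla_dwE p a c : W p -> cdom (atlas a) p -> cdom (atlas c) (w p) ->
  norm_nabla_dw w lam X J h Gh G p = Num.sqrt (nn2 a c (cmap (atlas a) p)).
Proof.
move=> Wp ap cp; have a'p := chart_atP p; have c'p := chart_atP (w p).
have E1 := nnorm2_source G oW sw ap a'p Wp cp htriad mh cGh.
have E2 := nnorm2_target h Gh oW sw a'p Wp c'p cp htriad cG.
refine (etrans _ (congr1 Num.sqrt (esym (etrans E1 (etrans (congr1 (nn2 _ c) (transE _ ap)) (esym E2)))))).
exact: (congr1 Num.sqrt (contr_contr (invmx (h (chart_at p) (cmap (atlas (chart_at p)) p)))
  (fun i1 i2 l1 l2 => triad_metric lam X J (chart_at (w p))
     (local_rep w (chart_at p) (chart_at (w p)) (cmap (atlas (chart_at p)) p))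
     (nabla_dw w Gh G (chart_at p) (chart_at (w p)) (cmap (atlas (chart_at p)) p) (e i1) (e l1))
     (nabla_dw w Gh G (chart_at p) (chart_at (w p)) (cmap (atlas (chart_at p)) p) (e i2) (e l2))))).
Qed.

Let oT c : open (cimg [set: M] c). Proof. by apply: cimg_openW; exact: openT. Qed.

Lemma proj_mx_diff c y : cimg setT c y -> differentiable (proj_mx lam X c) y.
Proof.
move=> cy; apply: differentiable_sub_mx; first exact: differentiable_cst.
apply: differentiable_mulmx; first exact: (lam_diff htriad cy).
by case: htriad => _ [[sX _] _ _] _ _; exact: (smooth_diff (@oT c) (sX c) cy).
Qed.

Lemma J_diff c y : cimg setT c y -> differentiable (J c) y.
Proof. by case: htriad => _ _ [sJ _] _ cy; exact: (smooth_diff (@oT c) (sJ c) cy). Qed.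

Lemma dlam_mx_diff c y : cimg setT c y -> differentiable (dlam_mx lam c) y.
Proof.
move=> cy; apply: differentiable_mx => i k.
have -> : (fun z => dlam_mx lam c z i k) =
   (fun z => ('D_(e i) (lam c) z) k 0) - (fun z => ('D_(e k) (lam c) z) i 0).
  by apply/funext => z; rewrite mxE.
have sl : smooth_on (cimg setT c) (lam c) by case: htriad => -[[]].
by apply: differentiableB; apply: differentiable_entry; exact: (smooth_derive_dir_diff _ (@oT c) sl cy).
Qed.

Lemma triad_mx_diff c y : cimg setT c y -> differentiable (triad_mx lam X J c) y.
Proof.
move=> cy; have dP := proj_mx_diff cy; have dl := lam_diff htriad cy.
apply: differentiable_add_mx; last first.
  by apply: differentiable_mulmx => //; exact: differentiable_tr.
apply: differentiable_mulmx.
  by apply: differentiable_mulmx => //; exact: dlam_mx_diff.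
by apply: differentiable_tr; apply: differentiable_mulmx => //; exact: J_diff.
Qed.

Section at_point.
Variables (a : idx S) (c : idx M) (x : E2).
Hypothesis dx : local_dom W w a c x.
Let f := local_rep w a c.
Let df : differentiable f x. Proof. exact: (local_rep_diff oW sw dx). Qed.
Let oD : open (local_dom W w a c). Proof. exact: local_dom_open. Qed.
Let sf : smooth_on (local_dom W w a c) f. Proof. exact: local_rep_smooth. Qed.

Let nx : \near x, local_dom W w a c x.
Proof. exact: (open_near oD dx). Qed.

Lemma invh_diff : differentiable (fun y => invmx (h a y)) x.
Proof.
apply: differentiable_invmx22.
  by apply: (open_near oD dx) => y dy; exact: metric_unit mh (local_dom_cimg dy).
case: mh => sh _ _ _; exact: (smooth_diff (cimg_openW oW) (sh a) (local_dom_cimg dx)).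
Qed.

Let dDf i : differentiable (fun y => 'D_(e i) f y) x.
Proof. exact: (smooth_derive_dir_diff _ oD sf dx). Qed.

Lemma norm2_diff : differentiable (n2 a c) x.
Proof.
apply: differentiable_contr; first exact: invh_diff.
move=> i k; apply: (@near_eq_differentiable _ _ _ (fun y => bil (triad_mx lam X J c (f y)) ('D_(e i) f y) ('D_(e k) f y))).
  by apply: filterS nx => y dy; rewrite (triad_bil htriad)//; exact: local_rep_cimg dy.
apply: (differentiable_bil _ (dDf i) (dDf k)).
exact: (differentiable_comp df (triad_mx_diff (local_rep_cimg dx))).
Qed.

Lemma chris_diff m (V : normedModType R) (Ga : 'rV[R]_m.+1 -> 'I_m.+1 -> 'M[R]_m.+1)
   (y u v : V -> 'rV[R]_m.+1) z :
  (forall k, differentiable (fun t => Ga t k) (y z)) ->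
  differentiable y z -> differentiable u z -> differentiable v z ->
  differentiable (fun t => chris Ga (y t) (u t) (v t)) z.
Proof.
move=> dG dy du dv; apply: differentiable_mx => i k.
have -> : (fun t => chris Ga (y t) (u t) (v t) i k) = (fun t => bil (Ga (y t) k) (u t) (v t)).
  by apply/funext => t; rewrite mxE.
by apply: differentiable_bil => //; exact: (differentiable_comp dy (dG k)).
Qed.

Lemma nabla_dw_diff i k : differentiable (fun y => nabla_dw w Gh G a c y (e i) (e k)) x.
Proof.
have d1 : differentiable (fun y => 'D_(e i) (fun y => 'D_(e k) f y) y) x.
  exact: (smooth_derive_dir_diff _ oD (smooth_derive k sf) dx).
have d2 : differentiable (fun y => chris (G c) (f y) ('D_(e i) f y) ('D_(e k) f y)) x.
  apply: chris_diff => // l.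
  by case: cG => sG _; exact: (smooth_diff (@oT c) (sG c l) (local_rep_cimg dx)).
have d3 : differentiable (fun y => 'D_(chris (Gh a) y (e i) (e k)) f y) x.
  apply: (@near_eq_differentiable _ _ _ (fun y => \sum_l (chris (Gh a) y (e i) (e k)) 0 l *: 'D_(e l) f y)).
    apply: filterS nx => y dy; rewrite -derive_basis//; exact: (local_rep_diff oW sw dy).
  apply: differentiable_fsum => l.
  have dch : differentiable (fun y => chris (Gh a) y (e i) (e k)) x.
    apply: chris_diff => // l'.
    by case: cGh => sG _; exact: (smooth_diff (cimg_openW oW) (sG a l') (local_dom_cimg dx)).
  apply: differentiable_mx => i' k'.
  have -> : (fun y => (chris (Gh a) y (e i) (e k) 0 l *: 'D_(e l) f y) i' k') =
     (fun y => chris (Gh a) y (e i) (e k) 0 l) * (fun y => ('D_(e l) f y) i' k').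
    by apply/funext => y; rewrite mxE.
  by apply: differentiableM; exact: differentiable_entry.
exact: (differentiable_sub_mx (differentiable_add_mx d1 d2) d3).
Qed.

Lemma nnorm2_diff : differentiable (nn2 a c) x.
Proof.
apply: differentiable_contr; first exact: invh_diff.
move=> i1 i2; apply: differentiable_contr; first exact: invh_diff.
move=> l1 l2; apply: (@near_eq_differentiable _ _ _ (fun y => bil (triad_mx lam X J c (f y))
  (nabla_dw w Gh G a c y (e i1) (e l1)) (nabla_dw w Gh G a c y (e i2) (e l2)))).
  by apply: filterS nx => y dy; rewrite (triad_bil htriad)//; exact: local_rep_cimg dy.
apply: differentiable_bil; [|exact: nabla_dw_diff..].
exact: (differentiable_comp df (triad_mx_diff (local_rep_cimg dx))).
Qed.

End at_point.

(** [norm_dw] and [norm_nabla_dw] select their charts point by point and are not visibly continuous.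
    Chart independence identifies each of them near p with the square root of one fixed coordinate
    expression. The continuity is what later makes the integrands measurable. *)
Let sqrt_cont (N : S -> R) (F : E2 -> R) a c p : W p -> cdom (atlas a) p -> cdom (atlas c) (w p) ->
  (forall q, W q -> cdom (atlas a) q -> cdom (atlas c) (w q) ->
     N q = Num.sqrt (F (cmap (atlas a) q))) ->
  differentiable F (cmap (atlas a) p) -> {for p, continuous N}.
Proof.
move=> Wp ap cp NE dF.
have oV : open (cdom (atlas a) `&` (W `&` w @^-1` cdom (atlas c))).
  apply: openI; first exact: cdom_open.
  by apply: preimage_open => //; exact: cdom_open.
apply: (@continuous_near_eq _ _ (Num.sqrt \o (F \o cmap (atlas a)))).
  by apply: (open_near oV) => // q [aq [Wq cq]]; rewrite NE.
apply: continuous_comp; last exact: sqrt_continuous.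
apply: continuous_comp; first exact: cmap_cont.
exact: differentiable_continuous.
Qed.

Lemma norm_dw_continuous p : W p -> {for p, continuous (norm_dw w lam X J h)}.
Proof.
move=> Wp; have ap := chart_atP p; have cp := chart_atP (w p).
apply: (@sqrt_cont _ (n2 (chart_at p) (chart_at (w p))) _ _ _ Wp ap cp).
  by move=> q *; exact: norm_dwE.
exact/norm2_diff/local_dom_intro.
Qed.

Lemma norm_nabla_dw_continuous p : W p ->
  {for p, continuous (norm_nabla_dw w lam X J h Gh G)}.
Proof.
move=> Wp; have ap := chart_atP p; have cp := chart_atP (w p).
apply: (@sqrt_cont _ (nn2 (chart_at p) (chart_at (w p))) _ _ _ Wp ap cp).
  by move=> q *; exact: norm_nabla_dwE.
exact/nnorm2_diff/local_dom_intro.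
Qed.

End norms.

(** * The second-order equation of a contact instanton *)

Section compact_bounds.
Variables (R : realType) (T : topologicalType) (K : set T).
Hypothesis cK : compact K.

Lemma compact_bound (V : normedModType R) (f : T -> V) :
  (forall x, K x -> {for x, continuous f}) ->
  exists2 C : R, 0 < C & forall x, K x -> `|f x| <= C.
Proof.
move=> cf; have [->|K0] := eqVneq K set0; first by exists 1.
have cn : {within K, continuous (fun x => `|f x|)}.
  apply: continuous_in_subspaceT => x /[!inE] Kx.
  exact: (continuous_comp (cf x Kx) (@norm_continuous _ _ _)).
have [c cK' cmax] := compact_EVT_max ((set0P _).1 K0) cK cn.
exists (`|f c| + 1); first by rewrite ltr_wpDl.
by move=> x Kx; rewrite (le_trans (cmax _ _)) ?inE// lerDl.
Qed.

Lemma compact_bound_fin (I : finType) (V : normedModType R) (f : I -> T -> V) :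
  (forall i x, K x -> {for x, continuous (f i)}) ->
  exists2 C : R, 0 < C & forall i x, K x -> `|f i x| <= C.
Proof.
move=> cf.
have /choice[C CP] i : exists C : R, 0 < C /\ forall x, K x -> `|f i x| <= C.
  by have [C C0 CP] := compact_bound (cf i); exists C.
have C0 i : 0 <= C i by rewrite ltW//; case: (CP i).
exists (1 + \sum_i C i); first by rewrite ltr_wpDr// sumr_ge0.
move=> i x Kx; rewrite (le_trans ((CP i).2 x Kx))// (bigD1 i)//=.
by rewrite addrCA lerDl addr_ge0// sumr_ge0.
Qed.

End compact_bounds.

Section norms_of_products.
Variable R : realType.

Lemma norm_mulmx_le p q r (A : 'M[R]_(p, q)) (B : 'M[R]_(q, r)) (a b : R) :
  `|A| <= a -> `|B| <= b -> `|A *m B| <= q%:R * (a * b).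
Proof.
move=> Aa Bb; have a0 : 0 <= a by rewrite (le_trans _ Aa).
have b0 : 0 <= b by rewrite (le_trans _ Bb).
apply: norm_le_entry => [|i k]; first by rewrite !mulr_ge0.
rewrite mxE (le_trans (ler_norm_sum _ _ _))//.
rewrite -[q in leRHS]card_ord mulr_natl -sumr_const ler_sum// => l _.
rewrite normrM ler_pM// (le_trans (entry_le_norm _ _ _))//.
Qed.

Lemma norm_row_le p q (A : 'M[R]_(p, q)) i : `|row i A| <= `|A|.
Proof. by apply: norm_le_entry => // a b; rewrite mxE entry_le_norm. Qed.

Lemma norm_tr p q (A : 'M[R]_(p, q)) : `|A^T| <= `|A|.
Proof. by apply: norm_le_entry => // a b; rewrite mxE entry_le_norm. Qed.

Lemma norm_bil_le m (A : 'M[R]_m.+1) (u v : 'rV[R]_m.+1) (a b c : R) :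
  `|A| <= a -> `|u| <= b -> `|v| <= c ->
  `|bil A u v| <= m.+1%:R * (m.+1%:R * (b * a) * c).
Proof.
move=> Aa ub vc; rewrite (le_trans (entry_le_norm _ _ _))//.
by do ?apply: norm_mulmx_le => //; rewrite (le_trans (norm_tr _)).
Qed.

Lemma norm_contr_le m (k : 'M[R]_m) (Q : 'I_m -> 'I_m -> R) (a b : R) :
  `|k| <= a -> (forall i j, `|Q i j| <= b) -> 0 <= b -> `|contr k Q| <= m%:R * (m%:R * (a * b)).
Proof.
move=> ka Qb b0; have a0 : 0 <= a by rewrite (le_trans _ ka).
have sumB (F : 'I_m -> R) (c : R) : (forall i, `|F i| <= c) -> `|\sum_i F i| <= m%:R * c.
  move=> Fc; rewrite (le_trans (ler_norm_sum _ _ _))//.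
  by rewrite -[m in leRHS]card_ord mulr_natl -sumr_const ler_sum.
apply: (sumB) => i; apply: (sumB) => l; rewrite normrM ler_pM//.
by rewrite (le_trans (entry_le_norm _ _ _)).
Qed.

Lemma norm_chris_le m (Ga : 'rV[R]_m.+1 -> 'I_m.+1 -> 'M[R]_m.+1) y (u v : 'rV[R]_m.+1) (a b c : R) :
  (forall k, `|Ga y k| <= a) -> `|u| <= b -> `|v| <= c -> 
  `|chris Ga y u v| <= m.+1%:R * (m.+1%:R * (b * a) * c).
Proof.
move=> Gaa ub vc; apply: norm_le_entry => [|i l].
  by rewrite (le_trans _ (norm_bil_le (Gaa ord0) ub vc)).
by rewrite mxE; exact: norm_bil_le.
Qed.

Lemma norm_derive_le (W : normedModType R) m (A : 'rV[R]_m.+1 -> W) y v (a b : R) :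
  differentiable A y -> (forall i, `|'D_(basis_vec R i) A y| <= a) -> `|v| <= b ->
  `|'D_v A y| <= m.+1%:R * (b * a).
Proof.
move=> dA Aa vb; rewrite (derive_basis _ dA) (le_trans (ler_norm_sum _ _ _))//.
have b0 : 0 <= b by rewrite (le_trans _ vb).
rewrite -[m.+1 in leRHS]card_ord mulr_natl -sumr_const ler_sum// => l _.
by rewrite normrZ ler_pM// (le_trans (entry_le_norm _ _ _)).
Qed.

Lemma norm_sub_le (W : normedModType R) (u v : W) (a b : R) :
  `|u| <= a -> `|v| <= b -> `|u - v| <= a + b.
Proof. by move=> ua vb; rewrite (le_trans (ler_normB _ _))// lerD. Qed.

Lemma norm_add_le (W : normedModType R) (u v : W) (a b : R) :
  `|u| <= a -> `|v| <= b -> `|u + v| <= a + b.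
Proof. by move=> ua vb; rewrite (le_trans (ler_normD _ _))// lerD. Qed.

End norms_of_products.

Lemma sum2 (V : nmodType) (F : 'I_2 -> V) : \sum_i F i = F 0 + F 1.
Proof. by rewrite !big_ord_recl big_ord0 addr0; congr (F _ + F _); exact/val_inj. Qed.

Section ell.
Variables (R : realType) (m : nat).

(** When [D0] and [D1] are the derivatives of the Jacobian of f along the two axes, this is the
    second-order part of the curl of df o j. For j = 1 it vanishes by the symmetry of second
    derivatives. *)
Definition ell (j0 : 'M[R]_2) (D0 D1 : 'M[R]_(2, m)) : 'rV[R]_m :=
  row 1 (j0 *m D0) - row 0 (j0 *m D1).

Lemma ell1 (D0 D1 : 'M[R]_(2, m)) : (forall k, D0 1 k = D1 0 k) -> ell 1%:M D0 D1 = 0.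
Proof.
by move=> DE; apply/rowP => k; rewrite /ell !mul1mx !mxE DE subrr.
Qed.

Lemma ell_curl q (j0 : 'M[R]_2) D0 D1 (A : 'M[R]_(m, q)) (e0 e1 : 'M[R]_(2, q)) :
  row 0 (j0 *m D1 *m A + e1) - row 1 (j0 *m D0 *m A + e0) + ell j0 D0 D1 *m A =
  row 0 e1 - row 1 e0.
Proof.
rewrite /ell !linearD/= mulmxBl -!row_mul.
move: (row 0 (_ *m A)) (row 1 (_ *m A)) (row 0 e1) (row 1 e0) => a b r1 r0.
by apply/rowP => k; rewrite !mxE; ring.
Qed.

Lemma ellE (j0 : 'M[R]_2) D0 D1 k :
  ell j0 D0 D1 0 k = j0 1 0 * D0 0 k + j0 1 1 * D0 1 k - (j0 0 0 * D1 0 k + j0 0 1 * D1 1 k).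
Proof. by rewrite /ell !mxE !sum2. Qed.

End ell.

Section curl.
Variables (R : realType) (m q : nat).
Local Notation E := 'rV[R]_m.+1.
Local Notation E2 := 'rV[R]_2.
Local Notation e := (basis_vec R).
Variables (O : set E2) (f : E2 -> E) (x : E2).
Hypotheses (oO : open O) (sf : smooth_on O f) (Ox : O x).
Implicit Types (jm : E2 -> 'M[R]_2) (A : E -> 'M[R]_(m.+1, q)).

Let df : differentiable f x. Proof. exact: (smooth_diff oO sf Ox). Qed.

Lemma jac_diff : differentiable (jac f) x.
Proof.
apply: differentiable_mx => i k.
have -> : (fun y => jac f y i k) = (fun y => ('D_(e i) f y) 0 k).
  by apply/funext => y; rewrite mxE.
by apply: differentiable_entry; exact: (smooth_derive_dir_diff _ oO sf Ox).
Qed.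

Lemma derive_jacE l i k : ('D_l (jac f) x) i k = ('D_l (fun y => 'D_(e i) f y) x) 0 k.
Proof.
refine (etrans (diff_entry _ _ _ jac_diff) _).
refine (etrans _ (esym (diff_entry _ _ _ (smooth_derive_dir_diff _ oO sf Ox)))).
by congr ('D_l _ x); apply/funext => y; rewrite mxE.
Qed.

Definition elliptic_op jm : E :=
  ell (jm x) ('D_(e 0) (jac f) x) ('D_(e 1) (jac f) x).

Lemma derive_jac_sym k : ('D_(e 0) (jac f) x) 1 k = ('D_(e 1) (jac f) x) 0 k.
Proof.
refine (etrans (derive_jacE _ _ _) (etrans _ (esym (derive_jacE _ _ _)))).
by apply: (congr1 (fun v : E => v 0 k)); exact: (derive2_sym _ _ oO sf Ox).
Qed.

Lemma elliptic_op1 : elliptic_op (cst 1%:M) = 0.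
Proof. by apply: ell1; exact: derive_jac_sym. Qed.

(* Second derivatives of f enter the curl of the 1-form A(f) o df o jm only
   through [elliptic_op jm *m A (f x)].  Both instanton equations say that such
   a curl vanishes or equals one with jm = 1, and elliptic_op 1 = 0. *)
Lemma curl_bound jm A (B N : R) :
  differentiable jm x -> differentiable A (f x) ->
  `|jm x| <= B -> (forall i, `|'D_(e i) jm x| <= B) ->
  `|A (f x)| <= B -> (forall i, `|'D_(e i) A (f x)| <= B) -> `|jac f x| <= N ->
  `|row 0 ('D_(e 1) (fun y => jm y *m jac f y *m A (f y)) x) -
    row 1 ('D_(e 0) (fun y => jm y *m jac f y *m A (f y)) x) + elliptic_op jm *m A (f x)| <=
  4 * m.+1%:R ^+ 2 * B ^+ 2 * (N + N ^+ 2).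
Proof.
move=> djm dA jB DjB AB DAB fN; pose P y := jm y *m jac f y *m A (f y).
have B0 : 0 <= B by rewrite (le_trans _ jB).
have N0 : 0 <= N by rewrite (le_trans _ fN).
have dAf : differentiable (A \o f) x by exact: differentiable_comp.
(* The terms in which the derivative misses df. The first is linear in df; the second is quadratic,
   since differentiating A along f produces another factor df. *)
pose err l := 'D_(e l) jm x *m jac f x *m A (f x) + jm x *m jac f x *m 'D_('D_(e l) f x) A (f x).
have DP l : 'D_(e l) P x = jm x *m 'D_(e l) (jac f) x *m A (f x) + err l.
  have E1 := derive_mulmx (e l) (differentiable_mulmx djm jac_diff) dAf.
  refine (etrans E1 _); rewrite (derive_chain _ df dA) (derive_mulmx _ djm jac_diff).
  by rewrite mulmxDl -addrA addrCA.
have errB l : `|err l| <= 2 * m.+1%:R ^+ 2 * B ^+ 2 * (N + N ^+ 2).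
  have FN : `|'D_(e l) f x| <= N by rewrite -row_jac (le_trans (norm_row_le _ _)).
  have := norm_add_le (norm_mulmx_le (norm_mulmx_le (DjB l) fN) AB)
    (norm_mulmx_le (norm_mulmx_le jB fN) (norm_derive_le dA DAB FN)).
  move/le_trans; apply; rewrite (_ : 2 * _ * _ * _ = m.+1%:R * (2 * (B * N) * B) * m.+1%:R + m.+1%:R * (2 * (B * N) * (m.+1%:R * (N * B)))); last by ring.
  by rewrite lerD2r ler_peMr// ?ler1n// !mulr_ge0.
rewrite [X in row 0 X](DP 1) [X in row 1 X](DP 0) ell_curl.
have := norm_sub_le (le_trans (norm_row_le _ 0) (errB 1)) (le_trans (norm_row_le _ 1) (errB 0)).
by move/le_trans; apply; rewrite le_eqVlt; apply/orP; left; apply/eqP; ring.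
Qed.

End curl.

Section instanton_estimates.
Variables (R : realType) (n : nat) (S : manifold R 1) (M : manifold R n.*2).
Local Notation E := 'rV[R]_n.*2.+1.
Local Notation E2 := 'rV[R]_2.
Local Notation e := (basis_vec R).
Variables (W : set S).
Variables (lam : one_form M) (X : vector_field M) (J : tensor2 M) (j : tensor2 S).
Hypotheses (oW : open W) (htriad : is_contact_triad lam X J).
Hypothesis cj : is_complex_structure j.

Let oT c : open (cimg [set: M] c). Proof. by apply: cimg_openW; exact: openT. Qed.

Lemma j_diff a x : cimg W a x -> differentiable (j a) x.
Proof.
have oT' : open (cimg [set: S] a) by apply: cimg_openW; exact: openT.
case: cj => -[sj _] _ ax; apply: (smooth_diff oT' (sj a)).
by case: ax => p [ap Wp] <-; exact: cimg_intro.
Qed.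

Definition projJ_mx c y : 'M[R]_n.*2.+1 := proj_mx lam X c y *m J c y.

Lemma lam_proj c y (v : E) : cimg setT c y -> covec (lam c y) (v *m proj_mx lam X c y) = 0.
Proof.
move=> cy; have lX : covec (lam c y) (X c y) = 1 by case: htriad => _ [_ H _] _ _; exact: H.
rewrite -proj_xiE /proj_xi /covec mulmxBl -scalemxAl mxE.
rewrite [X in _ + X]mxE [X in _ - X]mxE.
move: lX; rewrite /covec => ->; rewrite mulr1; exact: subrr.
Qed.

(** The endomorphism J squares to -1 on xi only, hence the projection in front. *)
Lemma proj_mxJJ c y (v : E) : cimg setT c y -> v *m proj_mx lam X c y *m J c y *m J c y = - (v *m proj_mx lam X c y).
Proof.
move=> cy; case: htriad => _ _ _ /(_ c y cy)[_ H _ _].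
exact: (H _ (lam_proj v cy)).2.
Qed.

Section at_point.
Variables (w : S -> M) (hw : contact_instanton W w lam X J j).
Let sw : smooth_map W w := hw.1.
Variables (a : idx S) (c : idx M) (x : E2).
Hypothesis dx : local_dom W w a c x.
Let f := local_rep w a c.
Let O := local_dom W w a c.
Let oO : open O. Proof. exact: local_dom_open. Qed.
Let sf : smooth_on O f. Proof. exact: local_rep_smooth. Qed.
Let cx : cimg setT c (f x). Proof. exact: local_rep_cimg dx. Qed.

Let row_curl (q : nat) (A : E -> 'M[R]_(n.*2.+1, q)) y i : O y ->
  row i (j a y *m jac f y *m A (f y)) = 'D_(e i *m j a y) f y *m A (f y).
Proof.
move=> Oy; rewrite (derive_jac _ (smooth_diff oO sf Oy)) !row_mul.
by rewrite /basis_vec rowE.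
Qed.

Lemma instanton_proj y : O y ->
  jac f y *m proj_mx lam X c (f y) + j a y *m jac f y *m projJ_mx c (f y) = 0.
Proof.
move=> Oy; apply/row_matrixP => i; rewrite row0 linearD/= row_curl// row_mul row_jac.
have [/(_ (e i)) H _] := hw.2 _ _ _ Oy.
rewrite /projJ_mx mulmxA; apply/eqP.
have /eqP := etrans (esym (congr1 (fun v => 2^-1 *: v)
  (congr2 (fun u v => u + v *m J c (f y)) (proj_xiE lam X c (f y) ('D_(e i) f y)) (proj_xiE lam X c (f y) ('D_(e i *m j a y) f y))))) H.
by rewrite scaler_eq0 invr_eq0 pnatr_eq0.
Qed.

Variables (B N : R).
Hypotheses (jB : `|j a x| <= B) (DjB : forall i, `|'D_(e i) (j a) x| <= B).
Hypotheses (lB : `|lam c (f x)| <= B) (DlB : forall i, `|'D_(e i) (lam c) (f x)| <= B).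
Hypotheses (PB : `|proj_mx lam X c (f x)| <= B) (DPB : forall i, `|'D_(e i) (proj_mx lam X c) (f x)| <= B).
Hypotheses (KB : `|projJ_mx c (f x)| <= B) (DKB : forall i, `|'D_(e i) (projJ_mx c) (f x)| <= B).
Hypotheses (JB : `|J c (f x)| <= B) (XB : `|X c (f x)| <= B) (B1 : 1 <= B).
Hypothesis fN : `|jac f x| <= N.

Let dj : differentiable (j a) x. Proof. exact: (j_diff (local_dom_cimg dx)). Qed.
Let k := n.*2.+1%:R : R.
Let C0 := 4 * k ^+ 2 * B ^+ 2.

Let projJ_diff : differentiable (projJ_mx c) (f x).
Proof. exact: (differentiable_mulmx (proj_mx_diff htriad cx) (J_diff htriad cx)). Qed.

Let df : differentiable f x. Proof. exact: (smooth_diff oO sf dx). Qed.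

Let L := elliptic_op f x (j a).

Let row_sub0 (A A' : 'M[R]_(2, 1)) : A 1 0 - A' 0 0 = 0 -> row 0 A' - row 1 A = 0.
Proof.
move/eqP; rewrite subr_eq0 => /eqP AE.
by apply/rowP => z; rewrite (ord1 z) !mxE AE subrr.
Qed.

(** The curl of w^*lambda o j is exactly zero, so [curl_bound] leaves only its lower-order terms. *)
Let lamB : `|L *m lam c (f x)| <= C0 * (N + N ^+ 2).
Proof.
have H := curl_bound oO sf dx dj (lam_diff htriad cx) jB DjB lB DlB fN.
suff E0 : row 0 ('D_(e 1) (fun y => j a y *m jac f y *m lam c (f y)) x) -
    row 1 ('D_(e 0) (fun y => j a y *m jac f y *m lam c (f y)) x) = 0.
  by rewrite E0 add0r in H.
have dP : differentiable (fun y => j a y *m jac f y *m lam c (f y)) x.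
  apply: differentiable_mulmx; first by apply: differentiable_mulmx => //; exact: (jac_diff oO sf dx).
  exact: (differentiable_comp df (lam_diff htriad cx)).
have [_ /(_ (e 0) (e 1)) H1] := hw.2 _ _ _ dx.
have pE l i : 'D_(e l) (fun y => pullback_lam_j w lam j a c y (e i)) x =
   ('D_(e l) (fun y => j a y *m jac f y *m lam c (f y)) x) i 0.
  refine (etrans _ (esym (diff_entry _ _ _ dP))).
  apply: near_eq_derive; apply: (open_near oO dx) => y Oy.
  have := row_curl (lam c) i Oy => /(congr1 (fun A : 'M[R]_(1, 1) => A 0 0)).
  by rewrite mxE => ->.
apply: row_sub0.
exact: etrans (esym (congr2 (fun u v => u - v) (pE 0 1) (pE 1 0))) H1.
Qed.

Let row_opp_cancel (A A' : 'M[R]_(2, n.*2.+1)) v :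
  v = (row 0 (- A) - row 1 (- A')) + (row 0 A - row 1 A' + v).
Proof. by apply/rowP => l; rewrite !mxE; ring. Qed.

(** With P the projection to xi, the first equation reads df P = - (df o j) P J. The curl of the
    left side has no second-order part, so that of the right side must be of lower order as well.
    The factor 2 counts the two uses of [curl_bound]. *)
Let projB : `|L *m projJ_mx c (f x)| <= 2 * C0 * (N + N ^+ 2).
Proof.
have dJ := jac_diff oO sf dx.
have dPf : differentiable (proj_mx lam X c \o f) x := differentiable_comp df (proj_mx_diff htriad cx).
have dKf : differentiable (projJ_mx c \o f) x := differentiable_comp df projJ_diff.
pose P1 y := (cst 1%:M : E2 -> 'M[R]_2) y *m jac f y *m proj_mx lam X c (f y).
pose P2 y := j a y *m jac f y *m projJ_mx c (f y).
have d1 : differentiable P1 x.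
  apply: differentiable_mulmx => //; apply: differentiable_mulmx => //; exact: differentiable_cst.
have d2 : differentiable P2 x by apply: differentiable_mulmx => //; exact: differentiable_mulmx.
have DE l : 'D_(e l) P1 x = - 'D_(e l) P2 x.
  apply/eqP; rewrite -addr_eq0; apply/eqP.
  refine (etrans (esym (deriveD (diff_derivable d1) (diff_derivable d2))) _).
  rewrite (near_eq_derive (e l) (_ : \near x, (P1 + P2) x = cst 0 x)) ?derive_cst//.
  by apply: (open_near oO dx) => y Oy; rewrite fctE /P1 /cst mul1mx; exact: instanton_proj.
have iB : `|(cst 1%:M : E2 -> 'M[R]_2) x| <= B.
  by apply: le_trans B1; apply: norm_le_entry => // i' k'; rewrite mxE; case: (_ == _); rewrite ?normr1 ?normr0.
have DiB i : `|'D_(e i) (cst 1%:M : E2 -> 'M[R]_2) x| <= B.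
  by rewrite derive_cst normr0 (le_trans ler01).
have H1 := curl_bound oO sf dx (differentiable_cst _ _) (proj_mx_diff htriad cx) iB DiB PB DPB fN.
have H2 := curl_bound oO sf dx dj projJ_diff jB DjB KB DKB fN.
rewrite (elliptic_op1 oO sf dx) mul0mx addr0 in H1.
have E1 : L *m projJ_mx c (f x) = (row 0 ('D_(e 1) P1 x) - row 1 ('D_(e 0) P1 x)) +
    (row 0 ('D_(e 1) P2 x) - row 1 ('D_(e 0) P2 x) + L *m projJ_mx c (f x)).
  by rewrite !DE; exact: row_opp_cancel.
rewrite E1; apply: (le_trans (norm_add_le H1 H2)).
by rewrite le_eqVlt; apply/orP; left; apply/eqP; rewrite /C0 /k; ring.
Qed.

(** Each equation controls one part of L: its Reeb component and its xi component turned by J. They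
    are reassembled as L = lam(L) X - (L P J) J. *)
Lemma elliptic_bound : `|L| <= 3 * k * B * C0 * (N + N ^+ 2).
Proof.
have -> : L = L *m lam c (f x) *m X c (f x) - L *m projJ_mx c (f x) *m J c (f x).
  rewrite /projJ_mx mulmxA (proj_mxJJ _ cx) opprK -[L *m _ *m _]mulmxA -covec_scale -proj_xiE /proj_xi.
  by rewrite addrC subrK.
apply: (le_trans (norm_sub_le (norm_mulmx_le lamB XB) (norm_mulmx_le projB JB))).
have N0 : 0 <= N by rewrite (le_trans _ fN).
have B0 : 0 <= B by rewrite (le_trans ler01).
have k1 : 1 <= k by rewrite ler1n.
pose T := C0 * (N + N ^+ 2) * B.
have T0 : 0 <= T by rewrite !mulr_ge0 ?addr_ge0 ?exprn_ge0.
rewrite -/T (_ : 2 * C0 * (N + N ^+ 2) * B = 2 * T); last by rewrite /T; ring.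
rewrite (_ : 3 * k * B * C0 * (N + N ^+ 2) = k * T + k * (2 * T)); last by rewrite /T; ring.
by rewrite lerD2r mul1r ler_peMl.
Qed.

End at_point.
End instanton_estimates.

(** * Coefficient bounds on compact sets, uniform in w *)

Lemma continuous_fsum (R : realType) (T : topologicalType) (V : normedModType R)
    (I : finType) (F : I -> T -> V) p :
  (forall i, {for p, continuous (F i)}) ->
  {for p, continuous (fun y => \sum_i F i y)}.
Proof.
move=> cF; have -> : (fun y => \sum_i F i y) = \sum_i F i.
  by apply/funext => y; rewrite fct_sumE.
elim/big_ind : _ => [|f g cf cg|i _]; last exact: cF.
  exact: cvg_cst.
exact: cvgD.
Qed.

Section uniform_bounds.
Variables (R : realType) (T : topologicalType) (K : set T).
Hypothesis cK : compact K.

(** Stating the bound for all large B, rather than for some B, lets any finite number of such bounds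
    be met by one constant through intersection of filter sets. *)
Lemma compact_bound_near (V : normedModType R) (f : T -> V) :
  (forall x, K x -> {for x, continuous f}) ->
  \forall B \near +oo_R, forall x, K x -> `|f x| <= B.
Proof.
move=> cf; have [C C0 CP] := compact_bound cK cf.
near=> B => x Kx; apply: (le_trans (CP x Kx)).
near: B; apply: nbhs_pinfty_ge; exact: num_real.
Unshelve. all: by end_near. Qed.

Lemma compact_bound_near_fin (I : finType) (V : normedModType R) (f : I -> T -> V) :
  (forall i x, K x -> {for x, continuous (f i)}) ->
  \forall B \near +oo_R, forall x, K x -> forall i, `|f i x| <= B.
Proof.
move=> cf; have [C C0 CP] := compact_bound_fin cK cf.
near=> B => x Kx i; apply: (le_trans (CP i x Kx)).
near: B; apply: nbhs_pinfty_ge; exact: num_real.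
Unshelve. all: by end_near. Qed.

End uniform_bounds.

Section twice.
Variables (R : realType) (m : nat) (U : set 'rV[R]_m.+1).
Hypothesis oU : open U.
Local Notation e := (basis_vec R).

(** A class containing the smooth fields whose stability under products needs the product rule only
    once. It provides continuity of F and of its first derivatives, which is all that the bounds on
    compact sets ask for. *)
Definition twice p q (F : 'rV[R]_m.+1 -> 'M[R]_(p, q)) :=
  forall x, U x -> differentiable F x /\ forall i, differentiable (fun y => 'D_(e i) F y) x.

Lemma smooth_twice p q (F : 'rV[R]_m.+1 -> 'M[R]_(p, q)) : smooth_on U F -> twice F.
Proof.
move=> sF x Ux; split=> [|i]; first exact: (smooth_diff oU sF Ux).
exact: (smooth_derive_dir_diff _ oU sF Ux).
Qed.

Lemma twice_cst p q (A : 'M[R]_(p, q)) : twice (cst A).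
Proof.
move=> x Ux; split=> [|i]; first exact: differentiable_cst.
rewrite (_ : (fun y => _) = cst 0); first exact: differentiable_cst.
by apply/funext => y; rewrite derive_cst.
Qed.

Lemma twice_sub p q (F G : 'rV[R]_m.+1 -> 'M[R]_(p, q)) :
  twice F -> twice G -> twice (fun y => F y - G y).
Proof.
move=> tF tG x Ux; split=> [|i].
  exact: differentiable_sub_mx (tF x Ux).1 (tG x Ux).1.
apply: (@near_eq_differentiable _ _ _ (fun y => 'D_(e i) F y - 'D_(e i) G y)).
  apply: (open_near oU Ux) => y Uy.
  by rewrite (derive_sub _ (tF y Uy).1 (tG y Uy).1).
exact: differentiable_sub_mx ((tF x Ux).2 i) ((tG x Ux).2 i).
Qed.

Lemma twice_mulmx p q r (F : 'rV[R]_m.+1 -> 'M[R]_(p, q)) (G : 'rV[R]_m.+1 -> 'M[R]_(q, r)) :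
  twice F -> twice G -> twice (fun y => F y *m G y).
Proof.
move=> tF tG x Ux; split=> [|i].
  exact: differentiable_mulmx (tF x Ux).1 (tG x Ux).1.
apply: (@near_eq_differentiable _ _ _ (fun y => 'D_(e i) F y *m G y + F y *m 'D_(e i) G y)).
  apply: (open_near oU Ux) => y Uy.
  by rewrite (derive_mulmx _ (tF y Uy).1 (tG y Uy).1).
apply: differentiable_add_mx; apply: differentiable_mulmx.
- exact: (tF x Ux).2.
- exact: (tG x Ux).1.
- exact: (tF x Ux).1.
- exact: (tG x Ux).2.
Qed.

Lemma twice_continuous p q (F : 'rV[R]_m.+1 -> 'M[R]_(p, q)) x : twice F -> U x ->
  {for x, continuous F}.
Proof. by move=> tF Ux; exact/differentiable_continuous/(tF x Ux).1. Qed.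

Lemma twice_derive_continuous p q (F : 'rV[R]_m.+1 -> 'M[R]_(p, q)) x i : twice F -> U x ->
  {for x, continuous (fun y => 'D_(e i) F y)}.
Proof. by move=> tF Ux; exact/differentiable_continuous/(tF x Ux).2. Qed.

End twice.

Lemma bil_scale (R : realType) m (A : 'M[R]_m.+1) a u v :
  bil A (a *: u) (a *: v) = a ^+ 2 * bil A u v.
Proof.
rewrite !bilE mulr_sumr; apply: eq_bigr => i _; rewrite mulr_sumr.
by apply: eq_bigr => k _; rewrite !mxE; ring.
Qed.

Section target_bounds.
Variables (R : realType) (n : nat) (M : manifold R n.*2).
Local Notation E := 'rV[R]_n.*2.+1.
Local Notation e := (basis_vec R).
Variables (lam : one_form M) (X : vector_field M) (J : tensor2 M) (G : connection M).
Hypotheses (htriad : is_contact_triad lam X J) (cG : is_connection setT G).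

Let oT c : open (cimg [set: M] c). Proof. by apply: cimg_openW; exact: openT. Qed.

Lemma triad_pos c y (v : E) : cimg setT c y -> v != 0 -> 0 < triad_metric lam X J c y v v.
Proof.
move=> cy v0; rewrite /triad_metric.
have lp : covec (lam c y) (proj_xi lam X c y v) = 0 by rewrite proj_xiE (lam_proj htriad).
have [_ _ _ /(_ c y cy)[_ _ _ pos]] := htriad.
have [pv0|pv] := eqVneq (proj_xi lam X c y v) 0; last first.
  by rewrite ltr_pwDl// ?pos// -expr2 sqr_ge0.
have l0 : covec (lam c y) v != 0.
  apply: contra v0 => /eqP l0; move: pv0; rewrite /proj_xi l0 scale0r subr0 => ->.
  by rewrite eqxx.
rewrite pv0 /g_xi (dlamE htriad)// mul0mx subrr add0r.
by rewrite -expr2 exprn_even_gt0.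
Qed.

(** One constant for all target data that enter the pointwise estimates, including the comparison of
    the coordinate norm with the triad metric. As w does not occur here, everything computed from B
    is uniform in w. *)
Definition target_bd c (y : E) (B : R) : Prop :=
  [/\ [/\ `|lam c y| <= B, forall i, `|'D_(e i) (lam c) y| <= B, `|X c y| <= B & `|J c y| <= B],
      [/\ `|proj_mx lam X c y| <= B, forall i, `|'D_(e i) (proj_mx lam X c) y| <= B,
          `|projJ_mx lam X J c y| <= B & forall i, `|'D_(e i) (projJ_mx lam X J c) y| <= B],
      `|triad_mx lam X J c y| <= B, forall k, `|G c y k| <= B
    & forall v, `|v| ^+ 2 <= B * triad_metric lam X J c y v v].

Lemma sphere_compact : compact [set v : E | `|v| = 1].
Proof.
apply: bounded_closed_compact.
  by exists 1; split=> [|r r1 v /= ->]; [exact: num_real|exact: ltW].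
have -> : [set v : E | `|v| = 1] = (fun v => `|v|) @^-1` [set 1] by [].
by apply: preimage_closed => [v _|]; [exact: norm_continuous|exact: closed_eq].
Qed.

(** The reciprocal of the metric is continuous, hence bounded, on the product of K with the unit
    sphere; homogeneity extends the bound to all vectors. *)
Lemma triad_coercive c (K : set E) : compact K -> K `<=` cimg setT c ->
  \forall B \near +oo_R, forall y, K y ->
    forall v, `|v| ^+ 2 <= B * triad_metric lam X J c y v v.
Proof.
move=> cK Kc; have cKS := compact_setX cK sphere_compact.
pose F (p : E * E) := (triad_metric lam X J c p.1 p.2 p.2)^-1.
(* The metric as an explicit polynomial in the components of v, which makes joint continuity in (y,
   v) evident. *)
pose Q (p : E * E) := \sum_i \sum_k p.2 0 i * p.2 0 k * triad_mx lam X J c p.1 i k.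
have ne0 (p : E * E) : (K `*` [set v : E | `|v| = 1]) p -> p.2 != 0.
  by move=> [_ /= p1]; rewrite -normr_eq0 p1 oner_eq0.
have cQ p : cimg setT c p.1 -> {for p, continuous Q}.
  move=> cp; have ct i k : {for p, continuous (fun p : E * E => triad_mx lam X J c p.1 i k)}.
    apply: (@continuous_comp _ _ _ (fun p : E * E => p.1) (fun y => triad_mx lam X J c y i k)).
      exact: cvg_fst.
    exact/differentiable_continuous/differentiable_entry/(triad_mx_diff htriad cp).
  have cv i : {for p, continuous (fun p : E * E => p.2 0 i)}.
    apply: (@continuous_comp _ _ _ (fun p : E * E => p.2) (fun v : E => v 0 i)).
      exact: cvg_snd.
    exact: coord_continuous.
  apply: continuous_fsum => i; apply: continuous_fsum => k.
  by apply: cvgM; [apply: cvgM; exact: cv|exact: ct].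
have QE p : cimg setT c p.1 -> Q p = triad_metric lam X J c p.1 p.2 p.2.
  by move=> cp; rewrite (triad_bil htriad)// bilE.
have cF p : (K `*` [set v : E | `|v| = 1]) p -> {for p, continuous (fun p => (Q p)^-1)}.
  move=> Kp; apply: cvgV; last exact/cQ/Kc/Kp.1.
  by rewrite QE ?gt_eqF ?triad_pos// ?ne0//; apply: Kc; exact: Kp.1.
have := compact_bound_near cKS cF; apply: filterS => B FB y Ky v.
have [->|v0] := eqVneq v 0.
  have -> : triad_metric lam X J c y 0 0 = 0.
    by rewrite (triad_bil htriad) ?/bil ?mul0mx ?mxE//; exact: Kc.
  by rewrite normr0 expr0n mulr0.
have nv : 0 < `|v| by rewrite normr_gt0.
pose u := `|v|^-1 *: v.
have u1 : `|u| = 1 by rewrite normrZ normfV normr_id mulVf// gt_eqF.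
have u0 : u != 0 by rewrite -normr_eq0 u1 oner_eq0.
have := FB (y, u) (conj Ky u1); rewrite QE/=; last exact: Kc.
have tu := triad_pos (Kc _ Ky) u0.
have tui : 0 <= (triad_metric lam X J c y u u)^-1 by rewrite invr_ge0 ltW.
rewrite (ger0_norm tui) => H.
have tE : triad_metric lam X J c y v v = `|v| ^+ 2 * triad_metric lam X J c y u u.
  have -> : v = `|v| *: u by rewrite scalerA divff ?scale1r// gt_eqF.
  rewrite !(triad_bil htriad); [|exact: Kc..].
  by rewrite bil_scale normrZ normr_id u1 mulr1.
rewrite tE mulrCA ler_peMr ?exprn_ge0//.
by rewrite -ler_pdivrMr// mul1r.
Qed.

Lemma target_bounds c (K : set E) : compact K -> K `<=` cimg setT c ->
  \forall B \near +oo_R, forall y, K y -> target_bd c y B.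
Proof.
move=> cK Kc.
have sl : smooth_on (cimg setT c) (lam c) by case: htriad => -[[]].
have sX : smooth_on (cimg setT c) (X c) by case: htriad => _ [[]].
have sJ : smooth_on (cimg setT c) (J c) by case: htriad => _ _ [].
have tl := smooth_twice (@oT c) sl; have tX := smooth_twice (@oT c) sX.
have tJ := smooth_twice (@oT c) sJ.
have tP : twice (cimg setT c) (proj_mx lam X c).
  have t1 := @twice_cst _ _ (cimg setT c) _ _ (1%:M : 'M[R]_n.*2.+1).
  exact: (twice_sub (@oT c) t1 (twice_mulmx (@oT c) tl tX)).
have tK : twice (cimg setT c) (projJ_mx lam X J c) := twice_mulmx (@oT c) tP tJ.
have b1 := compact_bound_near cK (fun y Ky => twice_continuous tl (Kc y Ky)).
have b2 := compact_bound_near_fin cK (fun i y Ky => twice_derive_continuous (i := i) tl (Kc y Ky)).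
have b3 := compact_bound_near cK (fun y Ky => twice_continuous tX (Kc y Ky)).
have b4 := compact_bound_near cK (fun y Ky => twice_continuous tJ (Kc y Ky)).
have b5 := compact_bound_near cK (fun y Ky => twice_continuous tP (Kc y Ky)).
have b6 := compact_bound_near_fin cK (fun i y Ky => twice_derive_continuous (i := i) tP (Kc y Ky)).
have b7 := compact_bound_near cK (fun y Ky => twice_continuous tK (Kc y Ky)).
have b8 := compact_bound_near_fin cK (fun i y Ky => twice_derive_continuous (i := i) tK (Kc y Ky)).
have b9 := compact_bound_near cK (fun y Ky => differentiable_continuous (triad_mx_diff htriad (Kc y Ky))).
have b10 := compact_bound_near_fin cK (fun k y Ky =>
   smooth_continuous (cG.1 c k) (Kc y Ky)).
have b11 := triad_coercive cK Kc.
apply: filterS (filterI b1 (filterI b2 (filterI b3 (filterI b4 (filterI b5 (filterI b6 (filterI b7 (filterI b8 (filterI b9 (filterI b10 b11)))))))))) => B [H1 [H2 [H3 [H4 [H5 [H6 [H7 [H8 [H9 [H10 H11]]]]]]]]]] y Ky; split; [split|split| | |].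
- exact: H1.
- exact: H2.
- exact: H3.
- exact: H4.
- exact: H5.
- exact: H6.
- exact: H7.
- exact: H8.
- exact: H9.
- exact: H10.
- exact: H11.
Qed.

End target_bounds.

Section source_bounds.
Variables (R : realType) (S : manifold R 1) (W : set S) (j h : tensor2 S) (Gh : connection S).
Local Notation E2 := 'rV[R]_2.
Local Notation e := (basis_vec R).
Hypotheses (oW : open W) (cj : is_complex_structure j) (mh : is_metric W h)
  (cGh : is_connection W Gh).

(** The bound on the inverse of the entry [j a x 0 1] is the uniform ellipticity of the second-order
    equation. *)
Definition source_bd a (x : E2) (B : R) : Prop :=
  [/\ [/\ `|j a x| <= B, forall i, `|'D_(e i) (j a) x| <= B & `|(j a x 0 1)^-1| <= B],
      `|h a x| <= B, `|invmx (h a x)| <= B & forall k, `|Gh a x k| <= B].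

(** The entry b = j 0 1 cannot vanish, since a^2 = -1 has no real solution. The off-diagonal
    equation b (a + d) = 0, with d = j 1 1, then forces the trace to be zero. *)
Lemma complex_entries a x : cimg W a x ->
  [/\ j a x 1 1 = - j a x 0 0, j a x 0 0 ^+ 2 + j a x 0 1 * j a x 1 0 = -1
    & j a x 0 1 != 0].
Proof.
move=> [p [ap Wp] <-]; have [_ /(_ a _ (cimg_intro ap (I : [set: S] p)))] := cj.
move: (j a _) => A A2.
have e00 : A 0 0 * A 0 0 + A 0 1 * A 1 0 = -1.
  have := congr1 (fun B : 'M[R]_2 => B 0 0) A2.
  by rewrite !mxE sum2 => ->.
have e01 : A 0 0 * A 0 1 + A 0 1 * A 1 1 = 0.
  have := congr1 (fun B : 'M[R]_2 => B 0 1) A2.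
  by rewrite !mxE sum2 oppr0 => ->.
have b0 : A 0 1 != 0.
  apply/eqP => b0; move: e00; rewrite b0 mul0r addr0 -expr2 => e00.
  by have := sqr_ge0 (A 0 0); rewrite e00 oppr_ge0 ler10.
split => //.
apply/eqP; rewrite -addr_eq0; apply/eqP; apply: (mulfI b0).
by rewrite mulr0 mulrDr addrC [A 0 1 * A 0 0]mulrC.
Qed.

Lemma source_bounds a (Z : set E2) : compact Z -> Z `<=` cimg W a ->
  \forall B \near +oo_R, forall x, Z x -> source_bd a x B.
Proof.
move=> cZ Za.
have oT : open (cimg [set: S] a) by apply: cimg_openW; exact: openT.
have ZT x : Z x -> cimg [set: S] a x by move=> /Za[p [ap _] <-]; exact: cimg_intro.
have tj := smooth_twice oT (cj.1.1 a).
have [sh _ _ _] := mh.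
have oWa : open (cimg W a) by exact: cimg_openW.
have b1 := compact_bound_near cZ (fun y Ky => twice_continuous tj (ZT y Ky)).
have b2 := compact_bound_near_fin cZ (fun i y Ky => twice_derive_continuous (i := i) tj (ZT y Ky)).
have c3 x : Z x -> {for x, continuous (fun y => (j a y 0 1)^-1)}.
  move=> Zx; apply: differentiable_continuous; apply: differentiableV.
    exact: differentiable_entry (tj x (ZT x Zx)).1.
  by have [] := complex_entries (Za x Zx).
have b3 := compact_bound_near cZ c3.
have b4 := compact_bound_near cZ (fun y Ky => smooth_continuous (sh a) (Za y Ky)).
have c5 x : Z x -> {for x, continuous (fun y => invmx (h a y))}.
  move=> Zx; apply: differentiable_continuous; apply: differentiable_invmx22.
    by apply: (open_near oWa (Za x Zx)) => y; exact: metric_unit.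
  exact: (smooth_diff oWa (sh a) (Za x Zx)).
have b5 := compact_bound_near cZ c5.
have b6 := compact_bound_near_fin cZ (fun k y Ky => smooth_continuous (cGh.1 a k) (Za y Ky)).
apply: filterS (filterI b1 (filterI b2 (filterI b3 (filterI b4 (filterI b5 b6))))) => B [H1 [H2 [H3 [H4 [H5 H6]]]]] y Ky; split; [split| | |].
- exact: H1.
- exact: H2.
- exact: H3.
- exact: H4.
- exact: H5.
- exact: H6.
Qed.

Lemma metric_entries a x : cimg W a x ->
  [/\ 0 < h a x 0 0, 0 < h a x 1 1, h a x 1 0 = h a x 0 1 & 0 < \det (h a x)].
Proof.
move=> ax; have [_ _ sym pos] := mh.
have s10 : h a x 1 0 = h a x 0 1 by rewrite -!bil_basis sym.
have b0 (i : 'I_2) : basis_vec R i != 0.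
  apply/eqP => /rowP/(_ i); rewrite !mxE !eqxx => /eqP; rewrite oner_eq0//.
have h0 : 0 < h a x 0 0 by rewrite -bil_basis; exact/pos/b0.
have h1 : 0 < h a x 1 1 by rewrite -bil_basis; exact/pos/b0.
split=> //; rewrite det22E s10.
(* The quadratic form takes the value h 1 1 times the determinant at this vector, so positivity of h
   transfers to the determinant. *)
pose u : E2 := \row_k (if k == 0 then h a x 1 1 else - h a x 0 1).
have u0 : u != 0.
  by apply/eqP => /rowP/(_ 0); rewrite !mxE eqxx; move/eqP; rewrite gt_eqF.
have := pos a x u ax u0; rewrite bilE !sum2 !mxE/= s10 => H.
rewrite -(pmulr_rgt0 _ h1); apply: lt_le_trans H _.
by rewrite le_eqVlt; apply/orP; left; apply/eqP; ring.
Qed.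

End source_bounds.

Section contr_lower.
Variables (R : realType) (m : nat) (h : 'M[R]_2) (A : 'M[R]_m.+1) (F : 'I_2 -> 'rV[R]_m.+1).
Hypotheses (h0 : 0 < h 0 0) (h1 : 0 < h 1 1) (hs : h 1 0 = h 0 1) (hd : 0 < \det h).
Hypothesis psd : forall v, 0 <= bil A v v.

Let uh : h \in unitmx. Proof. by rewrite unitmxE unitfE gt_eqF. Qed.

Let bil_comb (a b : R) (u v : 'rV[R]_m.+1) : bil A (a *: u - b *: v) (a *: u - b *: v) =
  a ^+ 2 * bil A u u - a * b * (bil A u v + bil A v u) + b ^+ 2 * bil A v v.
Proof.
have lin (x y z : 'rV[R]_m.+1) c d : bil A (c *: x - d *: y) z = c * bil A x z - d * bil A y z.
  by rewrite /bil !mulmxBl -!scalemxAl !mxE.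
have lin' (x y z : 'rV[R]_m.+1) c d : bil A z (c *: x - d *: y) = c * bil A z x - d * bil A z y.
  by rewrite /bil linearB/= mulmxBr !linearZ/= !mxE.
rewrite lin !lin'; ring.
Qed.

(** Gram-Schmidt with first vector e_i: the trace exceeds the left side by the form at
    [h i i *: F k - h 0 1 *: F i], where k is the other index, divided by [h i i] and by the
    determinant. *)
Lemma contr_ge (i : 'I_2) : bil A (F i) (F i) / h i i <=
  contr (invmx h) (fun a b => bil A (F a) (F b)).
Proof.
have [k00 k11 k01 k10] := invmx22E uh.
have d0 : \det h != 0 by rewrite gt_eqF.
have dE := det22E h; rewrite hs in dE.
rewrite /contr !sum2 k00 k11 k01 k10 hs.
have two : i = 0 \/ i = 1.
  by case: i => -[|[|//]] ?; [left|right]; exact/val_inj.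
have [->|->] := two.
- rewrite -subr_ge0.
  have -> : (\det h)^-1 * h 1 1 * bil A (F 0) (F 0) + - ((\det h)^-1 * h 0 1) * bil A (F 0) (F 1) +
     (- ((\det h)^-1 * h 0 1) * bil A (F 1) (F 0) + (\det h)^-1 * h 0 0 * bil A (F 1) (F 1)) -
     bil A (F 0) (F 0) / h 0 0 = (\det h)^-1 / h 0 0 * bil A (h 0 0 *: F 1 - h 0 1 *: F 0) (h 0 0 *: F 1 - h 0 1 *: F 0).
    rewrite bil_comb; move: (bil A _ _) (bil A _ _) (bil A _ _) (bil A _ _) => g00 g01 g10 g11.
    have H : h 0 0 != 0 by rewrite gt_eqF.
    apply: (mulfI d0); apply: (mulfI H).
    by field : dE; rewrite H d0.
  by rewrite mulr_ge0// divr_ge0 ?invr_ge0// ltW.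
- rewrite -subr_ge0.
  have -> : (\det h)^-1 * h 1 1 * bil A (F 0) (F 0) + - ((\det h)^-1 * h 0 1) * bil A (F 0) (F 1) +
     (- ((\det h)^-1 * h 0 1) * bil A (F 1) (F 0) + (\det h)^-1 * h 0 0 * bil A (F 1) (F 1)) -
     bil A (F 1) (F 1) / h 1 1 = (\det h)^-1 / h 1 1 * bil A (h 1 1 *: F 0 - h 0 1 *: F 1) (h 1 1 *: F 0 - h 0 1 *: F 1).
    rewrite bil_comb; move: (bil A _ _) (bil A _ _) (bil A _ _) (bil A _ _) => g00 g01 g10 g11.
    have H : h 1 1 != 0 by rewrite gt_eqF.
    apply: (mulfI d0); apply: (mulfI H).
    by field : dE; rewrite H d0.
  by rewrite mulr_ge0// divr_ge0 ?invr_ge0// ltW.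
Qed.

End contr_lower.

(** * Pointwise estimates *)

Section elliptic_algebra.
Variable R : realType.

(** Here p, s, q stand for u_00, u_01, u_11. The equation expresses q through p, s and r, so it
    suffices to bound p and s by a definite form in them. The exponent 8 and the factor 200 are
    crude: a cubic polynomial in B^2 is bounded by a multiple of its fourth power. *)
Lemma elliptic_quadratic (a b c p s q r B : R) :
  a ^+ 2 + b * c = -1 -> b != 0 -> 1 <= B ->
  `|a| <= B -> `|c| <= B -> `|b| <= B -> `|b^-1| <= B ->
  c * p - 2 * a * s - b * q = r ->
  p ^+ 2 + s ^+ 2 + q ^+ 2 <= 200 * B ^+ 8 * ((s ^+ 2 - p * q) + r ^+ 2).
Proof.
move=> abc b0 B1 aB cB bB biB rE.
have sqB (x : R) : `|x| <= B -> x ^+ 2 <= B ^+ 2.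
  by move=> xB; rewrite -(real_normK (num_real x)) lerXn2r ?nnegrE// (le_trans _ B1).
have := sqB _ aB; have := sqB _ cB; have := sqB _ bB; have := sqB _ biB.
move=> bi2 b2 c2 a2.
(* Substituting q into s^2 - p q and using b c = - 1 - a^2 gives this sum of squares, up to the
   error r p / b, which Young's inequality absorbs into A itself. *)
pose A := (s + a / b * p) ^+ 2 + (p / b) ^+ 2.
have AE : A = s ^+ 2 - p * q - r * (p / b).
  apply: (mulfI b0); apply: (mulfI b0).
  rewrite /A -rE; have : b * c = - 1 - a ^+ 2 by rewrite -abc; ring.
  by move=> bc; field: bc.
have A0 : 0 <= A by rewrite addr_ge0// sqr_ge0.
set D := s ^+ 2 - p * q in AE *.
have AD : A <= 2 * D + r ^+ 2.
  have : 0 <= (r + p / b) ^+ 2 by exact: sqr_ge0.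
  have : (p / b) ^+ 2 <= A by rewrite lerDr sqr_ge0.
  rewrite sqrrD; move: AE; move: (p / b) => pb.
  by rewrite -mulr_natl; nra.
have D0 : 0 <= D + r ^+ 2 by have := sqr_ge0 r; lra.
have p2 : p ^+ 2 <= B ^+ 2 * A.
  have -> : p ^+ 2 = b ^+ 2 * (p / b) ^+ 2 by rewrite -exprMn mulrCA divff// mulr1.
  by rewrite ler_pM ?sqr_ge0// lerDr sqr_ge0.
have s2 : s ^+ 2 <= (2 + 2 * B ^+ 2) * A.
  have -> : s = (s + a / b * p) - a * (p / b) by ring.
  have h1 : (s + a / b * p) ^+ 2 <= A by rewrite lerDl sqr_ge0.
  have h2 : (a * (p / b)) ^+ 2 <= B ^+ 2 * A.
    by rewrite exprMn ler_pM ?sqr_ge0// lerDr sqr_ge0.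
  have : 0 <= ((s + a / b * p) + a * (p / b)) ^+ 2 by exact: sqr_ge0.
  move: (s + a / b * p) (a * (p / b)) h1 h2 => x y h1 h2.
  by rewrite sqrrD sqrrB -mulr_natl; lra.
have q2 : q ^+ 2 <= 3 * B ^+ 2 * (B ^+ 2 * (B ^+ 2 * A) + 4 * B ^+ 2 * ((2 + 2 * B ^+ 2) * A) + r ^+ 2).
  have -> : q = b^-1 * (c * p - 2 * a * s - r) by rewrite -rE; field.
  rewrite exprMn (mulrC 3 (B ^+ 2)) -(mulrA (B ^+ 2) 3); apply: ler_pM => //; rewrite ?sqr_ge0//.
  have h1 : (c * p) ^+ 2 <= B ^+ 2 * (B ^+ 2 * A) by rewrite exprMn ler_pM ?sqr_ge0.
  have h2 : (2 * a * s) ^+ 2 <= 4 * B ^+ 2 * ((2 + 2 * B ^+ 2) * A).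
    rewrite (_ : (2 * a * s) ^+ 2 = (4 * a ^+ 2) * s ^+ 2); last by ring.
    apply: ler_pM s2; [by rewrite mulr_ge0 ?sqr_ge0|exact: sqr_ge0|].
    by rewrite ler_wpM2l.
  move: (c * p) (2 * a * s) h1 h2 => x y h1 h2.
  have e1 : 0 <= (x + y) ^+ 2 by exact: sqr_ge0.
  have e2 : 0 <= (x + r) ^+ 2 by exact: sqr_ge0.
  have e3 : 0 <= (y - r) ^+ 2 by exact: sqr_ge0.
  have : (x - y - r) ^+ 2 + (x + y) ^+ 2 + (x + r) ^+ 2 + (y - r) ^+ 2 = 3 * (x ^+ 2 + y ^+ 2 + r ^+ 2) by ring.
  by lra.
have B2 : 1 <= B ^+ 2 by rewrite exprn_ege1.
have B4 : B ^+ 4 = B ^+ 2 * B ^+ 2 by rewrite -exprD.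
have B8 : B ^+ 8 = (B ^+ 2 * B ^+ 2) * (B ^+ 2 * B ^+ 2) by rewrite -!exprD.
set b' := B ^+ 2 in p2 s2 q2 B2 B8 *.
have r2 : r ^+ 2 <= 2 * (D + r ^+ 2) by lra.
have A2 : A <= 2 * (D + r ^+ 2) by have := sqr_ge0 r; lra.
set Y := D + r ^+ 2 in D0 r2 A2 *.
have m1 : 1 <= b' * b' by rewrite mulr_ege1.
have m2 : b' <= b' * b' by rewrite ler_peMl// (le_trans _ B2).
have b0' : 0 <= b' by rewrite (le_trans _ B2).
have T0 : p ^+ 2 + s ^+ 2 + q ^+ 2 <= (b' + (2 + 2 * b') + 3 * b' * (b' * b' + 4 * b' * (2 + 2 * b'))) * A + 3 * b' * r ^+ 2.
  by lra.
apply: (le_trans T0).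
apply: (@le_trans _ _ ((b' + (2 + 2 * b') + 3 * b' * (b' * b' + 4 * b' * (2 + 2 * b'))) * (2 * Y) + 3 * b' * (2 * Y))).
  apply: lerD; (apply: ler_wpM2l; last by []); last by rewrite mulr_ge0.
  have bb : 0 <= b' * b' by exact: mulr_ge0.
  have b2b : 0 <= 2 + 2 * b' by lra.
  have b3 : 0 <= b' * (2 + 2 * b') by exact: mulr_ge0.
  have b4 : 0 <= b' * (b' * b' + 4 * (b' * (2 + 2 * b'))) by apply: mulr_ge0 => //; lra.
  by rewrite -[4 * b' * _]mulrA -[3 * b' * _]mulrA; lra.
rewrite B8 (_ : _ + _ = (2 * (b' + (2 + 2 * b') + 3 * b' * (b' * b' + 4 * b' * (2 + 2 * b'))) + 6 * b') * Y); last by ring.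
rewrite ler_wpM2r//.
have m3 : b' * b' <= b' * b' * (b' * b') by rewrite ler_peMr// mulr_ge0.
have m4 : b' * b' * b' <= b' * b' * (b' * b') by rewrite ler_wpM2l// mulr_ge0.
by move: m1 m2 m3 m4; nra.
Qed.

(** The lower-order term is O(|df| + |df|^2); this is where its square becomes the integrand |df|^2
    + |df|^4 of the final estimate. *)
Lemma sq_add_sq (y : R) : (y + y ^+ 2) ^+ 2 <= 2 * (y ^+ 2 + y ^+ 4).
Proof.
have := sqr_ge0 (y - y ^+ 2).
have -> : (y - y ^+ 2) ^+ 2 = y ^+ 2 + y ^+ 4 - 2 * y ^+ 3 by ring.
have -> : (y + y ^+ 2) ^+ 2 = y ^+ 2 + y ^+ 4 + 2 * y ^+ 3 by ring.
by lra.
Qed.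

Lemma sq_le_sq (r c y : R) : r ^+ 2 <= (c * (y + y ^+ 2)) ^+ 2 ->
  r ^+ 2 <= 2 * c ^+ 2 * (y ^+ 2 + y ^+ 4).
Proof.
move=> /le_trans; apply; rewrite exprMn [2 * c ^+ 2]mulrC -[leRHS]mulrA.
by rewrite ler_wpM2l ?sqr_ge0// sq_add_sq.
Qed.

End elliptic_algebra.

Lemma ell_sym (R : realType) m (j0 : 'M[R]_2) (D0 D1 : 'M[R]_(2, m)) l :
  D0 1 l = D1 0 l -> j0 1 1 = - j0 0 0 ->
  ell j0 D0 D1 0 l = j0 1 0 * D0 0 l - 2 * j0 0 0 * D0 1 l - j0 0 1 * D1 1 l.
Proof. by move=> sym tr; rewrite ellE -sym tr; ring. Qed.

Section pointwise.
Variables (R : realType) (n : nat) (S : manifold R 1) (M : manifold R n.*2).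
Local Notation E := 'rV[R]_n.*2.+1.
Local Notation E2 := 'rV[R]_2.
Local Notation e := (basis_vec R).
Variables (W : set S).
Variables (lam : one_form M) (X : vector_field M) (J : tensor2 M) (j h : tensor2 S).
Variables (Gh : connection S) (G : connection M).
Hypotheses (oW : open W) (htriad : is_contact_triad lam X J).
Hypotheses (cj : is_complex_structure j) (mh : is_metric W h).

Section lower_upper.
Variables (w : S -> M) (sw : smooth_map W w).
Variables (a : idx S) (c : idx M) (x : E2) (B : R).
Hypothesis dx : local_dom W w a c x.
Let f := local_rep w a c.
Hypotheses (B1 : 1 <= B) (sB : source_bd j h Gh a x B) (tB : target_bd lam X J G c (f x) B).
Let N := `|jac f x|.
Let D i := 'D_(e i) (jac f) x.
Let Q := `|D 0| ^+ 2 + `|D 1| ^+ 2.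
Let k := n.*2.+1%:R : R.
Let df : differentiable f x. Proof. exact: (local_rep_diff oW sw dx). Qed.
Let oO : open (local_dom W w a c). Proof. exact: local_dom_open. Qed.
Let sf : smooth_on (local_dom W w a c) f. Proof. exact: local_rep_smooth. Qed.
Let cx : cimg setT c (f x). Proof. exact: local_rep_cimg dx. Qed.
Let B0 : 0 < B. Proof. exact: lt_le_trans B1. Qed.

Lemma norm2_contr : norm2 w lam X J h a c x =
  contr (invmx (h a x)) (fun i1 i2 => bil (triad_mx lam X J c (f x)) ('D_(e i1) f x) ('D_(e i2) f x)).
Proof. by apply: eq_contr => i1 i2; rewrite (triad_bil htriad). Qed.

(** Coercivity bounds |D_i f|^2 by B times its triad length squared, and [contr_ge] bounds that
    length squared by [h i i] times |dw|^2. *)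
Lemma jac_le_norm2 : N <= B * Num.sqrt (norm2 w lam X J h a c x).
Proof.
have [h0 h1 hs hd] := metric_entries mh (local_dom_cimg dx).
have [_ _ _ _ coer] := tB; have [_ hB _ _] := sB.
have psd v : 0 <= bil (triad_mx lam X J c (f x)) v v.
  rewrite -(triad_bil htriad)// -(pmulr_rge0 _ B0).
  by apply: le_trans (coer v); rewrite exprn_ge0.
apply: norm_le_entry => [|i l]; first by rewrite mulr_ge0 ?sqrtr_ge0// ltW.
rewrite mxE; apply: (le_trans (entry_le_norm _ _ _)).
have hii : 0 < h a x i i.
  have : i = 0 \/ i = 1 by case: i => -[|[|//]] ?; [left|right]; exact/val_inj.
  by case=> ->.
have H := contr_ge (fun l => 'D_(e l) f x) h0 h1 hs hd psd i.
rewrite -norm2_contr ler_pdivrMr// -(triad_bil htriad)// in H.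
have hiB : h a x i i <= B by apply: le_trans hB; apply: le_trans (ler_norm _) (entry_le_norm _ _ _).
have n0 : 0 <= norm2 w lam X J h a c x.
  rewrite -(pmulr_lge0 _ hii); apply: le_trans H; rewrite (triad_bil htriad)//; exact: psd.
have F2 : `|'D_(e i) f x| ^+ 2 <= (B * Num.sqrt (norm2 w lam X J h a c x)) ^+ 2.
  rewrite exprMn sqr_sqrtr//; apply: (le_trans (coer _)).
  rewrite [B ^+ 2]expr2 -mulrA; apply: ler_wpM2l; first exact: ltW.
  by apply: (le_trans H); rewrite mulrC ler_wpM2r.
by rewrite -(@ler_pXn2r _ 2)// nnegrE ?mulr_ge0 ?sqrtr_ge0// ltW.
Qed.

Let DB i l : `|'D_(e i) (fun y => 'D_(e l) f y) x| <= `|D i|.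
Proof.
apply: norm_le_entry => // z m; rewrite (ord1 z) -(derive_jacE oO sf dx).
exact: entry_le_norm.
Qed.

Let DQ i : `|D i| ^+ 2 <= Q.
Proof.
have : i = 0 \/ i = 1 by case: i => -[|[|//]] ?; [left|right]; exact/val_inj.
by case=> ->; [rewrite lerDl sqr_ge0|rewrite lerDr sqr_ge0].
Qed.

(** Three contributions: second derivatives of f, the target Christoffel symbols, quadratic in df,
    and the source ones, linear in df. *)
Lemma nabla_dw_bound i l : `|nabla_dw w Gh G a c x (e i) (e l)| ^+ 2 <=
  200 * k ^+ 4 * B ^+ 2 * (Q + N ^+ 2 + N ^+ 4).
Proof.
have [_ _ _ GB _] := tB; have [_ _ _ GhB] := sB.
have FN m : `|'D_(e m) f x| <= N by rewrite -row_jac norm_row_le.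
have b2 := norm_chris_le GB (FN i) (FN l).
have e1 m : `|basis_vec R m : E2| <= 1 := normr_basis R m.
have b3 := norm_derive_le df FN (norm_chris_le GhB (e1 i) (e1 l)).
have H : `|nabla_dw w Gh G a c x (e i) (e l)| <= _ :=
   norm_sub_le (norm_add_le (DB i l) b2) b3.
have N0 : 0 <= N by exact: normr_ge0.
have k1 : 1 <= k by rewrite ler1n.
apply: (@le_trans _ _ ((`|D i| + k * (k * (N * B) * N) + 2 * (2 * (2 * (1 * B) * 1) * N)) ^+ 2)).
  by apply: lerXn2r => //; rewrite nnegrE//; exact: le_trans (normr_ge0 _) H.
rewrite (_ : k * (k * (N * B) * N) = k ^+ 2 * B * N ^+ 2); last by ring.
rewrite (_ : 2 * (2 * (2 * (1 * B) * 1) * N) = 8 * B * N); last by ring.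
have i1 := DQ i; move: (`|D i|) i1 => d i1.
have Q0 : 0 <= Q by rewrite addr_ge0 ?sqr_ge0.
have sq3 (u v t : R) : (u + v + t) ^+ 2 <= 3 * (u ^+ 2 + v ^+ 2 + t ^+ 2).
  have := sqr_ge0 (u - v); have := sqr_ge0 (u - t); have := sqr_ge0 (v - t).
  have -> : (u - v) ^+ 2 = u ^+ 2 + v ^+ 2 - 2 * (u * v) by ring.
  have -> : (u - t) ^+ 2 = u ^+ 2 + t ^+ 2 - 2 * (u * t) by ring.
  have -> : (v - t) ^+ 2 = v ^+ 2 + t ^+ 2 - 2 * (v * t) by ring.
  have -> : (u + v + t) ^+ 2 = u ^+ 2 + v ^+ 2 + t ^+ 2 + 2 * (u * v) + 2 * (u * t) + 2 * (v * t) by ring.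
  by lra.
apply: (le_trans (sq3 _ _ _)).
have BB : 1 <= B ^+ 2 by rewrite exprn_ege1.
have kk : 1 <= k ^+ 4 by rewrite exprn_ege1.
have kB : 1 <= k ^+ 4 * B ^+ 2 by rewrite mulr_ege1.
have N2 : 0 <= N ^+ 2 by rewrite sqr_ge0.
have N4 : 0 <= N ^+ 4 by rewrite exprn_ge0.
have t1 : 3 * d ^+ 2 <= 200 * (k ^+ 4 * B ^+ 2) * Q.
  apply: (@le_trans _ _ (3 * Q)); first by rewrite ler_wpM2l.
  by rewrite ler_wpM2r//; lra.
have t2 : 3 * (k ^+ 2 * B * N ^+ 2) ^+ 2 <= 200 * (k ^+ 4 * B ^+ 2) * N ^+ 4.
  rewrite (_ : (k ^+ 2 * B * N ^+ 2) ^+ 2 = k ^+ 4 * B ^+ 2 * N ^+ 4); last by ring.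
  by rewrite mulrA ler_wpM2r//; lra.
have t3 : 3 * (8 * B * N) ^+ 2 <= 200 * (k ^+ 4 * B ^+ 2) * N ^+ 2.
  rewrite (_ : (8 * B * N) ^+ 2 = 64 * B ^+ 2 * N ^+ 2); last by ring.
  rewrite mulrA ler_wpM2r//; have : B ^+ 2 <= k ^+ 4 * B ^+ 2 by rewrite ler_peMl// (le_trans ler01).
  by lra.
move: (Q) t1 => Q' t1.
rewrite -[200 * _ * _]mulrA !mulrDr [leRHS]addrAC.
exact: lerD (lerD t1 t2) t3.
Qed.

Let triad_term u v : `|u| ^+ 2 <= 200 * k ^+ 4 * B ^+ 2 * (Q + N ^+ 2 + N ^+ 4) ->
  `|v| ^+ 2 <= 200 * k ^+ 4 * B ^+ 2 * (Q + N ^+ 2 + N ^+ 4) ->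
  `|triad_metric lam X J c (f x) u v| <= k ^+ 2 * B * (200 * k ^+ 4 * B ^+ 2 * (Q + N ^+ 2 + N ^+ 4)).
Proof.
have [_ _ TB _ _] := tB; set Y := 200 * _ * _ * _ => uY vY.
rewrite (triad_bil htriad)//; apply: (le_trans (norm_bil_le TB (lexx `|u|) (lexx `|v|))).
rewrite (_ : _ * (_ * (_ * B) * _) = k ^+ 2 * B * (`|u| * `|v|)); last by rewrite /k; ring.
apply: ler_wpM2l; first by rewrite mulr_ge0 ?exprn_ge0// ltW.
have := sqr_ge0 (`|u| - `|v|).
have -> : (`|u| - `|v|) ^+ 2 = `|u| ^+ 2 + `|v| ^+ 2 - 2 * (`|u| * `|v|) by ring.
by move: (`|u| * `|v|) uY vY => uv; lra.
Qed.

Lemma nnorm2_bound : `|nnorm2 w lam X J h Gh G a c x| <=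
  3200 * k ^+ 6 * B ^+ 5 * (Q + N ^+ 2 + N ^+ 4).
Proof.
have [_ _ hB _] := sB.
have Y0 : 0 <= k ^+ 2 * B * (200 * k ^+ 4 * B ^+ 2 * (Q + N ^+ 2 + N ^+ 4)).
  have Q0 : 0 <= Q by rewrite addr_ge0 ?sqr_ge0.
  have Y0 : 0 <= Q + N ^+ 2 + N ^+ 4.
    by rewrite addr_ge0//; [rewrite addr_ge0// exprn_ge0// normr_ge0|rewrite exprn_ge0// normr_ge0].
  have k0 : 0 <= k by rewrite ler0n.
  exact: mulr_ge0 (mulr_ge0 (exprn_ge0 2 k0) (ltW B0))
    (mulr_ge0 (mulr_ge0 (mulr_ge0 (ler0n _ _) (exprn_ge0 4 k0)) (sqr_ge0 _)) Y0).
have H i1 i2 l1 l2 := triad_term (nabla_dw_bound i1 l1) (nabla_dw_bound i2 l2).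
have H1 i1 i2 := norm_contr_le hB (fun l1 l2 => H i1 i2 l1 l2) Y0.
have Y1 : 0 <= 2%:R * (2%:R * (B * (k ^+ 2 * B * (200 * k ^+ 4 * B ^+ 2 * (Q + N ^+ 2 + N ^+ 4))))).
  exact: mulr_ge0 (ler0n _ _) (mulr_ge0 (ler0n _ _) (mulr_ge0 (ltW B0) Y0)).
apply: (le_trans (norm_contr_le hB H1 Y1)).
by rewrite le_eqVlt; apply/orP; left; apply/eqP; ring.
Qed.

End lower_upper.

Section ell_bound.
Variables (w : S -> M) (hw : contact_instanton W w lam X J j).
Variables (a : idx S) (c : idx M) (x : E2) (B : R).
Hypothesis dx : local_dom W w a c x.
Let f := local_rep w a c.
Hypotheses (B1 : 1 <= B) (sB : source_bd j h Gh a x B) (tB : target_bd lam X J G c (f x) B).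
Let N := `|jac f x|.
Let D i := 'D_(e i) (jac f) x.
Let k := n.*2.+1%:R : R.

(** The bracket with coefficient 200 B^8 is minus the null Lagrangian of component l and will be
    integrated away. The number 12 k^3 B^3 is the constant of [elliptic_bound]. *)
Lemma elliptic_pointwise l :
  (D 0) 0 l ^+ 2 + (D 0) 1 l ^+ 2 + (D 1) 1 l ^+ 2 <=
  200 * B ^+ 8 * ((D 0) 1 l ^+ 2 - (D 0) 0 l * (D 1) 1 l) +
  200 * B ^+ 8 * (2 * (12 * k ^+ 3 * B ^+ 3) ^+ 2) * (N ^+ 2 + N ^+ 4).
Proof.
have [[lB DlB XB JB] [PB DPB KB DKB] _ _ _] := tB.
have [[jB DjB biB] _ _ _] := sB.
have LB := elliptic_bound oW htriad cj hw dx jB DjB lB DlB PB DPB KB DKB JB XB B1 (lexx N).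
have sym := derive_jac_sym (@local_dom_open _ _ _ _ _ _ oW hw.1 a c) (@local_rep_smooth _ _ _ _ _ _ hw.1 a c) dx l.
have [j11 jj b0] := complex_entries cj (local_dom_cimg dx).
have LE : elliptic_op f x (j a) 0 l =
    j a x 1 0 * (D 0) 0 l - 2 * j a x 0 0 * (D 0) 1 l - j a x 0 1 * (D 1) 1 l.
  exact: ell_sym sym j11.
have jle i i' : `|j a x i i'| <= B by apply: le_trans jB; exact: entry_le_norm.
have H := elliptic_quadratic jj b0 B1 (jle 0 0) (jle 1 0) (jle 0 1) biB (esym LE).
have N0 : 0 <= N by exact: normr_ge0.
have B0 : 0 <= B by rewrite (le_trans ler01).
have rB : `|elliptic_op f x (j a) 0 l| <= 12 * k ^+ 3 * B ^+ 3 * (N + N ^+ 2).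
  apply: (le_trans (entry_le_norm _ _ _)); apply: (le_trans LB).
  by rewrite le_eqVlt; apply/orP; left; apply/eqP; rewrite -/k; ring.
have r2 : elliptic_op f x (j a) 0 l ^+ 2 <= (12 * k ^+ 3 * B ^+ 3 * (N + N ^+ 2)) ^+ 2.
  rewrite -(real_normK (num_real (elliptic_op _ _ _ _ _))).
  apply: lerXn2r => //; rewrite nnegrE//; exact: le_trans (normr_ge0 _) rB.
have r3 := sq_le_sq r2.
apply: (le_trans H); rewrite mulrDr -[X in _ <= _ + X]mulrA.
apply: lerD => //; apply: ler_wpM2l r3.
exact: mulr_ge0 (ler0n _ _) (exprn_ge0 8 B0).
Qed.

End ell_bound.
End pointwise.

(** * Bump functions and integration over a square *)

Lemma differentiable_idfun (R : realType) (V : normedModType R) (x : V) :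
  differentiable (fun y : V => y) x.
Proof. by apply: (@linear_differentiable _ _ _ idfun) => ? //. Qed.

Section bump.
Variables (R : realType).

(** Only C^1, which suffices: the integration by parts differentiates the cutoff once and needs that
    derivative to be continuous. *)
Definition cut (t : R) : R := Num.max 0 t ^+ 2.

Lemma cut_is_derive (t : R) : is_derive t 1 cut (2 * Num.max 0 t).
Proof.
have [t0|t0|->] := ltgtP t 0.
- have n0 : \near t, cst 0 t = cut t.
    apply: (open_near (@open_lt R 0) t0) => s /= s0.
    by rewrite /cut max_l ?expr0n// ltW.
  by rewrite mulr0; apply: near_eq_is_derive n0 _; exact: is_derive_cst.
- have n0 : \near t, (id ^+ 2) t = cut t.
    apply: (open_near (@open_gt R 0) t0) => s /= s0.
    by rewrite /cut max_r// ltW.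
  apply: near_eq_is_derive n0 _.
  by apply: is_derive_eq; rewrite expr1 scaler1 /= mulr_natl.
(* At the corner t = 0 the derivative is 0 because [cut h] is at most |h|^2. *)
- rewrite ?maxxx mulr0.
  have d0 : differentiable cut (0 : R).
    have c0 : continuous (\0 : {linear R -> R}) by exact: cst_continuous.
    apply: (differentiable_littleo c0) => eps eps0.
    have nh : \forall h \near (0 : R), `|h| <= eps by exact: nbhs0_le.
    apply: filterS nh => h hn /=.
    rewrite addr0 /cut maxxx expr0n/= !subr0 normrX.
    have hm : `|Num.max 0 h| <= `|h| by case: (leP 0 h) => h0; rewrite ?normr0.
    rewrite expr2 (@le_trans _ _ (`|h| * `|h|))//; first by rewrite ler_pM.
    by rewrite ler_wpM2r.
  split; first exact: diff_derivable.
  have c0 : continuous (\0 : {linear R -> R}) by exact: cst_continuous.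
  rewrite deriveE//.
  have -> : 'd cut (0 : R) = (\0 : {linear R -> R}) :> (R -> R).
    apply: diff_unique => //; apply/eqaddoP => eps eps0.
    have nh : \forall h \near (0 : R), `|h| <= eps by exact: nbhs0_le.
    apply: filterS nh => h hn /=.
    rewrite !fctE /= addr0 /cut maxxx expr0n/= add0r subr0 normrX.
    have hm : `|Num.max 0 h| <= `|h| by case: (leP 0 h) => h0; rewrite ?normr0.
    rewrite expr2 (@le_trans _ _ (`|h| * `|h|))//; first by rewrite ler_pM.
    by rewrite ler_wpM2r.
  by [].
Qed.

Variable m : nat.
Local Notation E := 'rV[R]_m.+1.
Implicit Types (q y v : E) (r : R).

Definition dot (u v : E) : R := bil 1%:M u v.

Lemma dotE u v : dot u v = \sum_i u 0 i * v 0 i.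
Proof. by rewrite /dot /bil mulmx1 mxE; apply: eq_bigr => i _; rewrite mxE. Qed.

Lemma dot_diff q y : differentiable (fun y => dot (y - q) (y - q)) y.
Proof.
have d : differentiable (fun y => y - q) y.
  by apply: differentiable_sub_mx; [exact: differentiable_idfun|exact: differentiable_cst].
exact: (differentiable_bil (differentiable_cst _ _) d d).
Qed.

Lemma dot_is_derive q y v : is_derive y v (fun y => dot (y - q) (y - q)) (2 * dot (y - q) v).
Proof.
apply: DeriveDef; first exact/diff_derivable/dot_diff.
have dc i : is_derive y v (fun y : E => (y - q) 0 i) (v 0 i).
  have d : differentiable (fun y => y - q) y.
    by apply: differentiable_sub_mx; [exact: differentiable_idfun|exact: differentiable_cst].
  apply: DeriveDef; first exact/derivable_entry/diff_derivable.
  rewrite -(diff_entry _ _ _ d) (derive_sub _ (differentiable_idfun _) (differentiable_cst _ _)).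
  by rewrite derive_cst subr0 derive_id.
have -> : (fun y => dot (y - q) (y - q)) = \sum_i ((fun y => (y - q) 0 i) * (fun y => (y - q) 0 i)).
  by apply/funext => z; rewrite dotE fct_sumE.
rewrite (@derive_val _ _ _ _ _ _ _ (is_derive_sum (fun i => is_deriveM (dc i) (dc i)))).
rewrite dotE mulr_sumr; apply: eq_bigr => i _.
by rewrite mulr_natl mulr2n.
Qed.

(** The norm of row vectors is the maximum norm, which is not smooth; the bump therefore uses the
    Euclidean product. Its support, a Euclidean ball, lies in the cube [box q r] by [dot_norm], and
    it vanishes on the boundary of that cube. *)
Definition bump q r y : R := cut (r ^+ 2 - dot (y - q) (y - q)).

Definition dbump q r y v : R :=
  2 * Num.max 0 (r ^+ 2 - dot (y - q) (y - q)) * (- (2 * dot (y - q) v)).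

Lemma bump_diff q r y : differentiable (bump q r) y.
Proof.
apply: (@differentiable_comp _ _ _ _ (fun y => r ^+ 2 - dot (y - q) (y - q)) cut).
  by apply: differentiableB; [exact: differentiable_cst|exact: dot_diff].
by apply/derivable1_diffP; exact: (@ex_derive _ _ _ _ _ _ _ (cut_is_derive _)).
Qed.

Lemma bump_derive q r y v : 'D_v (bump q r) y = dbump q r y v.
Proof.
pose g y := r ^+ 2 - dot (y - q) (y - q).
have dg : differentiable g y.
  by apply: differentiableB; [exact: differentiable_cst|exact: dot_diff].
have dc : differentiable cut (g y).
  by apply/derivable1_diffP; exact: (@ex_derive _ _ _ _ _ _ _ (cut_is_derive _)).
have Dg : 'D_v g y = - (2 * dot (y - q) v).
  have := dot_is_derive q y v => H.
  have -> : 'D_v g y = 'D_v (cst (r ^+ 2)) y - 'D_v (fun y => dot (y - q) (y - q)) y.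
    by apply: (@deriveB _ _ _ (cst (r ^+ 2))) => //; exact/diff_derivable/dot_diff.
  by rewrite derive_cst sub0r (@derive_val _ _ _ _ _ _ _ H).
rewrite -[bump q r]/(cut \o g) (derive_chain _ dg dc) Dg.
rewrite /dbump -/(g y) [RHS]mulrC.
have -> (s t : R) : 'D_s cut t = s * 'D_1 cut t.
  have dt : differentiable cut t.
    by apply/derivable1_diffP; exact: (@ex_derive _ _ _ _ _ _ _ (cut_is_derive _)).
  by rewrite !deriveE// -[s in LHS]mulr1 [s * 1](_ : _ = s *: (1 : R))// linearZ.
by rewrite (@derive_val _ _ _ _ _ _ _ (cut_is_derive (g y))).
Qed.

Lemma dbump_continuous (T : topologicalType) q r (f : T -> E) (u : T -> E) p :
  {for p, continuous f} -> {for p, continuous u} ->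
  {for p, continuous (fun t => dbump q r (f t) (u t))}.
Proof.
move=> cf cu.
have ce (g : T -> E) i : {for p, continuous g} -> {for p, continuous (fun t => g t 0 i)}.
  move=> cg; exact: (continuous_comp cg (@coord_continuous _ _ _ 0 i _)).
have cdot (g1 g2 : T -> E) : {for p, continuous g1} -> {for p, continuous g2} ->
    {for p, continuous (fun t => dot (g1 t) (g2 t))}.
  move=> c1 c2; have -> : (fun t => dot (g1 t) (g2 t)) = (fun t => \sum_i g1 t 0 i * g2 t 0 i).
    by apply/funext => t; rewrite dotE.
  by apply: continuous_fsum => i; apply: cvgM; exact: ce.
have cfq : {for p, continuous (fun t => f t - q)} by apply: cvgB => //; exact: cvg_cst.
have cd : {for p, continuous (fun t => r ^+ 2 - dot (f t - q) (f t - q))}.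
  by apply: cvgB; [exact: cvg_cst|exact: cdot].
have cmax : {for p, continuous (fun t => Num.max 0 (r ^+ 2 - dot (f t - q) (f t - q)))}.
  have -> : (fun t => Num.max 0 (r ^+ 2 - dot (f t - q) (f t - q))) =
      (fun t => (r ^+ 2 - dot (f t - q) (f t - q) + `|r ^+ 2 - dot (f t - q) (f t - q)|) / 2).
    by apply/funext => t; rewrite maxr_absE add0r sub0r normrN.
  apply: cvgM; last exact: cvg_cst.
  by apply: cvgD => //; apply: cvg_norm.
apply: cvgM; last by apply: cvgN; apply: cvgM; [exact: cvg_cst|exact: cdot].
apply: cvgM; first exact: cvg_cst.
exact: cmax.
Qed.

Lemma bump_ge0 q r y : 0 <= bump q r y.
Proof. by rewrite /bump /cut sqr_ge0. Qed.

Lemma dot_ge0 (u : E) : 0 <= dot u u.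
Proof. by rewrite dotE sumr_ge0// => i _; rewrite -expr2 sqr_ge0. Qed.

Lemma dot_norm (u : E) : `|u| ^+ 2 <= dot u u.
Proof.
rewrite -(@sqr_sqrtr _ (dot u u)) ?dot_ge0// lerXn2r ?nnegrE ?sqrtr_ge0//.
apply: norm_le_entry => [|i k]; first exact: sqrtr_ge0.
rewrite (ord1 i) -sqrtr_sqr ler_sqrt ?dot_ge0// dotE (bigD1 k)//= -expr2 lerDl.
by rewrite sumr_ge0// => l _; rewrite -expr2 sqr_ge0.
Qed.

Lemma bump_le q r y : bump q r y <= r ^+ 4.
Proof.
rewrite /bump /cut (_ : r ^+ 4 = (r ^+ 2) ^+ 2); last by rewrite -exprM.
apply: lerXn2r; rewrite ?nnegrE ?sqr_ge0 ?le_max ?lexx//.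
by rewrite ge_max sqr_ge0/= gerBl dot_ge0.
Qed.

Lemma bump_support q r y : 0 <= r -> r < `|y - q| -> bump q r y = 0.
Proof.
move=> r0 ry; rewrite /bump /cut max_l ?expr0n// subr_le0.
apply: le_trans (dot_norm _); rewrite ltW// ltrXn2r// ?nnegrE//.
Qed.

Lemma bump_boundary q r y : r <= `|y - q| -> 0 <= r -> bump q r y = 0.
Proof.
move=> ry r0; rewrite /bump /cut max_l ?expr0n// subr_le0.
by apply: le_trans (dot_norm _); rewrite lerXn2r ?nnegrE.
Qed.

Lemma bump_inner q r y : 0 < r -> dot (y - q) (y - q) < r ^+ 2 / 2 ->
  r ^+ 4 / 4 <= bump q r y.
Proof.
move=> r0 dy; rewrite /bump /cut (_ : r ^+ 4 / 4 = (r ^+ 2 / 2) ^+ 2); last by field.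
have r2 : 0 <= r ^+ 2 / 2 by rewrite divr_ge0 ?sqr_ge0.
apply: lerXn2r; rewrite ?nnegrE ?le_max ?lexx//.
by apply/orP; right; lra.
Qed.

(** Off the support the derivative is zero, so |y - q| <= r may be assumed, and the two factors are
    at most 2 r^2 and 2 (m+1)^2 r |v|. *)
Lemma dbump_le q r y v : 0 <= r -> `|dbump q r y v| <= 4 * m.+1%:R ^+ 2 * r ^+ 3 * `|v|.
Proof.
move=> r0; rewrite /dbump.
have [ry|ry] := leP (`|y - q|) r; last first.
  have d0 : r ^+ 2 <= dot (y - q) (y - q).
    by apply: le_trans (dot_norm _); rewrite lerXn2r ?nnegrE// ltW.
  rewrite max_l ?subr_le0// mulr0 mul0r normr0.
  by rewrite !mulr_ge0// exprn_ge0.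
have i1 : `|(1%:M : 'M[R]_m.+1)| <= 1.
  by apply: norm_le_entry => // i' k'; rewrite mxE; case: (_ == _); rewrite ?normr1 ?normr0.
have dv := norm_bil_le i1 ry (lexx `|v|).
rewrite normrM normrN !normrM (ger0_norm (ler0n _ 2)).
have mx : `|Num.max 0 (r ^+ 2 - dot (y - q) (y - q))| <= r ^+ 2.
  by rewrite ger0_norm ?le_max ?lexx// ge_max sqr_ge0/= gerBl dot_ge0.
apply: (@le_trans _ _ (2 * r ^+ 2 * (2 * (m.+1%:R * (m.+1%:R * (r * 1) * `|v|))))).
  by rewrite ler_pM ?mulr_ge0// ler_wpM2l.
by rewrite le_eqVlt; apply/orP; left; apply/eqP; ring.
Qed.

End bump.

Section box.
Variables (R : realType) (m : nat) (x0 : 'rV[R]_m.+1) (r : R).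

(** In the plane this is a coordinate square, a product of intervals, to which Fubini applies
    directly. *)
Definition box : set 'rV[R]_m.+1 := [set z | `|z - x0| <= r].

Lemma box_closed : closed box.
Proof.
apply: (preimage_closed _ (@closed_le R r)) => z _.
have cB : {for z, continuous (fun t : 'rV[R]_m.+1 => t - x0)}.
  apply: differentiable_continuous.
  by apply: differentiable_sub_mx; [exact: differentiable_idfun|exact: differentiable_cst].
exact: (continuous_comp cB (@norm_continuous _ _ _)).
Qed.

Lemma box_compact : compact box.
Proof.
apply: bounded_closed_compact; last exact: box_closed.
exists (`|x0| + r); split; first exact: num_real.
move=> M xM z zr /=; rewrite (le_trans _ (ltW xM))//.
by rewrite -[z](subrK x0) (le_trans (ler_normD _ _))// addrC lerD2l.
Qed.

End box.

Lemma inner_box (R : realType) m (x q : 'rV[R]_m.+1) (s : R) : 0 < s ->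
  dot (x - q) (x - q) < s ^+ 2 / 2 -> box q s x.
Proof.
move=> s0 xs; rewrite /box/= -(@ler_pXn2r _ 2) ?nnegrE ?(ltW s0)//.
apply: le_trans (dot_norm _) (le_trans (ltW xs) _).
by rewrite ler_pdivrMr// ler_peMr ?sqr_ge0// ler1n.
Qed.

(** * Measurability, Fubini and the divergence theorem on a coordinate square *)

Section plane.
Variable R : realType.
Local Notation E2 := 'rV[R]_2.
Local Notation e := (basis_vec R).
Local Notation row2 := (@row2 R).
Local Notation leb := (@lebesgue_measure R).
Local Notation leb2 := (lebesgue_measure \x lebesgue_measure)%E.

Lemma row20 (z : R * R) : row2 z 0 0 = z.1.
Proof. by rewrite mxE. Qed.

Lemma row21 (z : R * R) : row2 z 0 1 = z.2.
Proof. by rewrite mxE. Qed.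

Lemma row2_line (i : 'I_2) (t s : R) :
  (if i == 0 then row2 (t, s) else row2 (s, t)) =
  t *: e i + (if i == 0 then row2 (0, s) else row2 (s, 0)).
Proof.
apply/rowP => k; case: i => -[|[|]]//= i2; rewrite /=; rewrite !mxE /=;
  case: k => -[|[|]]//= k2; rewrite /=; ring.
Qed.

Lemma ball2 (z x : E2) (r : R) :
  (`|z - x| <= r) = (`|z 0 0 - x 0 0| <= r) && (`|z 0 1 - x 0 1| <= r).
Proof.
have [r0|r0] := leP 0 r; last first.
  rewrite !leNgt !(lt_le_trans r0)//.
apply/idP/andP => [zr|[z0 z1]].
  have h (i : 'I_2) : `|z 0 i - x 0 i| <= r.
    by apply: le_trans zr; have := entry_le_norm (z - x) 0 i; rewrite !mxE.
  by split; exact: h.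
apply: norm_le_entry => // i k; rewrite (ord1 i) !mxE.
by case: k => -[|[|]]//= k2; [move: z0|move: z1]; congr (`|z 0 _ - x 0 _| <= _); exact: val_inj.
Qed.

(** The sigma-algebra is the product one on pairs of reals, while U is open among row vectors; U is
    a countable union of open squares with rational centres and sizes. *)
Lemma open_measurable2 (U : set E2) : open U ->
  measurable (row2 @^-1` U : set (measurableTypeR R * measurableTypeR R)).
Proof.
move=> oU.
pose B (q : rat * rat * rat) : set (measurableTypeR R * measurableTypeR R) :=
  `]ratr q.1.1 - ratr q.2, ratr q.1.1 + ratr q.2[%classic `*`
  `]ratr q.1.2 - ratr q.2, ratr q.1.2 + ratr q.2[%classic.
pose F q := if `[< B q `<=` row2 @^-1` U >] then B q else set0.
have -> : row2 @^-1` U = \bigcup_q F q.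
  apply/seteqP; split=> [z Uz|z [q _]]; last first.
    by rewrite /F; case: ifPn => // /asboolP h /h.
  have [r r0 rU] := open_normP oU Uz.
  have [k] : exists2 k : rat, 0 < ratr k :> R & ratr k < r / 2.
    have r2 : 0 < r / 2 by rewrite divr_gt0.
    have [k] := rat_in_itvoo r2; rewrite in_itv/= => /andP[k0 kr].
    by exists k.
  move=> k0 kr.
  have ex (t : R) : exists q : rat, t \in `]ratr q - ratr k, ratr q + ratr k[.
    have tk : t - ratr k < t + ratr k by lra.
    have [q] := rat_in_itvoo tk; rewrite in_itv/= => /andP[q1 q2].
    by exists q; rewrite in_itv/=; apply/andP; split; lra.
  have [q1 h1] := ex z.1; have [q2 h2] := ex z.2.
  exists (q1, q2, k) => //; rewrite /F asboolT; first by split.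
  move=> y [/=]; rewrite !in_itv/= => y1 y2; apply: rU; rewrite ball2 !row20 !row21.
  move: h1 h2 y1 y2; rewrite !in_itv/= => /andP[? ?] /andP[? ?] /andP[? ?] /andP[? ?].
  by apply/andP; split; rewrite ler_norml; apply/andP; split; lra.
apply: countable_bigcupT_measurable; first exact: countableP.
move=> q; rewrite /F; case: ifPn => // _.
by apply: measurableX; exact: measurable_itv.
Qed.

Lemma continuous_measurable2 (U : set E2) (g : E2 -> R) : open U ->
  (forall z, U z -> {for z, continuous g}) ->
  measurable_fun (row2 @^-1` U : set (measurableTypeR R * measurableTypeR R)) (g \o row2).
Proof.
move=> oU cg.
move=> mU; apply: (measurability _ (measurable_realfun.RGenOpens.measurableE R)).
move=> _ [_ [a [b ->] <-]]; rewrite (_ : _ `&` _ = row2 @^-1` (U `&` g @^-1` `]a, b[%classic))//.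
apply: open_measurable2; rewrite openE => z [Uz gz].
apply: filterI; first exact: open_nbhs_nbhs.
by apply: (cg _ Uz); apply: open_nbhs_nbhs; split => //; exact: interval_open.
exact: mU.
Qed.

Section box2.
Variables (x0 : E2) (r : R).
Hypothesis r0 : 0 < r.

Let itv (i : 'I_2) : set (measurableTypeR R) := `[x0 0 i - r, x0 0 i + r]%classic.

Lemma box_preimage : row2 @^-1` box x0 r = itv 0 `*` itv 1.
Proof.
apply/seteqP; split => z; rewrite /box/= ball2 !row20 !row21 /itv/= !in_itv/= !ler_norml.
  by move=> /andP[/andP[? ?] /andP[? ?]]; split; apply/andP; split; lra.
by move=> [/andP[? ?] /andP[? ?]]; apply/andP; split; apply/andP; split; lra.
Qed.

Lemma box_measurable : measurable (row2 @^-1` box x0 r : set (measurableTypeR R * measurableTypeR R)).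
Proof. by rewrite box_preimage; apply: measurableX; exact: measurable_itv. Qed.

Lemma box_finite : (leb2 (row2 @^-1` box x0 r) < +oo)%E.
Proof.
rewrite box_preimage product_measure1E//; try exact: measurable_itv.
have fin i : (leb (itv i) < +oo)%E.
  by rewrite lebesgue_measure_itv/=; case: ifPn => // _; rewrite -EFinB ltry.
apply: lte_mul_pinfty; [exact: measure_ge0| |exact: fin].
by rewrite ge0_fin_numE; [exact: fin|exact: measure_ge0].
Qed.

Lemma box_integrable (U : set E2) (g : E2 -> R) : open U -> box x0 r `<=` U ->
  (forall z, U z -> {for z, continuous g}) ->
  leb2.-integrable (row2 @^-1` box x0 r) (EFin \o (g \o row2)).
Proof.
move=> oU bU cg.
apply: measurable_bounded_integrable.
- exact: box_measurable.
- exact: box_finite.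
- apply: (measurable_funS _ _ (continuous_measurable2 oU cg)).
    exact: open_measurable2.
  by move=> z /bU.
have [B _ Bg] := @compact_bound _ _ _ (box_compact (r := r)) _ g (fun z zb => cg _ (bU _ zb)).
exists B; split; first exact: num_real.
by move=> M BM z zb /=; rewrite (le_trans (Bg _ zb))// ltW.
Qed.

Lemma line_integral i (V : E2 -> R) (s : R) :
  (forall z, derivable V z (e i)) ->
  (forall z, {for z, continuous V}) ->
  (forall z, {for z, continuous (fun z => 'D_(e i) V z)}) ->
  (forall z, r <= `|z - x0| -> V z = 0) ->
  (\int[leb]_(t in `[(x0 0 i - r)%R, (x0 0 i + r)%R])
     ('D_(e i) V (if i == 0 then row2 (t, s) else row2 (s, t)))%:E = 0)%E.
Proof.
move=> dV cV cD V0.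
pose y := if i == 0 then row2 (0, s) else row2 (s, 0).
pose F t := V (t *: e i + y).
pose l t := t *: e i + y.
have cl t : {for t, continuous l}.
  by apply: cvgD; [apply: cvgZr_tmp|]; [exact: cvg_id|exact: cvg_cst].
have dF (t : R) : is_derive t 1 F ('D_(e i) V (l t)) by exact: derivable_line.
have cF (t : R) : {for t, continuous F} by exact: continuous_comp (cl t) (cV _).
have ab : x0 0 i - r < x0 0 i + r by rewrite ltrD2l gtrN.
transitivity (\int[leb]_(t in `[(x0 0 i - r)%R, (x0 0 i + r)%R]) ('D_(e i) V (l t))%:E)%E.
  by apply: eq_integral => t _; rewrite row2_line.
rewrite (@continuous_FTC2 _ (fun t => 'D_(e i) V (l t)) F)//.
(* At either end the i-th coordinate alone puts the point at distance at least r from x0, whatever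
   the other coordinate s is. *)
- have Fb t : t = x0 0 i - r \/ t = x0 0 i + r -> F t = 0.
    move=> tE; apply: V0; have := entry_le_norm (l t - x0) 0 i.
    have -> : (l t - x0) 0 i = t - x0 0 i.
      have yi : y 0 i = 0.
        rewrite /y; case: (i =P 0) => [->|/eqP i0]; first by rewrite row20.
        by rewrite (_ : i = 1) ?row21//; apply/val_inj; move: i0; clear; case: i => -[|[|]].
      have ei : (e i : E2) 0 i = 1 by rewrite mxE !eqxx.
      by rewrite /l !mxE -/y -/(e i) yi !eqxx mulr1 addr0.
    apply: le_trans; case: tE => ->.
      by rewrite (_ : _ - r - _ = - r); [rewrite normrN ler_norm|ring].
    by rewrite (_ : _ + r - _ = r); [rewrite ler_norm|ring].
  by rewrite !Fb ?subee//; [left|right].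
- by apply: continuous_subspaceT => t; exact: continuous_comp (cl t) (cD _).
- split=> [t _| |]; first exact: (@ex_derive _ _ _ _ _ _ _ (dF t)).
  + by apply: cvg_at_right_filter; exact: cF.
  + by apply: cvg_at_left_filter; exact: cF.
by move=> t _; rewrite derive1E (@derive_val _ _ _ _ _ _ _ (dF t)).
Qed.

(** The order of integration is chosen so that the inner integral runs along direction i, where
    [line_integral] makes it zero. *)
Lemma integral_derive_box i (V : E2 -> R) :
  (forall z, derivable V z (e i)) ->
  (forall z, {for z, continuous V}) ->
  (forall z, {for z, continuous (fun z => 'D_(e i) V z)}) ->
  (forall z, r <= `|z - x0| -> V z = 0) ->
  (\int[leb2]_(z in row2 @^-1` box x0 r) ('D_(e i) V (row2 z))%:E = 0)%E.
Proof.
move=> dV cV cD V0.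
have ib : leb2.-integrable (row2 @^-1` box x0 r) (EFin \o ((fun z => 'D_(e i) V z) \o row2)).
  by apply: (box_integrable openT) => // z _.
rewrite integral_mkcond.
have ig : leb2.-integrable setT ((fun z => ('D_(e i) V (row2 z))%:E) \_ (row2 @^-1` box x0 r)).
  by apply/integrable_restrict => //; [exact: box_measurable|rewrite setTI].
have [i0|i0] := eqVneq i 0.
  rewrite -(integral21_prod_meas1 ig); apply: integral0_eq => s _.
  pose I1 := itv 1.
  have [s1|s1] := pselect (I1 s).
    rewrite -[RHS](line_integral s dV cV cD V0) i0 /= integral_mkcond.
    apply: eq_integral => t _; rewrite /patch box_preimage.
    congr (if _ then _ else _); apply/idP/idP => /set_mem H; apply/mem_set => //.
    by case: H.
  apply: integral0_eq => t _; rewrite /patch box_preimage memNset//.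
  by move=> [].
have i1 : i = 1 by apply/val_inj; case: i i0 {dV cV cD ib ig} => -[|[|]].
rewrite -(integral12_prod_meas1 ig); apply: integral0_eq => s _.
have [s1|s1] := pselect (itv 0 s).
  rewrite -[RHS](line_integral s dV cV cD V0) i1 /= integral_mkcond.
  apply: eq_integral => t _; rewrite /patch box_preimage.
  congr (if _ then _ else _); apply/idP/idP => /set_mem H; apply/mem_set => //.
  by case: H.
apply: integral0_eq => t _; rewrite /patch box_preimage memNset//.
by move=> [].
Qed.

End box2.
End plane.

(** * Integration by parts *)

Lemma flux_algebra (R : comPzRingType) (t t0 t1 u p s s' q w w' : R) : s' = s -> w' = w ->
  (t0 * (u * q) + t * (p * q + u * w)) - (t1 * (u * s) + t * (s' * s + u * w')) =
  t * (p * q - s ^+ 2) + u * (t0 * q - t1 * s).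
Proof. by move=> -> ->; ring. Qed.

Section divergence.
Variable R : realType.
Local Notation E2 := 'rV[R]_2.
Local Notation e := (basis_vec R).
Variables (O C : set E2) (t : E2 -> R).
Hypotheses (oO : open O) (clC : closed C) (CO : C `<=` O).
Hypotheses (dt : forall z, O z -> differentiable t z)
  (ct : forall i z, O z -> {for z, continuous (fun z => 'D_(e i) t z)})
  (t0 : forall z, ~ C z -> t z = 0).

Section product.
Variables (g1 g2 : E2 -> R) (s1 : smooth_on O g1) (s2 : smooth_on O g2).

(** The factors are controlled on O only. Since t vanishes off the closed set C inside O, the
    product is nevertheless C^1 on the whole plane, as the integrals over the square require. *)
Definition cutprod (z : E2) : R := t z * (g1 z * g2 z).

Let d1 z : O z -> differentiable g1 z. Proof. exact: smooth_diffR. Qed.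
Let d2 z : O z -> differentiable g2 z. Proof. exact: smooth_diffR. Qed.

Lemma cutprod0 z : ~ C z -> \near z, 0 = cutprod z.
Proof.
move=> nC; apply: (open_near (closed_openC clC) nC) => y /t0 ty.
by rewrite /cutprod ty mul0r.
Qed.

Lemma cutprod_diff z : differentiable cutprod z.
Proof.
have [Oz|nO] := pselect (O z).
  by apply: differentiableM; [exact: dt|apply: differentiableM; [exact: d1|exact: d2]].
have nC : ~ C z by move=> /CO.
exact: near_eq_differentiable (cutprod0 nC) (differentiable_cst _ _).
Qed.

Definition dcutprod i z := 'D_(e i) t z * (g1 z * g2 z) +
  t z * ('D_(e i) g1 z * g2 z + g1 z * 'D_(e i) g2 z).

Lemma derive_cutprod i z : O z -> 'D_(e i) cutprod z = dcutprod i z.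
Proof.
move=> Oz.
have h1 : derivable g1 z (e i) by exact/diff_derivable/d1.
have h2 : derivable g2 z (e i) by exact/diff_derivable/d2.
have ht : derivable t z (e i) by exact/diff_derivable/dt.
have h12 : derivable (g1 * g2) z (e i) := derivableM h1 h2.
have E : 'D_(e i) cutprod z = t z *: 'D_(e i) (g1 * g2) z + (g1 * g2) z *: 'D_(e i) t z := deriveM ht h12.
have E' : 'D_(e i) (g1 * g2) z = g1 z *: 'D_(e i) g2 z + g2 z *: 'D_(e i) g1 z := deriveM h1 h2.
rewrite E E' /dcutprod -[(g1 * g2) z]/(g1 z * g2 z) /GRing.scale /=.
move: ('D__ _ z) ('D__ _ z) ('D__ _ z) (g1 z) (g2 z) (t z) => a b c d f k.
ring.
Qed.

Lemma derive_cutprod_continuous i z : {for z, continuous (fun z => 'D_(e i) cutprod z)}.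
Proof.
have [Oz|nO] := pselect (O z).
  apply: (@continuous_near_eq _ _ (dcutprod i)).
    by apply: (open_near oO Oz) => y Oy; rewrite derive_cutprod.
  have c1 : {for z, continuous g1} by exact: smooth_continuous s1 Oz.
  have c2 : {for z, continuous g2} by exact: smooth_continuous s2 Oz.
  have cd1 : {for z, continuous (fun z => 'D_(e i) g1 z)}.
    exact: smooth_continuous (smooth_derive i s1) Oz.
  have cd2 : {for z, continuous (fun z => 'D_(e i) g2 z)}.
    exact: smooth_continuous (smooth_derive i s2) Oz.
  have ctz : {for z, continuous t} by exact/differentiable_continuous/dt.
  have cti : {for z, continuous (fun z => 'D_(e i) t z)} by exact: ct.
  have c3 : {for z, continuous (fun z => g1 z * g2 z)} by exact: cvgM c1 c2.
  have c4 : {for z, continuous (fun z => 'D_(e i) g1 z * g2 z)} by exact: cvgM cd1 c2.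
  have c5 : {for z, continuous (fun z => g1 z * 'D_(e i) g2 z)} by exact: cvgM c1 cd2.
  exact: (cvgD (cvgM cti c3) (cvgM ctz (cvgD c4 c5))).
have nC : ~ C z by move=> /CO.
apply: (@continuous_near_eq _ _ (fun=> 0)); last exact: cst_continuous.
apply: (open_near (closed_openC clC) nC) => y nCy.
by rewrite -(near_eq_derive _ (cutprod0 nCy)) derive_cst.
Qed.

End product.

Section flux.
Variables (u : E2 -> R) (su : smooth_on O u).

(* The null Lagrangian u_00 u_11 - u_01^2 written as a divergence. *)
Definition flux (z : E2) : R :=
  'D_(e 0) (cutprod (fun z => 'D_(e 0) u z) (fun z => 'D_(e 1) (fun y => 'D_(e 1) u y) z)) z -
  'D_(e 1) (cutprod (fun z => 'D_(e 0) u z) (fun z => 'D_(e 0) (fun y => 'D_(e 1) u y) z)) z.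

Let u0 z := 'D_(e 0) u z.
Let u1 z := 'D_(e 1) u z.
Let u2 i z := 'D_(e i) u1 z.
Let s0 : smooth_on O u0. Proof. exact: smooth_derive. Qed.
Let s1 : smooth_on O u1. Proof. exact: smooth_derive. Qed.
Let s2 i : smooth_on O (u2 i). Proof. exact: smooth_derive. Qed.
Let V i := cutprod u0 (u2 i).

Let fluxE z : flux z = 'D_(e 0) (V 1) z - 'D_(e 1) (V 0) z. Proof. by []. Qed.

Let DV_continuous i k z : {for z, continuous (fun z => 'D_(e i) (V k) z)}.
Proof. by apply: derive_cutprod_continuous; [exact: s0|exact: s2]. Qed.

Lemma flux_continuous z : {for z, continuous flux}.
Proof. exact: (cvgB (@DV_continuous 0 1 z) (@DV_continuous 1 0 z)). Qed.

Let DV_out i k z : ~ C z -> 'D_(e i) (V k) z = 0.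
Proof.
move=> nC; transitivity ('D_(e i) (cst 0 : E2 -> R) z); last by rewrite derive_cst.
by apply: esym; apply: near_eq_derive; exact: cutprod0.
Qed.

Lemma flux_out z : ~ C z -> flux z = 0.
Proof. move=> nC.
exact: etrans (congr2 (fun a b : R => a - b) (DV_out 0 1 nC) (DV_out 1 0 nC)) (subrr 0). Qed.

(** The third derivatives of u cancel by two applications of [schwarz]; what is left besides the
    null Lagrangian carries first derivatives of the cutoff t. *)
Lemma flux_eq z : O z ->
  flux z = t z * ('D_(e 0) (fun y => 'D_(e 0) u y) z * 'D_(e 1) (fun y => 'D_(e 1) u y) z -
                  'D_(e 0) (fun y => 'D_(e 1) u y) z ^+ 2) +
    'D_(e 0) u z * ('D_(e 0) t z * 'D_(e 1) (fun y => 'D_(e 1) u y) z -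
                    'D_(e 1) t z * 'D_(e 0) (fun y => 'D_(e 1) u y) z).
Proof.
move=> Oz; rewrite fluxE.
have E1 : 'D_(e 0) (V 1) z = dcutprod u0 (u2 1) 0 z by exact: derive_cutprod.
have E2 : 'D_(e 1) (V 0) z = dcutprod u0 (u2 0) 1 z by exact: derive_cutprod.
have E3 : 'D_(e 1) u0 z = u2 0 z by exact: schwarz oO Oz (su 2).
have E4 : 'D_(e 1) (u2 0) z = 'D_(e 0) (u2 1) z by exact: schwarz oO Oz (s1 2).
refine (etrans (congr2 (fun a b : R => a - b) E1 E2) _).
exact: (flux_algebra _ _ _ _ _ _ E3 E4).
Qed.

Lemma integral_flux (x0 : E2) (r : R) : 0 < r -> (forall z, r <= `|z - x0| -> t z = 0) ->
  (\int[lebesgue_measure \x lebesgue_measure]_(z in @row2 R @^-1` box x0 r) (flux (row2 z))%:E = 0)%E.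
Proof.
move=> r0 tr.
have V0 k z : r <= `|z - x0| -> V k z = 0 by move=> /tr zr; rewrite /V /cutprod zr mul0r.
have ib i k : (lebesgue_measure \x lebesgue_measure)%E.-integrable (@row2 R @^-1` box x0 r)
   (EFin \o ((fun z => 'D_(e i) (V k) z) \o @row2 R)).
  by apply: (box_integrable openT) => // z _; exact: DV_continuous.
have z0 i k : (\int[lebesgue_measure \x lebesgue_measure]_(z in @row2 R @^-1` box x0 r)
   (EFin \o ((fun z => 'D_(e i) (V k) z) \o @row2 R)) z = 0)%E.
  apply: (integral_derive_box r0) => z.
  - exact/diff_derivable/(cutprod_diff s0 (s2 k)).
  - exact/differentiable_continuous/(cutprod_diff s0 (s2 k)).
  - exact: DV_continuous.
  - exact: V0.
have := integralB (box_measurable x0 r) (ib 0 1) (ib 1 0).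
move=> H; refine (etrans _ (etrans H _)).
  by apply: eq_integral => z _; exact: EFinB.
exact: etrans (congr2 (fun a b : \bar R => (a - b)%E) (z0 0 1) (z0 1 0)) (sube0 _).
Qed.

End flux.
End divergence.

(** Here d0 and d1 are derivatives of the cutoff [ph ^+ 2], so each still contains one factor [ph],
    which pairs with the second derivative next to it. Young's inequality absorbs half of the left
    side; doubling accounts for the factor 2 on F and E, and 16 is 2 times two cross terms of size
    4. *)
Lemma absorb (R : realType) (C0 E L N T ph d0 d1 u p q s F : R) :
  0 <= C0 -> 0 <= E -> 0 <= L -> 0 <= N -> ph ^+ 2 <= T ->
  `|d0| <= 2 * `|ph| * (L * (1 + N)) -> `|d1| <= 2 * `|ph| * (L * (1 + N)) -> `|u| <= N ->
  p ^+ 2 + s ^+ 2 + q ^+ 2 <= C0 * (s ^+ 2 - p * q) + E ->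
  F = ph ^+ 2 * (p * q - s ^+ 2) + u * (d0 * q - d1 * s) ->
  ph ^+ 2 * (p ^+ 2 + s ^+ 2 + q ^+ 2) <=
    - (2 * C0 * F) + (16 * (C0 * L) ^+ 2 * (N ^+ 2 + N ^+ 4) + 2 * (T * E)).
Proof.
move=> C00 E0 L0 N0 phT d0B d1B uN ell ->.
have cross d x : `|d| <= 2 * `|ph| * (L * (1 + N)) ->
    C0 * (u * (d * x)) <= ph ^+ 2 * x ^+ 2 / 2 + 4 * (C0 * L) ^+ 2 * (N ^+ 2 + N ^+ 4).
  move=> dB.
  set y := 2 * (C0 * L * (N * (1 + N))).
  have h1 : C0 * (u * (d * x)) <= `|ph * x| * y.
    apply: le_trans (ler_norm _) _; rewrite !normrM (ger0_norm C00).
    have -> : `|ph| * `|x| * y = C0 * (N * (2 * `|ph| * (L * (1 + N)) * `|x|)) by rewrite /y; ring.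
    rewrite ler_wpM2l// ler_pM ?mulr_ge0//.
    by rewrite ler_wpM2r.
  have h2 : `|ph * x| * y <= ph ^+ 2 * x ^+ 2 / 2 + y ^+ 2 / 2.
    rewrite -exprMn -(real_normK (num_real (ph * x))).
    by move: (`|ph * x|) => a; have := sqr_ge0 (a - y); rewrite sqrrB; lra.
  have h3 : y ^+ 2 / 2 <= 4 * (C0 * L) ^+ 2 * (N ^+ 2 + N ^+ 4).
    have -> : y ^+ 2 / 2 = 2 * (C0 * L) ^+ 2 * (N ^+ 2 * (1 + N) ^+ 2) by rewrite /y; field.
    rewrite (_ : 4 * (C0 * L) ^+ 2 * (N ^+ 2 + N ^+ 4) = 2 * (C0 * L) ^+ 2 * (N ^+ 2 * (2 + 2 * N ^+ 2))); last by ring.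
    rewrite !ler_wpM2l ?mulr_ge0 ?sqr_ge0//.
    by have := sqr_ge0 (1 - N); rewrite sqrrB sqrrD; lra.
  by apply: le_trans h1 (le_trans h2 _); rewrite lerD2l.
have := cross d0 q d0B.
have := cross (- d1) s; rewrite normrN => /(_ d1B).
have tE : ph ^+ 2 * E <= T * E by rewrite ler_wpM2r.
have tell := ler_wpM2l (sqr_ge0 ph) ell.
have tp : 0 <= ph ^+ 2 * p ^+ 2 by rewrite mulr_ge0 ?sqr_ge0.
move: tE tell tp; set Z := 4 * (C0 * L) ^+ 2 * (N ^+ 2 + N ^+ 4).
have -> : 16 * (C0 * L) ^+ 2 * (N ^+ 2 + N ^+ 4) = 4 * Z by rewrite /Z; ring.
move: Z (ph ^+ 2) (T * E) => Z P TE tE tell tp h1 h2.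
have {}tell : P * p ^+ 2 + P * s ^+ 2 + P * q ^+ 2 <= C0 * (P * (s ^+ 2 - p * q)) + P * E.
  by move: tell; congr (_ <= _); ring.
have -> : P * (p ^+ 2 + s ^+ 2 + q ^+ 2) = P * p ^+ 2 + P * s ^+ 2 + P * q ^+ 2 by ring.
have -> : - (2 * C0 * (P * (p * q - s ^+ 2) + u * (d0 * q - d1 * s))) =
   2 * (C0 * (P * (s ^+ 2 - p * q))) - 2 * (C0 * (u * (d0 * q))) - 2 * (C0 * (u * (- d1 * s))) by ring.
move: (C0 * (P * (s ^+ 2 - p * q))) (C0 * (u * (d0 * q))) (C0 * (u * (- d1 * s))) tE tell tp h1 h2.
move: (P * p ^+ 2) (P * s ^+ 2) (P * q ^+ 2) (P * E) => a b c d a1 a2 a3.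
clear; move=> *; lra.
Qed.

(** The inequality on t SQ, multiplied by 2 A / m, is used twice. Dropping its nonnegative left side
    bounds the flux from above everywhere; where the cutoff t is at least m, that left side
    dominates A Q. *)
Lemma patch_algebra (R : realFieldType) (A m C0 K F NN t SQ B4 en : R) :
  0 <= A -> 0 < m -> 0 <= K -> 0 <= t -> 0 <= SQ -> NN <= B4 * en ->
  t * SQ <= - (2 * C0 * F) + K * NN -> 0 <= NN ->
  4 * A * C0 / m * F <= (2 * A / m * K + A) * B4 * en /\
  (forall Q nn, m <= t -> Q <= 2 * SQ -> nn <= A * (Q + NN) ->
    nn <= (2 * A / m * K + A) * B4 * en - 4 * A * C0 / m * F).
Proof.
move=> A0 m0 K0 t0 SQ0 NB TQ N0.
pose d := 2 * A / m.
have d0 : 0 <= d by rewrite divr_ge0 ?mulr_ge0// ltW.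
have h1 : d * (t * SQ) <= - (4 * A * C0 / m * F) + d * K * NN.
  have := ler_wpM2l d0 TQ.
  by rewrite (_ : d * (_ + _) = - (4 * A * C0 / m * F) + d * K * NN)// /d; field; rewrite gt_eqF.
have h2 : (d * K + A) * NN <= (d * K + A) * B4 * en.
  by rewrite -mulrA ler_wpM2l// addr_ge0// mulr_ge0.
rewrite -/d; move: h1 h2; set Z := 4 * A * C0 / m * F; set Y := _ * B4 * en => h1 h2.
rewrite mulrDl in h2; have AN : 0 <= A * NN by rewrite mulr_ge0.
have dT : 0 <= d * (t * SQ) := mulr_ge0 d0 (mulr_ge0 t0 SQ0).
split; first by lra.
move=> Q nn mt QS nnA.
have h3 : A * Q <= d * (t * SQ).
  apply: (@le_trans _ _ (A * (2 * SQ))); first exact: ler_wpM2l.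
  rewrite (_ : A * (2 * SQ) = d * (m * SQ)); last by rewrite /d; field; rewrite gt_eqF.
  by rewrite ler_wpM2l// ler_wpM2r.
by rewrite mulrDr in nnA; lra.
Qed.

Lemma sum_sqr3_ge (R : realDomainType) (x y z : R) :
  [/\ x ^+ 2 <= x ^+ 2 + y ^+ 2 + z ^+ 2, y ^+ 2 <= x ^+ 2 + y ^+ 2 + z ^+ 2
    & z ^+ 2 <= x ^+ 2 + y ^+ 2 + z ^+ 2].
Proof.
have := sqr_ge0 x; have := sqr_ge0 y; have := sqr_ge0 z.
by move: (x ^+ 2) (y ^+ 2) (z ^+ 2) => a b c *; split; lra.
Qed.

Lemma sqr_sqrtr_le (R : rcfType) (x : R) : Num.sqrt x ^+ 2 <= `|x|.
Proof.
have [x0|x0] := leP 0 x; first by rewrite sqr_sqrtr// ler_norm.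
by rewrite ler0_sqrtr ?(ltW x0)// expr2 mul0r.
Qed.

(** * Localisation in one source square and one target cube *)

Section target_patch.
Variables (R : realType) (n : nat) (S : manifold R 1) (M : manifold R n.*2).
Local Notation E := 'rV[R]_n.*2.+1.
Local Notation E2 := 'rV[R]_2.
Local Notation e := (basis_vec R).
Variables (W : set S).
Variables (lam : one_form M) (X : vector_field M) (J : tensor2 M) (j h : tensor2 S).
Variables (Gh : connection S) (G : connection M).
Hypotheses (oW : open W) (htriad : is_contact_triad lam X J).
Hypotheses (cj : is_complex_structure j) (mh : is_metric W h).
Hypotheses (cGh : is_connection W Gh) (cG : is_connection setT G).
Variables (a : idx S) (x0 : E2) (r : R).
Hypotheses (r0 : 0 < r) (bW : box x0 r `<=` cimg W a).
Variables (c : idx M) (q : E) (s : R).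
Hypotheses (s0 : 0 < s) (bM : box q s `<=` cimg setT c).

Section cutoff.
Variables (w : S -> M) (sw : smooth_map W w).
Let f := local_rep w a c.
Let O := local_dom W w a c.
Let oO : open O. Proof. exact: local_dom_open. Qed.
Let sf : smooth_on O f. Proof. exact: local_rep_smooth. Qed.
Let df z : O z -> differentiable f z. Proof. exact: smooth_diff. Qed.

Definition cutoff_supp : set E2 := [set z | [/\ O z, box x0 r z & box q s (f z)]].

Lemma cutoff_supp_sub : cutoff_supp `<=` O. Proof. by move=> z []. Qed.

(** [local_dom] is merely open, so a limit of points of the support might be mapped out of the
    target chart. This is excluded by compactness: the cube [box q s] corresponds to a compact
    subset of M, closed because M is Hausdorff, and w is continuous at the limit, which lies in the
    source square. *)
Lemma cutoff_supp_closed : closed cutoff_supp.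
Proof.
pose KM := cinv (atlas c) @` box q s.
have cKM : closed KM.
  apply: (compact_closed (@manifold_hausdorff _ _ M)).
  apply: continuous_compact; last exact: box_compact.
  apply: continuous_in_subspaceT => y /set_mem yb.
  apply: cinv_cont; have [p [cp _] <-] := bM yb.
  by exists p.
have suppKM z : cutoff_supp z -> KM (w (cinv (atlas a) z)).
  move=> [Oz _ fz]; exists (f z) => //.
  have [_ _ cw _] := local_domP Oz; by rewrite /f /local_rep /= cmapK.
move=> z clz.
have bz : box x0 r z.
  apply: (@box_closed _ _ x0 r); apply: (closureS _ clz).
  by move=> y [].
have [p [ap Wp] pz] := bW bz.
have zp : cinv (atlas a) z = p by rewrite -pz cmapK.
have cwz : {for z, continuous (w \o cinv (atlas a))}.
  apply: continuous_comp; first by apply: cinv_cont; exists p.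
  by rewrite zp; exact: sw.1.
have [y ybq yw] : KM (w (cinv (atlas a) z)).
  apply: contrapT => nK.
  have := cwz _ (open_nbhs_nbhs (conj (closed_openC cKM) nK)).
  by move=> /clz[y [/suppKM]].
have [p' [cp' _] p'y] := bM ybq.
have wp : w p = p' by rewrite -zp -yw -p'y cmapK.
have fz : f z = y by rewrite /f -pz local_repE// wp.
by split; rewrite ?fz// -pz; apply: local_dom_intro; rewrite // wp.
Qed.

Definition cutoff_root (z : E2) : R := bump x0 r z * bump q s (f z).

(* Outside [local_dom] the map f is meaningless, so the cutoff is explicitly
   extended by 0 off its closed support. *)
Definition cutoff (z : E2) : R :=
  if `[< cutoff_supp z >] then cutoff_root z ^+ 2 else 0.

Definition dcutoff_root i (z : E2) : R :=
  dbump x0 r z (e i) * bump q s (f z) + bump x0 r z * dbump q s (f z) ('D_(e i) f z).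

Lemma cutoff_out z : ~ cutoff_supp z -> cutoff z = 0.
Proof. by move=> nz; rewrite /cutoff asboolF. Qed.

(** Inside the domain the case distinction is invisible, since one of the two bumps vanishes off the
    support. *)
Lemma cutoffE z : O z -> cutoff z = cutoff_root z ^+ 2.
Proof.
move=> Oz; rewrite /cutoff; case: asboolP => // nz.
rewrite /cutoff_root; have [xz|xz] := leP `|z - x0| r; last first.
  by rewrite (bump_support (ltW r0) xz) mul0r expr0n.
have [fz|fz] := leP `|f z - q| s; first by exfalso; apply: nz.
by rewrite (bump_support (ltW s0) fz) mulr0 expr0n.
Qed.

Lemma cutoff_boundary z : r <= `|z - x0| -> cutoff z = 0.
Proof.
move=> rz; rewrite /cutoff /cutoff_root (bump_boundary rz (ltW r0)) mul0r expr0n.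
by case: ifP.
Qed.

Let df_bump z : O z -> differentiable (bump q s \o f) z.
Proof. by move=> Oz; apply: differentiable_comp; [exact: df|exact: bump_diff]. Qed.

Let droot z : O z -> differentiable cutoff_root z.
Proof. by move=> Oz; apply: differentiableM; [exact: bump_diff|exact: df_bump]. Qed.

Let nearE z : O z -> \near z, (cutoff_root * cutoff_root) z = cutoff z.
Proof. by move=> Oz; apply: (open_near oO Oz) => y Oy; rewrite cutoffE// expr2. Qed.

Lemma cutoff_diff z : O z -> differentiable cutoff z.
Proof.
move=> Oz; apply: (near_eq_differentiable (nearE Oz)).
by apply: differentiableM; exact: droot.
Qed.

Lemma derive_cutoff i z : O z ->
  'D_(e i) cutoff z = 2 * (cutoff_root z * dcutoff_root i z).
Proof.
move=> Oz.
have h1 : derivable cutoff_root z (e i) by exact/diff_derivable/droot.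
have hb : derivable (bump x0 r) z (e i) by exact/diff_derivable/bump_diff.
have hf : derivable (bump q s \o f) z (e i) by exact/diff_derivable/df_bump.
have E1 : 'D_(e i) (bump x0 r * (bump q s \o f)) z =
  bump x0 r z *: 'D_(e i) (bump q s \o f) z + (bump q s \o f) z *: 'D_(e i) (bump x0 r) z := deriveM hb hf.
have E2 : 'D_(e i) (bump q s \o f) z = dbump q s (f z) ('D_(e i) f z).
  by rewrite (derive_chain _ (df Oz) (bump_diff _ _ _)) bump_derive.
have E3 : 'D_(e i) cutoff_root z = dcutoff_root i z.
  refine (etrans E1 _); rewrite E2 bump_derive /dcutoff_root addrC.
  by congr (_ + _); rewrite /GRing.scale /= mulrC.
have E4 : 'D_(e i) (cutoff_root * cutoff_root) z =
  cutoff_root z *: 'D_(e i) cutoff_root z + cutoff_root z *: 'D_(e i) cutoff_root z := deriveM h1 h1.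
refine (etrans (esym (near_eq_derive _ (nearE Oz))) (etrans E4 _)).
by rewrite E3 mulr_natl mulr2n.
Qed.

Lemma derive_cutoff_continuous i z : O z -> {for z, continuous (fun z => 'D_(e i) cutoff z)}.
Proof.
move=> Oz; apply: (@continuous_near_eq _ _ (fun z => 2 * (cutoff_root z * dcutoff_root i z))).
  by apply: (open_near oO Oz) => y Oy; rewrite derive_cutoff.
have c1 : {for z, continuous cutoff_root} by exact/differentiable_continuous/droot.
have cb : {for z, continuous (bump x0 r)} by exact/differentiable_continuous/bump_diff.
have cbf : {for z, continuous (bump q s \o f)} by exact/differentiable_continuous/df_bump.
have cf : {for z, continuous f} by exact/differentiable_continuous/df.
have cDf : {for z, continuous (fun z => 'D_(e i) f z)}.
  exact: smooth_continuous (smooth_derive i sf) Oz.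
have cid : {for z, continuous (fun z : E2 => z)}.
  exact/differentiable_continuous/differentiable_idfun.
have cc : {for z, continuous (fun _ : E2 => e i : E2)} by exact: cst_continuous.
have cd1 : {for z, continuous (fun z => dbump x0 r z (e i))} by exact: dbump_continuous.
have cd2 : {for z, continuous (fun z => dbump q s (f z) ('D_(e i) f z))} by exact: dbump_continuous.
have c2 : {for z, continuous (dcutoff_root i)} by exact: (cvgD (cvgM cd1 cbf) (cvgM cb cd2)).
have c0 : {for z, continuous (fun _ : E2 => 2 : R)} by exact: cst_continuous.
exact: (cvgM c0 (cvgM c1 c2)).
Qed.

(** The first summand comes from differentiating the source bump, the second from differentiating
    the target bump, whose derivative along f is also multiplied by |df|. *)
Definition cutoff_lip : R := 16 * r ^+ 3 * s ^+ 4 + 4 * n.*2.+1%:R ^+ 2 * r ^+ 4 * s ^+ 3.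

Lemma cutoff_lip_ge0 : 0 <= cutoff_lip.
Proof. by rewrite addr_ge0// !mulr_ge0// ?exprn_ge0 ?ler0n ?(ltW r0) ?(ltW s0)//. Qed.

Lemma dcutoff_root_le i z : `|dcutoff_root i z| <= cutoff_lip * (1 + `|jac f z|).
Proof.
have Nf : `|'D_(e i) f z| <= `|jac f z| by rewrite -row_jac norm_row_le.
set N := `|jac f z| in Nf *.
have N0 : 0 <= N by exact: normr_ge0.
have r4 : 0 <= r ^+ 4 by rewrite exprn_ge0 ?ltW.
have r3 : 0 <= r ^+ 3 by rewrite exprn_ge0 ?ltW.
have s4 : 0 <= s ^+ 4 by rewrite exprn_ge0 ?ltW.
have s3 : 0 <= s ^+ 3 by rewrite exprn_ge0 ?ltW.
apply: le_trans (ler_normD _ _) _.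
rewrite (normrM (dbump _ _ _ _)) (normrM (bump _ _ _)) !(ger0_norm (bump_ge0 _ _ _)).
have h1 : `|dbump x0 r z (e i)| * bump q s (f z) <= 16 * r ^+ 3 * s ^+ 4.
  apply: ler_pM; rewrite ?normr_ge0 ?bump_ge0 ?bump_le//.
  apply: le_trans (dbump_le _ _ _ (ltW r0)) _.
  rewrite (_ : 16 = 4 * 2%:R ^+ 2 :> R); last by ring.
  rewrite -[leRHS]mulr1 ler_wpM2l ?normr_basis//.
  by apply: mulr_ge0 => //; apply: mulr_ge0 => //; exact: sqr_ge0.
have h2 : bump x0 r z * `|dbump q s (f z) ('D_(e i) f z)| <= 4 * n.*2.+1%:R ^+ 2 * r ^+ 4 * s ^+ 3 * N.
  rewrite (_ : _ * N = r ^+ 4 * (4 * n.*2.+1%:R ^+ 2 * s ^+ 3 * N)); last by ring.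
  apply: ler_pM; rewrite ?normr_ge0 ?bump_ge0 ?bump_le//.
  apply: le_trans (dbump_le _ _ _ (ltW s0)) _.
  exact: ler_wpM2l (mulr_ge0 (mulr_ge0 (ler0n _ _) (sqr_ge0 _)) s3) _ _ Nf.
have h3 : 0 <= 16 * r ^+ 3 * s ^+ 4 := mulr_ge0 (mulr_ge0 (ler0n _ _) r3) s4.
have h4 : 0 <= 4 * n.*2.+1%:R ^+ 2 * r ^+ 4 * s ^+ 3 := mulr_ge0 (mulr_ge0 (mulr_ge0 (ler0n _ _) (sqr_ge0 _)) r4) s3.
apply: le_trans (lerD h1 h2) _.
rewrite /cutoff_lip; move: (16 * _ * _) (4 * _ * _ * _) h3 h4 => u v h3 h4.
rewrite mulrDr mulr1 mulrDl lerD//; last by rewrite lerDr mulr_ge0.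
by rewrite lerDl.
Qed.

Lemma cutoff_root_le z : cutoff_root z ^+ 2 <= (r ^+ 4 * s ^+ 4) ^+ 2.
Proof.
have r4 : 0 <= r ^+ 4 by rewrite exprn_ge0 ?ltW.
have s4 : 0 <= s ^+ 4 by rewrite exprn_ge0 ?ltW.
have b0 := mulr_ge0 (bump_ge0 x0 r z) (bump_ge0 q s (f z)).
apply: lerXn2r; [exact: b0|exact: mulr_ge0|].
by apply: ler_pM (bump_ge0 _ _ _) (bump_ge0 _ _ _) _ _; exact: bump_le.
Qed.

Lemma cutoff_inner z : O z -> dot (z - x0) (z - x0) < r ^+ 2 / 2 ->
  dot (f z - q) (f z - q) < s ^+ 2 / 2 -> (r ^+ 4 / 4 * (s ^+ 4 / 4)) ^+ 2 <= cutoff z.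
Proof.
move=> Oz xz fz; rewrite cutoffE//.
have r4 : 0 <= r ^+ 4 / 4 by rewrite divr_ge0 ?exprn_ge0 ?(ltW r0).
have s4 : 0 <= s ^+ 4 / 4 by rewrite divr_ge0 ?exprn_ge0 ?(ltW s0).
have b0 := mulr_ge0 (bump_ge0 x0 r z) (bump_ge0 q s (f z)).
apply: lerXn2r; [exact: mulr_ge0|exact: b0|].
by apply: ler_pM => //; exact: bump_inner.
Qed.

End cutoff.
Section estimates.
Variable B : R.
Hypotheses (B1 : 1 <= B) (sB : forall z, box x0 r z -> source_bd j h Gh a z B)
  (tB : forall y, box q s y -> target_bd lam X J G c y B).
(** [C0] and [C1] are the constants of [elliptic_pointwise] and [A] is that of [nnorm2_bound]. [T]
    bounds the cutoff from above, [m2] bounds it from below where both arguments lie in the inner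
    balls, and [C4] collects the remainder in [absorb]. *)
Let k := n.*2.+1%:R : R.
Let C0 := 200 * B ^+ 8.
Let C1 := 200 * B ^+ 8 * (2 * (12 * k ^+ 3 * B ^+ 3) ^+ 2).
Let T := (r ^+ 4 * s ^+ 4) ^+ 2.
Let C4 := 16 * (C0 * cutoff_lip) ^+ 2 + 2 * (T * C1).
Let A := 3200 * k ^+ 6 * B ^+ 5.
Let m2 := (r ^+ 4 / 4 * (s ^+ 4 / 4)) ^+ 2.

Let B0 : 0 <= B. Proof. exact: le_trans B1. Qed.
Let C00 : 0 <= C0. Proof. exact: mulr_ge0 (ler0n _ _) (exprn_ge0 _ B0). Qed.
Let C10 : 0 <= C1. Proof. exact: mulr_ge0 C00 (mulr_ge0 (ler0n _ _) (sqr_ge0 _)). Qed.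
Let A0 : 0 <= A. Proof. exact: mulr_ge0 (mulr_ge0 (ler0n _ _) (exprn_ge0 _ (ler0n _ _))) (exprn_ge0 _ B0). Qed.
Let T0 : 0 <= T. Proof. exact: sqr_ge0. Qed.
Let C40 : 0 <= C4.
Proof.
exact: addr_ge0 (mulr_ge0 (ler0n _ _) (sqr_ge0 _)) (mulr_ge0 (ler0n _ _) (mulr_ge0 T0 C10)).
Qed.
Let m20 : 0 < m2. Proof. by rewrite exprn_gt0// mulr_gt0// divr_gt0// exprn_gt0. Qed.

Section map.
Variables (w : S -> M) (hw : contact_instanton W w lam X J j).
Let sw : smooth_map W w := hw.1.
Let f := local_rep w a c.
Let O := local_dom W w a c.
Let oO : open O. Proof. exact: local_dom_open. Qed.
Let sf : smooth_on O f. Proof. exact: local_rep_smooth. Qed.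
Let u l (z : E2) := f z 0 l.
Let su l : smooth_on O (u l). Proof. exact: smooth_entry. Qed.
Let N z := `|jac f z|.
Let D z i := 'D_(e i) (jac f) z.
Let Q2 l z := (D z 0) 0 l ^+ 2 + (D z 0) 1 l ^+ 2 + (D z 1) 1 l ^+ 2.
Let F l := flux (cutoff w) (u l).

Let clC : closed (cutoff_supp w). Proof. exact: cutoff_supp_closed. Qed.
Let dth z : O z -> differentiable (cutoff w) z. Proof. exact: cutoff_diff. Qed.
Let cDth i z : O z -> {for z, continuous (fun z => 'D_(e i) (cutoff w) z)}.
Proof. exact: derive_cutoff_continuous. Qed.
Let th0 z : ~ cutoff_supp w z -> cutoff w z = 0. Proof. exact: cutoff_out. Qed.

Lemma cutoff_flux_continuous l z : {for z, continuous (F l)}.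
Proof. exact: (flux_continuous oO clC (@cutoff_supp_sub w) dth cDth th0 (su l)). Qed.

Lemma integral_cutoff_flux l :
  (\int[lebesgue_measure \x lebesgue_measure]_(z in @row2 R @^-1` box x0 r) (F l (row2 z))%:E = 0)%E.
Proof.
apply: (integral_flux oO clC (@cutoff_supp_sub w) dth cDth th0 (su l) r0).
by move=> z; exact: cutoff_boundary.
Qed.

Let D2E z i1 i2 l : O z -> (D z i1) i2 l = 'D_(e i1) (fun y => 'D_(e i2) (u l) y) z.
Proof.
move=> Oz; refine (etrans (derive_jacE oO sf Oz _ _ _) _).
exact: (derive2_entry _ _ _ _ oO sf Oz).
Qed.

Let DE z l : O z -> `|'D_(e 0) (u l) z| <= N z.
Proof.
move=> Oz; have dfz := smooth_diff oO sf Oz.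
rewrite -(diff_entry _ 0 l dfz) (_ : ('D_(e 0) f z) 0 l = (jac f z) 0 l); last by rewrite mxE.
exact: entry_le_norm.
Qed.

Lemma cutoff_elliptic l z : cutoff_supp w z ->
  cutoff w z * Q2 l z <= - (2 * C0 * F l z) + C4 * (N z ^+ 2 + N z ^+ 4).
Proof.
move=> [Oz bz bf].
have N0 : 0 <= N z by exact: normr_ge0.
have ell := elliptic_pointwise (h := h) (Gh := Gh) (G := G) oW htriad cj hw Oz B1 (sB bz) (tB bf) l.
have dB i : `|'D_(e i) (cutoff w) z| <= 2 * `|cutoff_root w z| * (cutoff_lip * (1 + N z)).
  rewrite (derive_cutoff sw i Oz) normrM (normrM (cutoff_root w z)) (ger0_norm (ler0n _ 2)) -mulrA.
  by do 2!(apply: ler_wpM2l => //); exact: dcutoff_root_le.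
have FE := flux_eq oO dth (su l) Oz.
rewrite (cutoffE Oz) in FE *.
have E0 : 0 <= C1 * (N z ^+ 2 + N z ^+ 4) by rewrite mulr_ge0// addr_ge0 ?exprn_ge0.
rewrite -(D2E 0 0 l Oz) -(D2E 0 1 l Oz) -(D2E 1 1 l Oz) in FE.
have := absorb C00 E0 cutoff_lip_ge0 N0 (cutoff_root_le w z) (dB 0) (dB 1) (DE l Oz) ell FE.
congr (_ <= _ + _); rewrite /C4 -/T; move: (N z ^+ 2 + N z ^+ 4) (C0 * _) => X1 X2.
by clear; ring.
Qed.

(** The function D with integral zero, normalised so that |nabla dw|^2 enters [patch_density_inner]
    with coefficient 1. *)
Definition patch_density (z : E2) : R := 4 * A * C0 / m2 * \sum_l F l z.

Let K := n.*2.+1%:R * C4.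
Let K0 : 0 <= K. Proof. exact: mulr_ge0 (ler0n _ _) C40. Qed.
Let N4 z : 0 <= N z ^+ 2 + N z ^+ 4.
Proof. exact: addr_ge0 (sqr_ge0 _) (exprn_ge0 4 (normr_ge0 _)). Qed.

Lemma cutoff_elliptic_sum z : 
  cutoff w z * \sum_l Q2 l z <= - (2 * C0 * \sum_l F l z) + K * (N z ^+ 2 + N z ^+ 4).
Proof.
have [sz|nz] := pselect (cutoff_supp w z); last first.
  rewrite cutoff_out// mul0r big1 ?mulr0 ?oppr0 ?add0r; first exact: mulr_ge0 K0 (N4 z).
  by move=> l _; exact: (flux_out clC th0).
have -> : K * (N z ^+ 2 + N z ^+ 4) = \sum_(l < n.*2.+1) C4 * (N z ^+ 2 + N z ^+ 4).
  by rewrite sumr_const card_ord /K -mulrA mulr_natl.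
rewrite !mulr_sumr -sumrN -big_split/=.
by apply: ler_sum => l _; exact: cutoff_elliptic.
Qed.

Let nE p := norm_dw w lam X J h p.
Let nnE p := norm_nabla_dw w lam X J h Gh G p.
Definition energy p := nE p ^+ 2 + nE p ^+ 4.

Let N_le z : O z -> box x0 r z -> box q s (f z) -> N z ^+ 2 + N z ^+ 4 <= B ^+ 4 * energy (cinv (atlas a) z).
Proof.
move=> Oz bz bf; have [az Wz cz zE] := local_domP Oz.
have := jac_le_norm2 (Gh := Gh) (G := G) htriad mh Oz B1 (sB bz) (tB bf).
rewrite -[X in norm2 _ _ _ _ _ _ _ X]zE -(norm_dwE oW sw htriad mh Wz az cz) -/(nE _) -/(N z) /energy.
have n0 : 0 <= nE (cinv (atlas a) z) by exact: sqrtr_ge0.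
move: (nE _) (N z) (normr_ge0 (jac f z) : 0 <= N z) n0 => v N0 N00 v0 NB.
have Bv0 : 0 <= B * v by rewrite mulr_ge0.
have h2 : N0 ^+ 2 <= (B * v) ^+ 2 by rewrite lerXn2r ?nnegrE.
have h4 : N0 ^+ 4 <= (B * v) ^+ 4 by rewrite lerXn2r ?nnegrE.
apply: le_trans (lerD h2 h4) _; rewrite !exprMn mulrDr lerD2r ler_wpM2r ?sqr_ge0//.
by rewrite ler_weXn2l.
Qed.

(** [Q2] lists three of the four second derivatives of a component; symmetry supplies the fourth,
    and each of the two matrix norms is a maximum of entries. *)
Let Q_le z : O z -> `|D z 0| ^+ 2 + `|D z 1| ^+ 2 <= 2 * \sum_l Q2 l z.
Proof.
move=> Oz.
have Q0 l : 0 <= Q2 l z by rewrite !addr_ge0 ?sqr_ge0.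
have S0 : 0 <= \sum_l Q2 l z by rewrite sumr_ge0.
have entry x l : x ^+ 2 <= Q2 l z -> `|x| <= Num.sqrt (\sum_l Q2 l z).
  move=> xl; rewrite -sqrtr_sqr ler_sqrt// (le_trans xl)// (bigD1 l)//= lerDl sumr_ge0//.
have Dle i : `|D z i| ^+ 2 <= \sum_l Q2 l z.
  rewrite -(sqr_sqrtr S0) lerXn2r ?nnegrE ?sqrtr_ge0//.
  apply: norm_le_entry => [|i' l]; first exact: sqrtr_ge0.
  have sym : (D z 1) 0 l = (D z 0) 1 l by exact: esym (derive_jac_sym oO sf Oz l).
  apply: (entry _ l); rewrite /Q2.
  have [q1 q2 q3] := sum_sqr3_ge ((D z 0) 0 l) ((D z 0) 1 l) ((D z 1) 1 l).
  have I2 (i0 : 'I_2) : i0 = 0 \/ i0 = 1.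
    by case: i0 => -[|[|]]// ?; [left|right]; exact/val_inj.
  case: (I2 i) => ->; case: (I2 i') => ->; [exact: q1|exact: q2| |exact: q3].
  exact: (eq_ind_r (fun v : R => v ^+ 2 <= _) q2 sym).
by rewrite mulr_natl mulr2n lerD.
Qed.

Definition patch_const : R := (2 * A / m2 * K + A) * B ^+ 4.

Lemma patch_const_ge0 : 0 <= patch_const.
Proof.
apply: mulr_ge0 (exprn_ge0 _ B0); apply: addr_ge0 A0; apply: mulr_ge0 K0.
exact: divr_ge0 (mulr_ge0 (ler0n _ _) A0) (ltW m20).
Qed.

Lemma energy_ge0 p : 0 <= energy p.
Proof. exact: addr_ge0 (sqr_ge0 _) (exprn_ge0 4 (sqrtr_ge0 _)). Qed.

Let SQ0 z : 0 <= \sum_l Q2 l z.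
Proof.
by apply: sumr_ge0 => l _; exact: addr_ge0 (addr_ge0 (sqr_ge0 _) (sqr_ge0 _)) (sqr_ge0 _).
Qed.

Let th_ge0 z : 0 <= cutoff w z.
Proof. by rewrite /cutoff; case: ifP => // _; exact: sqr_ge0. Qed.

Lemma patch_density_le z : box x0 r z ->
  patch_density z <= patch_const * energy (cinv (atlas a) z).
Proof.
move=> bz; have [sz|nz] := pselect (cutoff_supp w z); last first.
  rewrite /patch_density big1 ?mulr0.
    exact: mulr_ge0 patch_const_ge0 (energy_ge0 _).
  by move=> l _; exact: (flux_out clC th0).
have [Oz _ bf] := sz.
exact: (patch_algebra A0 m20 K0 (th_ge0 z) (SQ0 z) (N_le Oz bz bf) (cutoff_elliptic_sum z) (N4 z)).1.
Qed.

Lemma patch_density_inner z : box x0 r z -> O z ->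
  dot (z - x0) (z - x0) < r ^+ 2 / 2 -> dot (f z - q) (f z - q) < s ^+ 2 / 2 ->
  nnE (cinv (atlas a) z) ^+ 2 <= patch_const * energy (cinv (atlas a) z) - patch_density z.
Proof.
move=> bz Oz iz fz.
have bf : box q s (f z) by exact: inner_box.
have [_ inner] := patch_algebra A0 m20 K0 (th_ge0 z) (SQ0 z) (N_le Oz bz bf) (cutoff_elliptic_sum z) (N4 z).
have mt := cutoff_inner Oz iz fz.
have H := inner _ (nnE (cinv (atlas a) z) ^+ 2) mt (Q_le Oz).
apply: H.
have [az Wz cz zE] := local_domP Oz.
rewrite /nnE (norm_nabla_dwE oW sw htriad mh cGh cG Wz az cz) zE.
apply: le_trans (sqr_sqrtr_le _) _.
by have := nnorm2_bound (h := h) (Gh := Gh) (G := G) oW htriad sw Oz B1 (sB bz) (tB bf); rewrite addrA.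
Qed.

Lemma patch_density_continuous z : {for z, continuous patch_density}.
Proof.
have cc : {for z, continuous (fun _ : E2 => 4 * A * C0 / m2 : R)} by exact: cst_continuous.
by apply: (cvgM cc); apply: continuous_fsum => l; exact: cutoff_flux_continuous.
Qed.

Lemma integral_patch_density :
  (\int[lebesgue_measure \x lebesgue_measure]_(z in @row2 R @^-1` box x0 r) (patch_density (row2 z))%:E = 0)%E.
Proof.
have iF l : (lebesgue_measure \x lebesgue_measure)%E.-integrable (@row2 R @^-1` box x0 r)
   (EFin \o (F l \o @row2 R)).
  by apply: (box_integrable openT) => // z _; exact: cutoff_flux_continuous.
have mb := box_measurable x0 r.
under eq_integral do rewrite /patch_density EFinM -sumEFin.
rewrite integralZl//; last first.
  apply: (eq_integrable mb (fun z => \sum_l (EFin \o (F l \o @row2 R)) z)%E) => //.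
  exact: integrable_sum.
rewrite integral_sum// big1 ?mule0// => l _.
exact: integral_cutoff_flux.
Qed.

End map.
End estimates.

(** L is fixed before w. The upper bound on D over the whole square is what permits adding patches
    and enlarging the domain of integration; the last clause is the estimate proper, on the inner
    disc and only where w enters the inner ball of the target. *)
Lemma target_patch : exists2 L : R, 0 <= L & forall w, contact_instanton W w lam X J j ->
  exists D : E2 -> R,
  [/\ forall z, {for z, continuous D},
      (\int[lebesgue_measure \x lebesgue_measure]_(z in @row2 R @^-1` box x0 r) (D (row2 z))%:E = 0)%E,
      forall z, box x0 r z -> D z <= L * energy w (cinv (atlas a) z)
    & forall z, box x0 r z -> dot (z - x0) (z - x0) < r ^+ 2 / 2 ->
        cdom (atlas c) (w (cinv (atlas a) z)) ->
        let y := local_rep w a c z in dot (y - q) (y - q) < s ^+ 2 / 2 ->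
        norm_nabla_dw w lam X J h Gh G (cinv (atlas a) z) ^+ 2 <=
          L * energy w (cinv (atlas a) z) - D z].
Proof.
(* A single B >= 1 for the source square and the target cube, chosen before any w is introduced. *)
have [B [[sB tB] B1]] := filter_ex (filterI (filterI
  (source_bounds oW cj mh cGh (box_compact (r := r)) bW)
  (target_bounds htriad cG (box_compact (r := s)) bM)) (nbhs_pinfty_ge (num_real 1))).
exists (patch_const B); first exact: patch_const_ge0.
move=> w hw; exists (patch_density B w); split.
- exact: patch_density_continuous.
- exact: integral_patch_density.
- by move=> z bz; exact: patch_density_le.
move=> z bz iz cz y fz; apply: patch_density_inner => //.
have [p [ap Wp] pz] := bW bz.
by move: cz; rewrite -pz cmapK// => cz; exact: local_dom_intro.
Qed.

End target_patch.

(** * Area measure and Lebesgue measure *)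

Section integral_comparison.
Context d (T : measurableType d) (R : realType).
Variables (m1 m2 : {measure set T -> \bar R}) (K : R) (A : set T).
Hypotheses (K0 : 0 <= K)
  (mK : forall B, measurable B -> B `<=` A -> (m1 B <= K%:E * m2 B)%E).

Import HBNNSimple.

(** The integral of a nonnegative function is the supremum over the simple functions below it, so it
    suffices to compare the measures of level sets. *)
Lemma le_integral_measure (F : T -> \bar R) : (forall x, A x -> (0 <= F x)%E) ->
  (\int[m1]_(x in A) F x <= K%:E * \int[m2]_(x in A) F x)%E.
Proof.
move=> F0; rewrite (ge0_integralE m1)// (ge0_integralE m2)//.
apply: ge_ereal_sup => _ [g /= gF <-].
apply: (@le_trans _ _ (K%:E * sintegral m2 g)%E); last first.
  by apply: lee_wpmul2l => //; apply: ereal_sup_ubound; exists g.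
rewrite !sintegralE ge0_mule_fsumr; last first.
  move=> x; have [x0|x0] := leP 0 x; first by rewrite mule_ge0// lee_fin.
  rewrite preimage10 ?measure0 ?mule0// => -[y _ yx].
  have gy : 0 <= g y by exact: fun_ge0.
  by move: gy; rewrite yx leNgt x0.
apply: lee_fsum => [|x [y _ yx]]; first exact: fimfunP.
have x0 : 0 <= x by rewrite -yx; exact: fun_ge0.
have [->|xn0] := eqVneq x 0; first by rewrite !mul0e mule0.
rewrite muleCA; apply: lee_wpmul2l; first by rewrite lee_fin.
apply: mK; first exact: measurable_funPTI.
(* A simple function below F extended by zero is at most 0 off A, so its level sets at nonzero
   values lie in A, where the measures are comparable. *)
move=> t /= gt; apply: contrapT => nA.
have := gF t; rewrite patchE memNset// gt lee_fin => xle.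
by move: xn0; rewrite eq_le xle x0.
Qed.

End integral_comparison.

Section area.
Variables (R : realType) (S : manifold R 1) (W : set S) (h : tensor2 S).
Hypotheses (oW : open W) (mh : is_metric W h).
Variable mu : {measure set (borel S) -> \bar R}.
Hypothesis hmu : is_area_measure W h mu.
Local Notation E2 := 'rV[R]_2.
Local Notation row2 := (@row2 R).
Local Notation leb2 := (lebesgue_measure \x lebesgue_measure)%E.

Lemma borel_open (U : set S) : open U -> measurable (U : set (borel S)).
Proof. by move=> oU; exact: sub_sigma_algebra. Qed.

Lemma borel_compact (K : set S) : compact K -> measurable (K : set (borel S)).
Proof.
move=> /(compact_closed (@manifold_hausdorff _ _ S)) cK.
by rewrite -(setCK K); apply: measurableC; apply: borel_open; exact: closed_openC.
Qed.

Lemma borel_continuous (U : set S) (g : S -> R) : open U ->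
  (forall p, U p -> {for p, continuous g}) -> measurable_fun (U : set (borel S)) (g : borel S -> R).
Proof.
move=> oU cg mU.
apply: (measurability _ (measurable_realfun.RGenOpens.measurableE R)).
move=> _ [_ [a [b ->] <-]].
apply: borel_open; rewrite openE => p [Up gp].
apply: filterI; first exact: open_nbhs_nbhs.
by apply: (cg _ Up); apply: open_nbhs_nbhs; split => //; exact: interval_open.
exact: mU.
Qed.

Variables (a : idx S) (x0 : E2) (r : R).
Hypotheses (r0 : 0 < r) (bW : box x0 r `<=` cimg W a).
Let psi := cinv (atlas a).

Let oC : open (cimg W a). Proof. exact: cimg_openW. Qed.

Let bchart z : box x0 r z -> [/\ cdom (atlas a) (psi z), W (psi z) & cmap (atlas a) (psi z) = z].
Proof. by move=> /bW[p [ap Wp] <-]; rewrite /psi cmapK. Qed.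

Let psi_cont z : cimg W a z -> {for z, continuous psi}.
Proof. by move=> [p [ap _] <-]; apply: cinv_cont; exists p. Qed.

(** The image of the chart is open, so it contains points slightly beyond the edge of the closed
    square; one of them is taken. *)
Let outside : {p | ~ (psi @` box x0 r) p}.
Proof.
apply: cid.
have e1 : `|basis_vec R (0 : 'I_2)| = 1.
  apply: le_anti; rewrite normr_basis/=.
  by have := entry_le_norm (basis_vec R (0 : 'I_2)) 0 0; rewrite mxE !eqxx normr1.
pose z1 := x0 + r *: basis_vec R 0.
have b1 : box x0 r z1 by rewrite /box/= /z1 addrC addKr normrZ e1 mulr1 (ger0_norm (ltW r0)).
have [d d0 dW] := open_normP oC (bW b1).
pose z2 := z1 + d *: basis_vec R 0.
have c2 : cimg W a z2 by apply: dW; rewrite /z2 addrC addKr normrZ e1 mulr1 (ger0_norm (ltW d0)).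
exists (psi z2) => -[z bz zz2].
have z2E : z2 = z.
  have [p [ap _] pz] := c2; have [_ _ <-] := bchart bz.
  by rewrite zz2 -pz /psi cmapK.
have z2x : z2 - x0 = (r + d) *: basis_vec R 0.
  by apply/rowP => k; rewrite !mxE; ring.
move: bz; rewrite -z2E /box/= z2x normrZ e1 mulr1.
by rewrite (ger0_norm (addr_ge0 (ltW r0) (ltW d0))) gerDl leNgt d0.
Qed.

(* Everything off the box is sent to one point outside psi(box), so that the
   preimage of a subset of psi(box) stays in the box. *)
Definition chart_extend (z : R * R) : borel S :=
  if `[< box x0 r (row2 z) >] then psi (row2 z) else sval outside.

Lemma chart_extendE (B : set S) : B `<=` psi @` box x0 r ->
  chart_extend @^-1` B = row2 @^-1` (cmap (atlas a) @` B).
Proof.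
move=> Bb; apply/seteqP; split => z /=; rewrite /chart_extend.
  case: asboolP => [bz Bz|_ /Bb]; last by case: outside.
  by exists (psi (row2 z)) => //; have [_ _] := bchart bz.
move=> [p Bp pz]; have [y yb yp] := Bb _ Bp.
have yz : y = row2 z by rewrite -pz -yp; have [_ _] := bchart yb.
by rewrite asboolT -yz// yp.
Qed.

Lemma chart_extend_img (I : set E2) : I `<=` box x0 r ->
  chart_extend @^-1` (psi @` I) = row2 @^-1` I.
Proof.
move=> Ib; rewrite chart_extendE; last exact: image_subset.
apply/seteqP; split => z /=.
  by move=> [_ [y Iy <-] <-]; have [_ _ ->] := bchart (Ib _ Iy).
by move=> Iz; exists (psi (row2 z)); [exists (row2 z)|have [_ _] := bchart (Ib _ Iz)].
Qed.

Lemma chart_extend_measurable :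
  measurable_fun setT (chart_extend : measurableTypeR R * measurableTypeR R -> borel S).
Proof.
apply: measurability; first by [].
move=> _ [V oV <-]; rewrite setTI.
have mb := box_measurable x0 r.
have -> : chart_extend @^-1` V = (row2 @^-1` (cimg W a `&` psi @^-1` V) `&` row2 @^-1` box x0 r) `|`
    ((if `[< V (sval outside) >] then setT else set0) `&` ~` (row2 @^-1` box x0 r)).
  apply/seteqP; split => z /=; rewrite /chart_extend.
    have [bz|bz] := pselect (box x0 r (row2 z)); last by rewrite asboolF// => Vo; right; rewrite asboolT.
    by rewrite asboolT// => Vz; left; split => //; split => //; exact: bW.
  move=> [[[_ Vz] bz]|[Vo bz]]; first by rewrite asboolT.
  by rewrite asboolF//; move: Vo; case: asboolP.
apply: measurableU; apply: measurableI => //; last exact: measurableC.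
  apply: open_measurable2; rewrite openE => z [cz Vz]; apply: filterI.
    exact: (@open_nbhs_nbhs _ z _ (conj oC cz)).
  exact: (psi_cont cz (open_nbhs_nbhs (conj oV Vz))).
by case: ifP.
Qed.

Let sd (z : E2) : R := Num.sqrt (\det (h a z)).

Let sd_cont z : cimg W a z -> {for z, continuous sd}.
Proof.
move=> cz.
have [sh _ _ _] := mh.
have dh : differentiable (h a) z := smooth_diff oC (sh a) cz.
have dd : differentiable (fun z => \det (h a z)) z.
  have -> : (fun z => \det (h a z)) = (fun z => h a z 0 0 * h a z 1 1) - (fun z => h a z 0 1 * h a z 1 0).
    by apply/funext => y; rewrite det22E.
  by apply: differentiableB; apply: differentiableM; exact: differentiable_entry.
exact: (continuous_comp (differentiable_continuous dd) (@sqrt_continuous R _)).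
Qed.

Let sd_gt0 z : cimg W a z -> 0 < sd z.
Proof. by move=> /(metric_entries mh)[]; rewrite sqrtr_gt0. Qed.

Let sd_measurable (B : set (measurableTypeR R * measurableTypeR R)) :
  B `<=` row2 @^-1` box x0 r -> measurable B -> measurable_fun B (sd \o row2).
Proof.
move=> Bb mB.
have := continuous_measurable2 oC sd_cont.
apply: measurable_funS; first by exact: open_measurable2.
by move=> z /Bb /bW.
Qed.

Let preimage_sub (B : set S) : B `<=` psi @` box x0 r -> row2 @^-1` (cmap (atlas a) @` B) `<=` row2 @^-1` box x0 r.
Proof. by move=> Bb z /= [p /Bb[y yb <-] <-]; have [_ _ ->] := bchart yb. Qed.

Let preimage_measurable (B : set (borel S)) : measurable B -> B `<=` psi @` box x0 r ->
  measurable (row2 @^-1` (cmap (atlas a) @` B) : set (measurableTypeR R * measurableTypeR R)).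
Proof.
move=> mB Bb; rewrite -(chart_extendE Bb) -[_ @^-1` _]setTI.
exact: chart_extend_measurable.
Qed.

Let area_sub (B : set S) : B `<=` psi @` box x0 r -> B `<=` cdom (atlas a) `&` W.
Proof. by move=> Bb p /Bb[y /bchart[? ? _] <-]. Qed.

(** Lebesgue measure carried to the surface. On the image of the square, mu has density sqrt(det h)
    with respect to it, bounded above and away from zero by compactness; hence the two comparisons
    below. *)
Let nu := pushforward leb2 chart_extend.

Lemma area_le : exists2 K, 0 <= K & forall B : set (borel S), measurable B ->
  B `<=` psi @` box x0 r -> (mu B <= K%:E * nu B)%E.
Proof.
have [K K0 sdK] := @compact_bound _ _ _ (box_compact (r := r)) _ sd (fun z zb => sd_cont (bW zb)).
exists K; [exact: ltW|move=> B mB Bb].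
have mB' := preimage_measurable mB Bb.
rewrite (hmu mB (area_sub Bb)) /nu /pushforward chart_extendE//.
rewrite -(integral_cst leb2 mB'); apply: ge0_le_integral => //; first by apply/measurable_EFinP; exact: sd_measurable (preimage_sub Bb) mB'.
move=> z /(preimage_sub Bb) zb; rewrite lee_fin.
by apply: le_trans (sdK _ zb); exact: ler_norm.
Qed.

Lemma le_area : exists2 K, 0 <= K & forall B : set (borel S), measurable B ->
  B `<=` psi @` box x0 r -> (nu B <= K%:E * mu B)%E.
Proof.
have ci z : box x0 r z -> {for z, continuous (fun z => (sd z)^-1)}.
  by move=> zb; exact: (cvgV (lt0r_neq0 (sd_gt0 (bW zb))) (sd_cont (bW zb))).
have [K K0 sdK] := @compact_bound _ _ _ (box_compact (r := r)) _ (fun z => (sd z)^-1) ci.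
exists K; [exact: ltW|move=> B mB Bb].
have mB' := preimage_measurable mB Bb.
rewrite (hmu mB (area_sub Bb)) /nu /pushforward chart_extendE//.
have /measurable_EFinP ms := sd_measurable (preimage_sub Bb) mB'.
have s0 z : (row2 @^-1` (cmap (atlas a) @` B)) z -> (0 <= (sd (row2 z))%:E)%E.
  by move=> _; rewrite lee_fin sqrtr_ge0.
have K0' : (0 <= K%:E)%E by rewrite lee_fin ltW.
rewrite -(@ge0_integralZl _ _ _ leb2 _ mB' _ ms _ s0 K0').
have := integral_cst leb2 mB' 1; rewrite mul1e => <-.
apply: ge0_le_integral => //; first exact: measurable_funeM.
move=> z /(preimage_sub Bb) zb; rewrite -EFinM lee_fin.
have sz := sd_gt0 (bW zb).
rewrite -ler_pdivrMr// mul1r; apply: le_trans (sdK _ zb); exact: ler_norm.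
Qed.

Lemma chart_integral (I : set E2) (F : borel S -> \bar R) : I `<=` box x0 r ->
  measurable (psi @` I : set (borel S)) ->
  measurable_fun (psi @` I : set (borel S)) F -> (forall p, (0 <= F p)%E) ->
  (\int[nu]_(p in psi @` I) F p = \int[leb2]_(z in row2 @^-1` I) F (psi (row2 z)))%E.
Proof.
move=> Ib mI mF F0.
rewrite /nu (ge0_integral_pushforward chart_extend_measurable)//.
rewrite chart_extend_img//; apply: eq_integral => z /set_mem /= Iz.
by rewrite /chart_extend asboolT//; exact: Ib.
Qed.

Let nu' : {measure set (borel S) -> \bar R} :=
  measure_function_pushforward__canonical__measure_function_Measure leb2 chart_extend_measurable.

Lemma area_integral_le : exists2 K, 0 <= K & forall (I : set E2) (F : borel S -> \bar R),
  I `<=` box x0 r -> measurable (psi @` I : set (borel S)) ->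
  measurable_fun (psi @` I : set (borel S)) F -> (forall p, (0 <= F p)%E) ->
  (\int[mu]_(p in psi @` I) F p <= K%:E * \int[leb2]_(z in row2 @^-1` I) F (psi (row2 z)))%E.
Proof.
have [K K0 muK] := area_le; exists K => // I F Ib mI mF F0.
rewrite -chart_integral//.
apply: (@le_integral_measure _ _ _ mu nu') => // B mB BI; apply: muK => //.
by apply: subset_trans BI _; exact: image_subset.
Qed.

Lemma le_area_integral : exists2 K, 0 <= K & forall (I : set E2) (F : borel S -> \bar R),
  I `<=` box x0 r -> measurable (psi @` I : set (borel S)) ->
  measurable_fun (psi @` I : set (borel S)) F -> (forall p, (0 <= F p)%E) ->
  (\int[leb2]_(z in row2 @^-1` I) F (psi (row2 z)) <= K%:E * \int[mu]_(p in psi @` I) F p)%E.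
Proof.
have [K K0 muK] := le_area; exists K => // I F Ib mI mF F0.
rewrite -chart_integral//.
apply: (@le_integral_measure _ _ _ nu' mu) => // B mB BI; apply: muK => //.
by apply: subset_trans BI _; exact: image_subset.
Qed.

End area.

(** * Covering arguments *)

Section source_patch.
Variables (R : realType) (n : nat) (S : manifold R 1) (M : manifold R n.*2).
Local Notation E := 'rV[R]_n.*2.+1.
Local Notation E2 := 'rV[R]_2.
Local Notation row2 := (@row2 R).
Local Notation leb2 := (lebesgue_measure \x lebesgue_measure)%E.
Variables (W : set S).
Variables (lam : one_form M) (X : vector_field M) (J : tensor2 M) (j h : tensor2 S).
Variables (Gh : connection S) (G : connection M).
Hypotheses (oW : open W) (htriad : is_contact_triad lam X J).
Hypotheses (cj : is_complex_structure j) (mh : is_metric W h).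
Hypotheses (cGh : is_connection W Gh) (cG : is_connection setT G).
Hypothesis hM : compact [set: M].

Lemma inner_open m (T : manifold R m) (c : idx T) (q : 'rV[R]_m.+1) (s : R) :
  open [set p | cdom (atlas c) p /\
                dot (cmap (atlas c) p - q) (cmap (atlas c) p - q) < s ^+ 2 / 2].
Proof.
rewrite openE => p [cp dp]; apply: filterI.
  exact: (@open_nbhs_nbhs _ p _ (conj (@cdom_open _ _ _ (atlas c)) cp)).
have cd : {for p, continuous (fun p => dot (cmap (atlas c) p - q) (cmap (atlas c) p - q))}.
  exact: (continuous_comp (cmap_cont cp) (differentiable_continuous (dot_diff q _))).
exact: (cd _ (@open_nbhs_nbhs _ _ _ (conj (@open_lt R (s ^+ 2 / 2)) dp))).
Qed.

Section box.
Variables (a : idx S) (x0 : E2) (r : R).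
Hypotheses (r0 : 0 < r) (bW : box x0 r `<=` cimg W a).
Let psi := cinv (atlas a).
Let I : set E2 := [set z | dot (z - x0) (z - x0) < r ^+ 2 / 2].

(** A property of target sets designed to pass to finite unions, so that compactness of M yields it
    for all of M. *)
Let patch_bound (V : set M) := exists2 L : R, 0 <= L &
  forall w, contact_instanton W w lam X J j -> exists D : E2 -> R,
  [/\ forall z, {for z, continuous D},
      (\int[leb2]_(z in row2 @^-1` box x0 r) (D (row2 z))%:E = 0)%E,
      forall z, box x0 r z -> D z <= L * energy lam X J h w (psi z)
    & forall z, box x0 r z -> I z -> V (w (psi z)) ->
        norm_nabla_dw w lam X J h Gh G (psi z) ^+ 2 <=
          L * energy lam X J h w (psi z) - D z].

Let target_nbhd (m : M) : exists V, [/\ open V, V m & patch_bound V].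
Proof.
pose c := chart_at m; pose q := cmap (atlas c) m.
have cm : cdom (atlas c) m by exact: chart_atP.
have oc : open (cimg [set: M] c) by apply: cimg_openW; exact: openT.
have cq : cimg [set: M] c q by exact: cimg_intro.
have [s s0 sc] := open_normP oc cq.
have bM : box q s `<=` cimg setT c by exact: sc.
exists [set p | cdom (atlas c) p /\ dot (cmap (atlas c) p - q) (cmap (atlas c) p - q) < s ^+ 2 / 2].
split; first exact: inner_open.
  split=> //; rewrite -/q subrr dotE big1 ?divr_gt0 ?exprn_gt0// => i _.
  by rewrite mxE mul0r.
have [L L0 HL] := target_patch oW htriad cj mh cGh cG r0 bW s0 bM.
exists L => // w hw; have [D [cD iD uD lD]] := HL w hw.
exists D; split => // z bz Iz [cz fz]; exact: lD.
Qed.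

Let patch_bound0 : patch_bound set0.
Proof.
exists 0 => // w hw; exists (fun=> 0); split => //.
- by move=> z; exact: cst_continuous.
- by apply: integral0_eq => z _.
- by move=> z _; rewrite mul0r.
Qed.

(** The densities are added. At a point sent into V the second patch contributes L' times the energy
    minus D', which is nonnegative by its upper bound and can only weaken the estimate of the
    first. *)
Let patch_boundU V V' : patch_bound V -> patch_bound V' -> patch_bound (V `|` V').
Proof.
move=> [L L0 HL] [L' L0' HL']; exists (L + L'); first exact: addr_ge0.
move=> w hw; have [D [cD iD uD lD]] := HL w hw; have [D' [cD' iD' uD' lD']] := HL' w hw.
exists (fun z => D z + D' z); split.
- by move=> z; exact: (cvgD (cD z) (cD' z)).
- have iD0 := box_integrable openT (@subsetT _ (box x0 r)) (fun z _ => cD z).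
  have iD0' := box_integrable openT (@subsetT _ (box x0 r)) (fun z _ => cD' z).
  have := integralD (box_measurable x0 r) iD0 iD0'.
  move=> H; refine (etrans _ (etrans H _)); first by apply: eq_integral => z _; exact: EFinD.
  exact: etrans (congr2 (fun a b : \bar R => (a + b)%E) iD iD') (adde0 _).
- by move=> z bz; rewrite mulrDl lerD ?uD ?uD'.
move=> z bz Iz; rewrite mulrDl; have := uD z bz; have := uD' z bz.
move=> h1 h2 [/(lD z bz Iz)|/(lD' z bz Iz)].
all: move: h1 h2; move: (L * _) (L' * _) (D z) (D' z) (_ ^+ 2) => *; lra.
Qed.

Let patch_boundT : patch_bound setT.
Proof.
have [V HV] := choice target_nbhd.
move: hM; rewrite compact_cover => /(_ M setT V)[].
- by move=> m _; have [] := HV m.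
- by move=> m _; exists m => //; have [] := HV m.
move=> D' _ cov.
have seqb (l : seq M) : patch_bound [set p | exists2 m, m \in l & V m p].
  elim: l => [|m l IH].
    by rewrite (_ : mkset _ = set0)//; apply/seteqP; split => // p [].
  rewrite (_ : mkset _ = V m `|` [set p | exists2 m, m \in l & V m p]); last first.
    apply/seteqP; split => p.
      move=> [m']; rewrite inE => /orP[/eqP ->|m'l Vp]; first by left.
      by right; exists m'.
    move=> [Vp|[m' m'l Vp]]; first by exists m => //; rewrite mem_head.
    by exists m' => //; rewrite inE m'l orbT.
  by apply: patch_boundU => //; have [] := HV m.
have /finite_seqP[l lE] := finite_fset D'.
have -> : setT = [set p | exists2 m, m \in l & V m p].
  apply/seteqP; split => // p _; have [m mD Vp] := cov p Logic.I; exists m => //.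
  by move: mD; rewrite lE.
exact: seqb.
Qed.

Lemma chart_continuous (g : S -> R) z : (forall p, W p -> {for p, continuous g}) ->
  cimg W a z -> {for z, continuous (g \o psi)}.
Proof.
move=> cg [p [ap Wp] pz].
apply: continuous_comp; first by apply: cinv_cont; exists p.
by rewrite -pz /psi cmapK//; exact: cg.
Qed.

Definition density w p : R :=
  norm_dw w lam X J h p ^+ 2 + norm_nabla_dw w lam X J h Gh G p ^+ 2.

Lemma energy_continuous w p : smooth_map W w -> W p -> {for p, continuous (energy lam X J h w)}.
Proof.
move=> sw Wp; have c1 := norm_dw_continuous oW sw htriad mh Wp.
by apply: cvgD; apply: (continuous_comp c1 (@exprn_continuous _ _ _)).
Qed.

Lemma density_continuous w p : smooth_map W w -> W p -> {for p, continuous (density w)}.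
Proof.
move=> sw Wp; have c1 := norm_dw_continuous oW sw htriad mh Wp.
have c2 := norm_nabla_dw_continuous oW sw htriad mh cGh cG Wp.
apply: cvgD; first exact: (continuous_comp c1 (@exprn_continuous _ _ _)).
exact: (continuous_comp c2 (@exprn_continuous _ _ _)).
Qed.

Lemma density_ge0 w p : 0 <= density w p.
Proof. by apply: addr_ge0; exact: sqr_ge0. Qed.

Lemma source_patch : exists2 L : R, 0 <= L & forall w, contact_instanton W w lam X J j ->
  (\int[leb2]_(z in row2 @^-1` I) (density w (psi (row2 z)))%:E <=
   L%:E * \int[leb2]_(z in row2 @^-1` box x0 r) (energy lam X J h w (psi (row2 z)))%:E)%E.
Proof.
have [L L0 HL] := patch_boundT; exists (L + 1); first by rewrite addr_ge0.
move=> w hw; have [D [cD iD uD lD]] := HL w hw.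
have sw := hw.1.
have oC : open (cimg W a) by exact: cimg_openW.
pose g := energy lam X J h w \o psi; pose f := density w \o psi.
have cg z : cimg W a z -> {for z, continuous g}.
  by apply: chart_continuous => p; exact: energy_continuous.
have cf z : cimg W a z -> {for z, continuous f}.
  by apply: chart_continuous => p; exact: density_continuous.
(* The extra 1 pays for |dw|^2 in the density. As H is nonnegative on the square, its integral may
   be extended from the inner disc to the square, where D integrates to zero. *)
pose H z := (L + 1) * g z - D z.
have g0 z : 0 <= g z by exact: energy_ge0.
have H0 z : box x0 r z -> 0 <= H z.
  move=> bz; have : D z <= L * g z := uD z bz.
  have := g0 z; rewrite /H mulrDl mul1r; by move: (L * g z) (g z) (D z) => *; lra.
have IB : I `<=` box x0 r by move=> z; exact: inner_box.
have fH z : I z -> f z <= H z.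
  move=> Iz; have h2 : norm_nabla_dw w lam X J h Gh G (psi z) ^+ 2 <= L * g z - D z.
    exact: lD z (IB _ Iz) Iz Logic.I.
  have h1 : norm_dw w lam X J h (psi z) ^+ 2 <= g z.
    by rewrite /g/= lerDl exprn_ge0// sqrtr_ge0.
  have -> : H z = g z + (L * g z - D z) by rewrite /H; ring.
  exact: lerD h1 h2.
have cH z : cimg W a z -> {for z, continuous H}.
  move=> cz; have cc : {for z, continuous (fun _ : E2 => L + 1 : R)} by exact: cst_continuous.
  exact: (cvgB (cvgM cc (cg _ cz)) (cD z)).
have mI : measurable (row2 @^-1` I : set (measurableTypeR R * measurableTypeR R)).
  apply: open_measurable2; rewrite openE => z Iz.
  exact: (differentiable_continuous (dot_diff x0 z) (@open_nbhs_nbhs _ _ _ (conj (@open_lt R (r ^+ 2 / 2)) Iz))).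
have mb := box_measurable x0 r.
have mU := open_measurable2 oC.
have sI : row2 @^-1` I `<=` row2 @^-1` cimg W a by move=> z /IB/bW.
have mf : measurable_fun (row2 @^-1` I : set (measurableTypeR R * measurableTypeR R)) (EFin \o (f \o row2)).
  by apply/measurable_EFinP; exact: measurable_funS (continuous_measurable2 oC cf).
have mH : measurable_fun (row2 @^-1` box x0 r : set (measurableTypeR R * measurableTypeR R)) (EFin \o (H \o row2)).
  apply/measurable_EFinP; apply: measurable_funS (continuous_measurable2 oC cH) => //.
  by move=> z /bW.
have ig := box_integrable oC bW cg.
have iDi := box_integrable openT (@subsetT _ (box x0 r)) (fun z _ => cD z).
apply: (@le_trans _ _ (\int[leb2]_(z in row2 @^-1` I) (EFin \o (H \o row2)) z)%E).
  apply: ge0_le_integral => //.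
  - by move=> z _; rewrite lee_fin density_ge0.
  - by apply: measurable_funS mH => // z /IB.
  - by move=> z Iz; rewrite lee_fin fH.
apply: (@le_trans _ _ (\int[leb2]_(z in row2 @^-1` box x0 r) (EFin \o (H \o row2)) z)%E).
  apply: ge0_subset_integral => //; first by move=> z bz; rewrite lee_fin H0.
  by move=> z /IB.
have iLg : leb2.-integrable (row2 @^-1` box x0 r) (fun z => ((L + 1)%:E * (EFin \o (g \o row2)) z)%E).
  exact: integrableZl.
have EH := integralB mb iLg iDi.
rewrite le_eqVlt; apply/orP; left; apply/eqP; refine (etrans _ (etrans EH _)).
  by apply: eq_integral => z _; rewrite /H /= EFinB EFinM.
rewrite (integralZl mb ig); exact: etrans (congr1 (fun t => (_ - t)%E) iD) (sube0 _).
Qed.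

End box.
End source_patch.

(** * Powers of the Lebesgue norms and the passage to domains *)

Section energy_norms.
Variables (R : realType) (n : nat) (S : manifold R 1) (M : manifold R n.*2).
Variables (w : S -> M) (lam : one_form M) (X : vector_field M) (J : tensor2 M) (h : tensor2 S).
Variable mu : {measure set (borel S) -> \bar R}.

(** The value x = +oo is included, so the norms need not be known to be finite. *)
Lemma poweR_invK (x : \bar R) (k : nat) : (0 < k)%N -> (0 <= x)%E ->
  ((x `^ (k%:R)^-1) ^+ k = x)%E.
Proof.
move=> k0; have kn0 : k%:R != 0 :> R by rewrite pnatr_eq0 -lt0n.
case: x => [x||]// x0.
  rewrite poweR_EFin -EFin_expe -powR_mulrn ?powR_ge0// -powRrM mulVf// powRr1//.
rewrite poweRyr ?invr_neq0//.
by case: k k0 {kn0 x0} => // k _; elim: k => // k IH; rewrite expeS IH mulyy.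
Qed.

Lemma Lp_norm_dw_expe (k : nat) (D : set S) : (0 < k)%N ->
  (Lp_norm_dw w lam X J h mu k%:R D ^+ k =
   \int[mu]_(p in D) (norm_dw w lam X J h p ^+ k)%:E)%E.
Proof.
move=> k0; rewrite /Lp_norm_dw unlock poweR_invK//; last first.
  by apply: integral_ge0 => p _; exact: poweR_ge0.
rewrite [RHS]integral_mkcond; apply: eq_integral => p _.
rewrite /patch; case: ifP => pD /=.
  by rewrite ger0_norm ?sqrtr_ge0// powR_mulrn// sqrtr_ge0.
by rewrite normr0 powR0// pnatr_eq0 -lt0n.
Qed.

End energy_norms.

Lemma integral_setU_le d (T : measurableType d) (R : realType) (mu : {measure set T -> \bar R})
    (A B : set T) (f : T -> \bar R) : measurable A -> measurable B ->
  measurable_fun (A `|` B) f -> (forall x, (0 <= f x)%E) ->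
  (\int[mu]_(x in A `|` B) f x <= \int[mu]_(x in A) f x + \int[mu]_(x in B) f x)%E.
Proof.
move=> mA mB mf f0; have mBA : measurable (B `\` A) by exact: measurableD.
have E : A `|` B = A `|` (B `\` A).
  apply/seteqP; split => x [Ax|]; [by left| |by left|by move=> []; right].
  by move=> Bx; have [Ax|nA] := pselect (A x); [left|right].
have mfB : measurable_fun B f.
  by apply: measurable_funS mf; [exact: measurableU|move=> x; right].
rewrite E in mf *; rewrite ge0_integral_setU//; last first.
  by rewrite disj_set2E setIDA setIC -setIDA setDv setI0.
by rewrite leeD2l//; apply: ge0_subset_integral => //; exact: subDsetl.
Qed.

Section estimates_on_domains.
Variables (R : realType) (n : nat) (S : manifold R 1) (M : manifold R n.*2).
Local Notation row2 := (@row2 R).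
Variables (W : set S).
Variables (lam : one_form M) (X : vector_field M) (J : tensor2 M) (j h : tensor2 S).
Variables (Gh : connection S) (G : connection M).
Hypotheses (oW : open W) (htriad : is_contact_triad lam X J).
Hypotheses (cj : is_complex_structure j) (mh : is_metric W h).
Hypotheses (cGh : is_connection W Gh) (cG : is_connection setT G).
Hypothesis hM : compact [set: M].
Variables (mu : {measure set (borel S) -> \bar R}) (hmu : is_area_measure W h mu).
Variable D2 : set S.
Hypotheses (oD : open D2) (DW : D2 `<=` W).

Let e w := energy lam X J h w.
Let f w := density lam X J h Gh G w.

Let e_measurable w : smooth_map W w ->
  measurable_fun (W : set (borel S)) (fun p : borel S => (e w p)%:E).
Proof.
move=> sw; apply/measurable_EFinP; apply: borel_continuous => // p Wp.
exact: (energy_continuous oW htriad mh sw Wp).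
Qed.

Let f_measurable w : smooth_map W w ->
  measurable_fun (W : set (borel S)) (fun p : borel S => (f w p)%:E).
Proof.
move=> sw; apply/measurable_EFinP; apply: borel_continuous => // p Wp.
exact: (density_continuous oW htriad mh cGh cG sw Wp).
Qed.

Let mW : measurable (W : set (borel S)). Proof. exact: borel_open. Qed.
Let mD : measurable (D2 : set (borel S)). Proof. exact: borel_open. Qed.
Let e0 w p : (0 <= (e w p)%:E)%E. Proof. by rewrite lee_fin energy_ge0. Qed.
Let f0 w p : (0 <= (f w p)%:E)%E. Proof. by rewrite lee_fin density_ge0. Qed.

Let estimate (U : set S) := exists2 C : R, 0 <= C &
  forall w, contact_instanton W w lam X J j ->
    (\int[mu]_(p in U) (f w p)%:E <= C%:E * \int[mu]_(p in D2) (e w p)%:E)%E.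

Lemma local_estimate p : D2 p -> exists U : set S, [/\ open U, U p, U `<=` D2 & estimate U].
Proof.
move=> Dp; pose a := chart_at p; pose x0 := cmap (atlas a) p; pose psi := cinv (atlas a).
have ap : cdom (atlas a) p by exact: chart_atP.
have [r r0 rD] := open_normP (cimg_openW oD) (cimg_intro ap Dp).
have bD : box x0 r `<=` cimg D2 a by exact: rD.
have bW : box x0 r `<=` cimg W a.
  by move=> z /bD[p' [ap' Dp'] <-]; apply: cimg_intro => //; exact: DW.
pose I := [set z : 'rV[R]_2 | dot (z - x0) (z - x0) < r ^+ 2 / 2].
have Ib : I `<=` box x0 r by move=> z; exact: inner_box.
pose U := [set p | cdom (atlas a) p /\
                   dot (cmap (atlas a) p - x0) (cmap (atlas a) p - x0) < r ^+ 2 / 2].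
have UE : U = psi @` I.
  apply/seteqP; split => p' /=; first by move=> [ap' Ip]; exists (cmap (atlas a) p') => //; exact: cmapK.
  move=> [z Iz <-]; have [p2 [ap2 _] pz] := bD _ (Ib _ Iz).
  by rewrite -pz /psi cmapK//; split => //; rewrite pz.
have bDpsi : psi @` box x0 r `<=` D2.
  by move=> p' [z /bD[p2 [ap2 Dp2] <-] <-]; rewrite /psi cmapK.
have oU : open U by exact: inner_open.
exists U; split => //.
- split=> //; rewrite -/x0 subrr dotE big1 ?divr_gt0 ?exprn_gt0// => i _.
  by rewrite mxE mul0r.
- by rewrite UE; apply: subset_trans bDpsi; exact: image_subset.
have [K1 K10 H1] := area_integral_le oW mh hmu r0 bW.
have [K2 K20 H2] := le_area_integral oW mh hmu r0 bW.
have [L L0 HL] := source_patch oW htriad cj mh cGh cG hM r0 bW.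
have mI : measurable (psi @` I : set (borel S)) by rewrite -UE; exact: borel_open.
have mb : measurable (psi @` box x0 r : set (borel S)).
  apply: borel_compact; apply: continuous_compact; last exact: box_compact.
  apply: continuous_in_subspaceT => y /set_mem /bW[p2 [ap2 _] <-].
  by apply: cinv_cont; exists p2.
(* The factor [K1] passes from area to Lebesgue measure, L is the constant of the coordinate
   estimate, and [K2] passes back to area. *)
exists (K1 * (L * K2)); first by rewrite !mulr_ge0.
move=> w hw; have sw := hw.1.
have me : measurable_fun (psi @` box x0 r : set (borel S)) (fun p : borel S => (e w p)%:E).
  by apply: measurable_funS (e_measurable sw) => // y /bDpsi/DW.
have mf : measurable_fun (psi @` I : set (borel S)) (fun p : borel S => (f w p)%:E).
  apply: measurable_funS (f_measurable sw) => // y [z /Ib bz <-].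
  by apply: DW; apply: bDpsi; exists z.
rewrite UE; apply: le_trans (H1 I _ Ib mI mf (f0 w)) _.
rewrite !EFinM -muleA; apply: lee_wpmul2l; first by rewrite lee_fin.
apply: le_trans (HL w hw) _.
rewrite -muleA; apply: lee_wpmul2l; first by rewrite lee_fin.
apply: le_trans (H2 _ _ (@subset_refl _ _) mb me (e0 w)) _.
apply: lee_wpmul2l; first by rewrite lee_fin.
apply: ge0_subset_integral => //.
by apply: measurable_funS (e_measurable sw).
Qed.

Let estimate_measurable (U : set S) := [/\ measurable (U : set (borel S)), U `<=` D2 & estimate U].

Let estimateU U V : estimate_measurable U -> estimate_measurable V -> estimate_measurable (U `|` V).
Proof.
move=> [mU UD [C C0 HC]] [mV VD [C' C0' HC']]; split.
- exact: measurableU.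
- by move=> p [/UD|/VD].
exists (C + C'); first exact: addr_ge0.
move=> w hw; apply: (@le_trans _ _ (\int[mu]_(p in U) (f w p)%:E + \int[mu]_(p in V) (f w p)%:E)%E).
  apply: integral_setU_le => //; apply: measurable_funS (f_measurable hw.1) => //.
  by move=> p [/UD|/VD] /DW.
rewrite EFinD ge0_muleDl ?lee_fin//; apply: leeD; [exact: HC|exact: HC'].
Qed.

(** Finitely many of the local neighbourhoods cover K. Each contributes a multiple of the same
    integral over D2, so the constants add up even though the neighbourhoods overlap. *)
Lemma compact_estimate (K D1 : set S) : compact K -> K `<=` D2 -> open D1 -> D1 `<=` K -> estimate D1.
Proof.
move=> cK KD oD1 D1K.
have [U HU] : exists U : S -> set S, forall p, D2 p -> [/\ open (U p), U p p, U p `<=` D2 & estimate (U p)].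
  have /choice : forall p, exists U : set S, D2 p -> [/\ open U, U p, U `<=` D2 & estimate U].
    move=> p; have [Dp|nD] := pselect (D2 p); last by exists set0.
    by have [U HU] := local_estimate Dp; exists U.
  by move=> [U HU]; exists U.
move: cK; rewrite compact_cover => /(_ S K U)[].
- by move=> p /KD/HU[].
- by move=> p Kp; exists p => //; have [] := HU p (KD _ Kp).
move=> D' D'K cov.
have /finite_seqP[l lE] := finite_fset D'.
have lK p : p \in l -> D2 p.
  move=> pl; apply: KD; have : [set` l] p by [].
  by rewrite -lE /= => /D'K; rewrite inE.
have seqb (s : seq S) : {subset s <= l} -> estimate_measurable [set p | exists2 m, m \in s & U m p].
  elim: s => [|m s IH] sl.
    rewrite (_ : mkset _ = set0); last by apply/seteqP; split => // p [].
    split => //; exists 0 => // w hw; rewrite integral_set0 mul0e//.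
  rewrite (_ : mkset _ = U m `|` [set p | exists2 m, m \in s & U m p]); last first.
    apply/seteqP; split => p.
      move=> [m']; rewrite inE => /orP[/eqP ->|m's Up]; first by left.
      by right; exists m'.
    move=> [Up|[m' m's Up]]; first by exists m => //; rewrite mem_head.
    by exists m' => //; rewrite inE m's orbT.
  apply: estimateU; last by apply: IH => m' m's; apply: sl; rewrite inE m's orbT.
  have [oU Um UD eU] := HU m (lK _ (sl _ (mem_head _ _))).
  by split => //; exact: borel_open.
have [mU UD [C C0 HC]] := seqb l (fun _ => id).
exists C => // w hw; apply: le_trans (HC w hw).
apply: ge0_subset_integral => //; first exact: borel_open.
  by apply: measurable_funS (f_measurable hw.1) => // p /UD/DW.
move=> p /D1K/cov[m mD' Up]; exists m => //.
by move: mD'; rewrite lE.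
Qed.

End estimates_on_domains.

Theorem theorem1p6 (R : realType) (n : nat)
  (M : manifold R n.*2) (hM : compact [set: M])
  (lam : one_form M) (X : vector_field M) (J : tensor2 M)
  (htriad : is_contact_triad lam X J)
  (G : connection M) (hG : is_triad_connection lam X J G)
  (S : manifold R 1) (P : set S) (j h : tensor2 S)
  (hS : is_punctured_surface P j h)
  (Gh : connection S) (hGh : is_levi_civita (~` P) h Gh)
  (mu : {measure set (borel S) -> \bar R}) (hmu : is_area_measure (~` P) h mu)
  (D1 D2 : set S)
  (hD1 : domain_in (~` P) D1) (hD1c : relatively_compact_in (~` P) D1)
  (hD2 : domain_in (~` P) D2) (hD2c : relatively_compact_in (~` P) D2)
  (hD12 : closure D1 `&` ~` P `<=` D2) :
  exists C1 C2 : R, forall w : S -> M,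
    contact_instanton (~` P) w lam X J j ->
    (W12_norm2_dw w lam X J h Gh G mu D1
     <= C1%:E * Lp_norm_dw w lam X J h mu 2 D2 ^+ 2
        + C2%:E * Lp_norm_dw w lam X J h mu 4 D2 ^+ 4)%E.
Proof.
have [cP cj mh _ _] := hS.
have oW : open (~` P) by exact: closed_openC.
have [D1W oD1 _] := hD1; have [D2W oD2 _] := hD2.
have [cGh _ _] := hGh.
(* The compact set to be covered is the closure of D1 within the punctured surface. *)
have D1K : D1 `<=` closure D1 `&` ~` P by move=> p Dp; split; [exact: subset_closure|exact: D1W].
have [C C0 HC] := compact_estimate oW htriad cj mh cGh hG.1 hM hmu oD2 D2W hD1c hD12 oD1 D1K.
(* The energy is |dw|^2 + |dw|^4, so its integral splits into the two norms and one constant serves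
   for both. *)
exists C, C => w hw; apply: le_trans (HC w hw) _.
have mD2 : measurable (D2 : set (borel S)) by exact: borel_open.
have mn k : measurable_fun (D2 : set (borel S)) (fun p : borel S => (norm_dw w lam X J h p ^+ k)%:E).
  apply/measurable_EFinP; apply: borel_continuous => // p /D2W Wp.
  exact: (continuous_comp (norm_dw_continuous oW hw.1 htriad mh Wp) (@exprn_continuous _ _ _)).
have n0 k p : (0 <= (norm_dw w lam X J h p ^+ k)%:E)%E.
  by rewrite lee_fin exprn_ge0// sqrtr_ge0.
rewrite (@Lp_norm_dw_expe _ _ _ _ w lam X J h mu 2)// (@Lp_norm_dw_expe _ _ _ _ w lam X J h mu 4)//.
rewrite -ge0_muleDr ?integral_ge0//.
rewrite -ge0_integralD//.
Qed.
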